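(* Let $0<\lambda<\mu$ and consider the Poisson matching problem $PM(\lambda,\mu)$ (defined in the context), with stable matching $\mathcal{M}_s$. Let $X$ be the matching distance in $\mathcal{M}_s$ of an arbitrary (typical) blue point. Then $$\mathbb{E}(X)\le\left(1+\ln\Bigl(\frac{\mu+\lambda}{\mu-\lambda}\Bigr)\right)\frac{1}{\mu-\lambda}.$$
   Context: Poisson matching problem $PM(\lambda,\mu)$: $\mathcal{B}$ (blue points) and $\mathcal{R}$ (red points) are independent homogeneous Poisson point processes on $\mathbb{R}$ of intensities $\lambda$ and $\mu$ respectively. A matching is a map $\mathcal{M}:\mathcal{B}\cup\mathcal{R}\to\mathcal{B}\cup\mathcal{R}\cup\{\infty\}$ with $\mathcal{M}(r)\in\mathcal{B}\cup\{\infty\}$ for red $r$, $\mathcal{M}(b)\in\mathcal{R}\cup\{\infty\}$ for blue $b$, and $\mathcal{M}(r)=b$ iff $\mathcal{M}(b)=r$. A matching is stable if there is no pair $(b,r)$ with $b\ne\mathcal{M}(r)$ and $|r-b|<\min(|r-\mathcal{M}(r)|,|b-\mathcal{M}(b)|)$. $\mathcal{M}_s$ is the stable matching produced by the following procedure: every blue point simultaneously emits two rays, one in each direction, each at distance $t$ from its emitter at time $t$; when a ray hits an unmatched red point $r$, the emitter $b$ is matched to $r$ and both leave the system. The matching distance of $x$ is $|x-\mathcal{M}_s(x)|$. *)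

(* Defs.v *)
From HB Require Import structures.
From mathcomp Require Import all_boot all_order all_algebra.
From mathcomp Require Import all_classical all_reals all_analysis.
From mathcomp Require Import measurable_realfun.
Set Implicit Arguments. Unset Strict Implicit. Unset Printing Implicit Defensive.
Import Order.TTheory GRing.Theory Num.Theory.
Local Open Scope classical_set_scope.
Local Open Scope ring_scope.

Definition ncount {R : realType} (S : set R) (k : nat) : Prop :=
  exists s : seq R, uniq s /\ S = [set x | x \in s] /\ size s = k.

(* Poisson pmf with mean m >= 0:  e^{-m} m^k / k!  (with 0^0 = 1). *)
Definition pois {R : realType} (m : R) (k : nat) : R :=
  m ^+ k / (k`!)%:R * expR (- m).

Definition bounded_borel {R : realType} (A : set R) : Prop :=
  measurable A /\ exists a b : R, A `<=` `[a, b].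

(* (B, Rd) is a pair of independent homogeneous Poisson point processes on R
   of intensities lam and mu: counting events over bounded Borel sets are
   measurable, and the joint law of the counts of B and Rd in any finite
   family of pairwise disjoint bounded Borel sets A_0..A_{n-1} is the
   product of Poisson laws with means lam|A_i| and mu|A_i|. *)
Definition poisson_pair {d : measure_display} {Omega : measurableType d}
  {R : realType} (P : probability Omega R) (lam mu : R)
  (B Rd : Omega -> set R) : Prop :=
  (forall (A : set R) (k : nat), bounded_borel A ->
     measurable [set w | ncount (B w `&` A) k] /\
     measurable [set w | ncount (Rd w `&` A) k]) /\
  (forall (n : nat) (A : 'I_n -> set R) (kB kR : 'I_n -> nat),
     (forall i, bounded_borel (A i)) ->
     (forall i j, i != j -> A i `&` A j = set0) ->
     P [set w | forall i, ncount (B w `&` A i) (kB i) /\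
                          ncount (Rd w `&` A i) (kR i)]
     = (\prod_(i < n) (pois (lam * fine (lebesgue_measure (A i))) (kB i)
                      * pois (mu * fine (lebesgue_measure (A i))) (kR i)))%:E).

Definition match_dist {R : realType} (M : R -> option R) (x : R) : \bar R :=
  match M x with Some y => (`|x - y|)%:E | None => +oo%E end.

(* M is a matching between blue points B and red points Rd
   (None encodes the point at infinity). *)
Definition is_matching {R : realType} (B Rd : set R) (M : R -> option R) : Prop :=
  (forall b, B b -> forall y, M b = Some y -> Rd y) /\
  (forall r, Rd r -> forall y, M r = Some y -> B y) /\
  (forall b r, B b -> Rd r -> (M r = Some b <-> M b = Some r)).

Definition is_stable_matching {R : realType} (B Rd : set R)
  (M : R -> option R) : Prop :=
  is_matching B Rd M /\
  (forall b r, B b -> Rd r -> M r <> Some b ->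
     ~ ((`|r - b|)%:E < Order.min (match_dist M r) (match_dist M b))%E).

(* Main.v *)
(** Cut the line into cells of length [1/N].  With high probability every cell
    near [0, 1) holds at most one point and no point is nearly equidistant from
    two others, so the configuration is a word over blue, red, empty, and
    stability becomes a statement about indices.  Call a segment good if it has a
    strictly stable perfect matching pairing its two ends.  If the blue letter at
    [0] is unmatched within distance [n] and [0..m], [m <= n], is good with a red
    end, then the red letter at [m] has a partner closer than [0]; this partner is
    not inside the segment, so it is some [k > m] with [k - m < m] and [m..k] is
    good again.  Iterating on the fresh letters to the right gives, for the
    one-sided survival probabilities [y] (blue) and [z] (red),
      [y_n = y_(n-1) - q i_n z_(n-1)],  [z_n = z_(n-1) - p i_n y_(n-1)]
    as bounds, where [p], [q] are the letter probabilities and [i_n] is the mass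
    of the interiors of good segments of length [n].  Interiors are balanced, so
    [i_n] only depends on [p q] and may be computed with equal colour weights
    [h = sqrt (p q)].  There, a word of length [n] with an odd number of points,
    continued with reversed colours at each period, has a good rotation, whence
      [h i_n >= ((o + 2 h)^n - (o - 2 h)^n) / (4 n)]  up to a negligible error.
    As [N] tends to infinity the survival probability to time [t] is at most
      [ybar t = ((1 + s) x - (s - 1) / x) / 2],
      [s = sqrt (mu / lam)],  [x^4 = (1 + d t) / (1 + D t)],
      [D, d = (sqrt mu +- sqrt lam)^2].
    The two sides of a blue point are independent and [lam ybar^2] is the
    derivative of [(sqrt ((1 + D t) (1 + d t)) - (mu - lam) t) / 2], so
    the integral of [ybar^2] is [1 / (mu - lam)].  Replacing it by a Riemann sum
    of mesh [tau] costs [2 tau], and this is where the logarithm is spent. *)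

Require Import Defs.
From HB Require Import structures.
From mathcomp Require Import all_boot all_order all_algebra finmap.
From mathcomp Require Import all_classical all_reals all_analysis.
From mathcomp Require Import measurable_realfun.
From mathcomp Require Import ring lra zify.
Set Implicit Arguments. Unset Strict Implicit. Unset Printing Implicit Defensive.
Import Order.TTheory GRing.Theory Num.Theory.

(** * Coloured words, good segments and the [avoid] recursion *)

(* [Some true] is a blue point, [Some false] a red point, [None] an empty cell. *)
Definition sym := option bool.
Definition flip : sym -> sym := omap negb.
Definition gap (x y : nat) : nat := (x - y) + (y - x).
Definition shift (i : nat) (c : nat -> sym) : nat -> sym := fun x => c (i + x).

(** The value of [f] at an empty cell is unconstrained. The last clause is strict: an opposite pair
    that is not matched is ruled out even when its distance only ties with the distances to the
    partners. *)
Definition good (c : nat -> sym) (lo hi : nat) : Prop :=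
  exists f : nat -> nat,
  [/\ c lo <> None, lo < hi, f lo = hi,
      forall x, lo <= x <= hi -> c x <> None ->
        [/\ lo <= f x <= hi, f (f x) = x & c (f x) = flip (c x)] &
      forall x y, lo <= x <= hi -> lo <= y <= hi ->
        c x <> None -> c y = flip (c x) -> f x <> y ->
        gap x (f x) < gap x y \/ gap y (f y) < gap x y].

(* What remains, at recursion depth [r], of the statement that [c 0] is not matched
   to the right within distance [n]: whenever [0..m] is a good segment, the letter at
   [m] has a partner on its right at distance less than [m]. *)
Fixpoint avoid (r n : nat) (c : nat -> sym) : Prop :=
  if r is r'.+1 then
    forall m, 0 < m <= n -> c m = flip (c 0) -> good c 0 m ->
      ~ avoid r' m.-1 (shift m c)
  else True.

Lemma flipK : involutive flip. Proof. by case=> [[]|]. Qed.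
Lemma flip_neq (s : sym) : s <> None -> flip s <> s. Proof. by case: s => [[]|]. Qed.
Lemma flip_None (s : sym) : s <> None -> flip s <> None. Proof. by case: s. Qed.
Lemma sym_dec (s t : sym) : s <> None -> t <> None -> t = s \/ t = flip s.
Proof. by case: s => [[]|]; case: t => [[]|] //; auto. Qed.

Lemma eq_good (c c' : nat -> sym) lo hi :
  (forall x, lo <= x <= hi -> c x = c' x) -> good c lo hi -> good c' lo hi.
Proof.
move=> e [f [h1 h2 h3 h4 h5]]; exists f; split=> //.
- by rewrite -e //; lia.
- move=> x hx; rewrite -(e x hx) => /(h4 x hx)[a b d]; split=> //.
  by rewrite -e.
- by move=> x y hx hy; rewrite -(e x hx) -(e y hy); exact: h5.
Qed.

Lemma good_shift (c : nat -> sym) i lo hi :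
  good (shift i c) lo hi <-> good c (i + lo) (i + hi).
Proof.
split=> -[f [h1 h2 h3 h4 h5]].
- exists (fun x => i + f (x - i)); split.
  + exact: h1.
  + lia.
  + by rewrite addKn h3.
  + move=> x hx cx.
    have [||a b d] := h4 (x - i); first lia.
      by rewrite /shift subnKC //; lia.
    rewrite addKn; split; [lia| rewrite b; lia|].
    by move: d; rewrite /shift subnKC //; lia.
  + move=> x y hx hy cx cy fxy.
    have := h5 (x - i) (y - i); rewrite /shift !subnKC; try lia.
    move=> /(_ _ _ cx cy) []; try lia; rewrite /gap; lia.
- exists (fun x => f (i + x) - i); split.
  + exact: h1.
  + lia.
  + by rewrite h3; lia.
  + move=> x hx cx.
    have [||a b d] := h4 (i + x); [lia|done|].
    split; [lia|by rewrite subnKC ?b; lia|].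
    by rewrite /shift subnKC //; lia.
  + move=> x y hx hy cx cy fxy.
    have [||a b d] := h4 (i + x); [lia|done|].
    have [||a' b' d'] := h4 (i + y); [lia|by rewrite /shift in cx cy; rewrite cy; exact: flip_None|].
    have := h5 (i + x) (i + y).
    move=> /(_ _ _ cx cy) []; try lia; rewrite /gap; lia.
Qed.

Lemma shift0 c x : shift 0 c x = c x. Proof. by []. Qed.
Lemma shift_shift i j c x : shift i (shift j c) x = shift (j + i) c x.
Proof. by rewrite /shift addnA. Qed.

Lemma eq_avoid r n c c' : (forall x, c x = c' x) -> avoid r n c -> avoid r n c'.
Proof.
elim: r n c c' => [//|r IH] n c c' e /= h m hm cm gm h2.
apply: (h m hm); first by rewrite !e.
- by apply: eq_good gm => x _; rewrite e.
- by apply: IH h2 => x; rewrite /shift e.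
Qed.

(** * Stable matchings of indices observed through a finite window *)

Section StableWindow.
Variables (col : nat -> sym) (pm : nat -> option nat) (V : nat -> Prop) (n : nat).
Hypothesis pm_sym : forall x y, pm x = Some y ->
  [/\ col x <> None, col y = flip (col x) & pm y = Some x].
Hypothesis pm_stable : forall x y, V x -> V y -> gap x y <= n ->
  col x <> None -> col y = flip (col x) -> pm x <> Some y ->
  (exists2 k, pm x = Some k & gap x k < gap x y) \/
  (exists2 k, pm y = Some k & gap y k < gap x y).

(* [V] holds at the indices where the stability of [pm] is known; [deep] keeps the
   argument on a segment away from the ends of the window. *)
Definition deep i j := (forall z, i <= z <= j -> V z) /\
  (forall x y, i <= x <= j -> pm x = Some y -> gap x y <= j - i -> V y).

(** A letter [x] between [j] and [k] has the colour opposite to one of the two ends and is closer to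
    it than that end's partner, so stability gives [x] a partner [y] closer still. If [y] lay beyond
    the other end, [y] and that end would have opposite colours and be closer to each other than to
    their own partners. *)
Lemma inside_matched j k : j < k -> k - j <= n -> deep j k -> pm j = Some k ->
  forall x, j < x < k -> col x <> None -> exists2 y, pm x = Some y & j < y < k.
Proof.
move=> jk kn [dV dP] pj x xjk cx.
have [cj ck pk] := pm_sym pj.
have Vx : V x by apply: dV; lia.
have Vj : V j by apply: dV; lia.
have Vk : V k by apply: dV; lia.
have [cxE|cxE] := sym_dec cj cx.
- have cx' : col x = flip (col k) by rewrite ck flipK.
  have ck0 : col k <> None by rewrite ck; exact: flip_None.
  have [||[z pz hz]|[y py hy]] := pm_stable Vk Vx _ ck0 cx'.
  + rewrite /gap; lia.
  + by rewrite pk => -[]; lia.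
  + by move: pz hz; rewrite pk => -[<-]; rewrite /gap; lia.
  exists y => //.
  have [_ cy py'] := pm_sym py.
  have nyj : y <> j by move=> yj; move: py'; rewrite yj pj => -[]; lia.
  have nyk : y < k by move: hy; rewrite /gap; lia.
  suff : ~ (y < j) by lia.
  move=> yj.
  have Vy : V y by apply: (dP x y) => //; move: hy; rewrite /gap; lia.
  have cy0 : col y <> None by rewrite cy; exact: flip_None.
  have [|||[z pz hz]|[z pz hz]] := pm_stable Vj Vy _ cj.
  + move: hy; rewrite /gap; lia.
  + by rewrite cy cxE.
  + by rewrite pj => -[]; lia.
  + by move: pz hz; rewrite pj => -[<-]; move: hy; rewrite /gap; lia.
  + by move: pz hz; rewrite py' => -[<-]; rewrite /gap; lia.
- have [||[z pz hz]|[y py hy]] := pm_stable Vj Vx _ cj cxE.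
  + rewrite /gap; lia.
  + by rewrite pj => -[]; lia.
  + by move: pz hz; rewrite pj => -[<-]; rewrite /gap; lia.
  exists y => //.
  have [_ cy py'] := pm_sym py.
  have nyk : y <> k by move=> yk; move: py'; rewrite yk pk => -[]; lia.
  have nyj : j < y by move: hy; rewrite /gap; lia.
  suff : ~ (k < y) by lia.
  move=> ky.
  have Vy : V y by apply: (dP x y) => //; move: hy; rewrite /gap; lia.
  have ck0 : col k <> None by rewrite ck; exact: flip_None.
  have [|||[z pz hz]|[z pz hz]] := pm_stable Vk Vy _ ck0.
  + move: hy; rewrite /gap; lia.
  + by rewrite cy cxE ck.
  + by rewrite pk => -[]; lia.
  + by move: pz hz; rewrite pk => -[<-]; move: hy; rewrite /gap; lia.
  + by move: pz hz; rewrite py' => -[<-]; rewrite /gap; lia.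
Qed.

Lemma good_of_match j k : j < k -> k - j <= n -> deep j k -> pm j = Some k ->
  good col j k.
Proof.
move=> jk kn dp pj.
have [cj ck pk] := pm_sym pj.
have IN x : j <= x <= k -> col x <> None ->
    exists2 y, pm x = Some y & j <= y <= k.
  move=> xjk cx.
  have [xj|nxj] := eqVneq x j; first by rewrite xj; exists k => //; lia.
  have [xk|nxk] := eqVneq x k; first by rewrite xk; exists j => //; lia.
  have [|y py hy] := inside_matched jk kn dp pj _ cx; first lia.
  by exists y => //; lia.
(* By [IN] every coloured cell of the segment is matched, so inside it the default [0] is taken at
   empty cells only. *)
exists (fun x => odflt 0 (pm x)); split => //.
- by rewrite pj.
- move=> x xjk cx; have [y py hy] := IN x xjk cx.
  have [_ cy py'] := pm_sym py.
  by rewrite py /= py'.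
- move=> x y hx hy cx cy fxy.
  have cy0 : col y <> None by rewrite cy; exact: flip_None.
  have [x' px hx'] := IN x hx cx.
  have [y' py hy'] := IN y hy cy0.
  rewrite px py /=; rewrite px /= in fxy.
  have [||||[z pz hz]|[z pz hz]] := pm_stable _ _ _ cx cy.
  + by apply: dp.1.
  + by apply: dp.1.
  + rewrite /gap; lia.
  + by rewrite px => -[].
  + by left; move: pz hz; rewrite px => -[<-].
  + by right; move: pz hz; rewrite py => -[<-].
Qed.

(** Descent along a chain alternating between [pm] and [f]. If [pm] joins [y] to [x] and [y] is
    closer to [x] than to [f y], stability of [f] puts [f x] closer to [x] than [y] is; stability of
    [pm] then gives [f x] a partner closer still. That partner is again strictly between [i] and
    [j], since otherwise [f x] and [i], or [j] and the partner, would be a blocking pair. The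
    lengths decrease forever, which is absurd. *)
Lemma good_excludes i j : j - i <= n -> deep i j -> good col i j ->
  (forall k, pm i = Some k -> j - i < gap i k) ->
  forall x, pm j = Some x -> ~ (i < x < j).
Proof.
move=> ijn [dV dP] [f [ci ij fi f1 f2]] ui x0 px0 x0ij.
have [|fjj ffi cj] := f1 i _ ci; first lia.
rewrite fi in ffi cj fjj.
have cj0 : col j <> None by rewrite cj; exact: flip_None.
have Vj : V j by apply: dV; lia.
have Vi : V i by apply: dV; lia.
(* Invariant of the descent: [y] has the colour of [j], is closer to [x] than to [f y], and its edge
   is no longer than the one at [j]. The last bound keeps the chain from leaving beyond [j]. *)
suff chain N : forall y x, gap y x < N -> i < y <= j -> i < x < j ->
    pm y = Some x -> col y = flip (col i) -> gap y x < gap y (f y) ->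
    gap y x <= gap j x0 -> False.
  apply: (chain (gap j x0).+1 j x0) => //; first lia.
  by rewrite ffi; rewrite /gap; lia.
elim: N => [//|N IH] y x hN yij xij pyx cy hf hd.
have [cy0 cx px] := pm_sym pyx.
have cx0 : col x <> None by rewrite cx; exact: flip_None.
have [|fx ffx cfx] := f1 x _ cx0; first lia.
have [|_ ffy _] := f1 y _ cy0; first lia.
have fxy : f x <> y by move=> e; move: hf; rewrite -e ffx; rewrite /gap; lia.
have {}cx : col y = flip (col x) by rewrite cx flipK.
have [||h|h] := f2 x y _ _ cx0 cx fxy; [lia|lia| |by move: h hf; rewrite /gap; lia].
set y2 := f x in fx ffx cfx h fxy.
have y2i : y2 <> i by move=> e; move: ffx; rewrite e fi; lia.
have y2j : y2 <> j by move=> e; move: ffx; rewrite e ffi; lia.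
have cy2 : col y2 = flip (col i) by rewrite cfx -cx cy.
have Vx : V x by apply: dV; lia.
have Vy2 : V y2 by apply: dV; lia.
have [||[z pz hz]|[x3 px3 hx3]] := pm_stable Vx Vy2 _ cx0 cfx.
- rewrite /gap; lia.
- by rewrite px => -[e]; apply: fxy.
- by move: pz hz; rewrite px => -[<-]; move: h; rewrite /gap; lia.
have [cy20 cx3 px3'] := pm_sym px3.
have Vx3 : V x3 by apply: (dP y2 x3) => //; move: hx3; rewrite /gap; lia.
have x3i : x3 <> i.
  by move=> e; move: px3'; rewrite e => /ui; rewrite /gap; lia.
have x3j : x3 <> j.
  by move=> e; move: cx3; rewrite e cy2 cj flipK; exact: flip_neq.
have {}x3i : i < x3.
  suff : ~ (x3 < i) by lia.
  move=> lt.
  have [||[z pz hz]|[z pz hz]] := pm_stable Vi Vy2 _ ci cy2.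
  - rewrite /gap; lia.
  - by move=> /ui; rewrite /gap; lia.
  - by have := ui _ pz; move: hz; rewrite /gap; lia.
  - by move: pz hz; rewrite px3 => -[<-]; rewrite /gap; lia.
have {}x3j : x3 < j.
  suff : ~ (j < x3) by lia.
  move=> lt.
  have cx3' : col x3 = flip (col j) by rewrite cx3 cy2 cj.
  have [||[z pz hz]|[z pz hz]] := pm_stable Vj Vx3 _ cj0 cx3'.
  - by move: hx3 h hN hd; rewrite /gap; lia.
  - by rewrite px0 => -[]; lia.
  - by move: pz hz; rewrite px0 => -[<-]; move: hx3 hd h; rewrite /gap; lia.
  - by move: pz hz; rewrite px3' => -[<-]; rewrite /gap; lia.
have hf2 : gap y2 x3 < gap y2 (f y2).
  by rewrite ffx; move: hx3; rewrite /gap; lia.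
have hN2 : gap y2 x3 < N by move: hx3 h hN; rewrite /gap; lia.
have hd2 : gap y2 x3 <= gap j x0 by move: hx3 h hd; rewrite /gap; lia.
by apply: (IH y2 x3 hN2 _ _ px3 cy2 hf2 hd2); lia.
Qed.

(* [Dom r i l]: there is room on the right of [i] for [r] rounds starting with
   distance [l]. *)
Variable Dom : nat -> nat -> nat -> Prop.
Hypothesis Dom_deep : forall r i l m, Dom r i l -> 0 < m <= l ->
  m <= n /\ deep i (i + m).
Hypothesis Dom_step : forall r i l m k, Dom r.+1 i l -> 0 < m <= l ->
  col (i + m) = flip (col i) ->
  pm (i + m) = Some k -> i + m < k -> k - (i + m) < m ->
  deep (i + m) k /\ Dom r k (k - (i + m)).-1.

(* Even depths only: the truncation of [avoid] is an upper bound at even depth and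
   a lower bound at odd depth. *)
Lemma unmatched_avoid r i l : Dom r i l -> col i <> None ->
  (forall k, pm i = Some k -> l < gap i k) -> avoid r.*2 l (shift i col).
Proof.
elim: r i l => [//|r IH] i l D ci ui.
rewrite doubleS => /= m hm cm /good_shift gm av.
have [mn dm] := Dom_deep D hm.
move: cm gm; rewrite /shift addn0 => cm gm.
have Vi : V i by apply: dm.1; lia.
have Vm : V (i + m) by apply: dm.1; lia.
have [||[z pz hz]|[k pk hk]] := pm_stable Vi Vm _ ci cm.
- rewrite /gap; lia.
- by move=> /ui; rewrite /gap; lia.
- by have := ui _ pz; move: hz; rewrite /gap; lia.
have [cm0 ck pk'] := pm_sym pk.
have ki : k <> i by move=> e; move: pk'; rewrite e => /ui; rewrite /gap; lia.
have km : k <> i + m by move=> e; move: ck; rewrite e => /esym; exact: flip_neq.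
have mi : i + m - i <= n by lia.
have nin : ~ (i < k < i + m).
  apply: (good_excludes mi dm gm _ pk) => k' /ui; lia.
have kgt : i + m < k by move: hk; rewrite /gap; lia.
have kl : k - (i + m) < m by move: hk; rewrite /gap; lia.
have [dk Dk] := Dom_step D hm cm pk kgt kl.
have gk : good col (i + m) k by apply: good_of_match => //; lia.
apply: (av (k - (i + m))).
- lia.
- rewrite /shift !addn0 addnA.
  by rewrite subnKC ?ck //; lia.
- apply: (@eq_good (shift (i + m) col)); first by move=> x _; rewrite shift_shift.
  by apply/good_shift; rewrite addn0 subnKC //; lia.
- apply: (@eq_avoid _ _ (shift k col)).
    move=> x; rewrite /shift; congr col; lia.
  (* The partner of [k] is [i + m], so [k] is unmatched within one less than their distance: this is
     the [.-1] in [avoid]. *)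
  apply: IH => //; first by rewrite ck; exact: flip_None.
  by move=> k'; rewrite pk' => -[<-]; rewrite /gap; lia.
Qed.

End StableWindow.

(** The matching [f] of the segment, restricted to [0 .. m], is itself stable and matches [0] at
    distance [m > l], so [unmatched_avoid] applies to it. This makes the subtraction in
    [survival_bnd] exact at even depth. *)
Lemma good_avoid_before c m r l : c m = flip (c 0) -> good c 0 m -> l < m ->
  avoid r.*2 l c.
Proof.
move=> cm [f [c0 m0 f0 f1 f2]] lm.
have [|h1 fm cm'] := f1 0 _ c0; first lia.
rewrite f0 in fm.
pose pm x := if (x <= m) && (c x != None) then Some (f x) else None.
pose V x := x <= m.
have pmE x y : pm x = Some y -> [/\ x <= m, c x <> None & y = f x].
  by rewrite /pm; case: ifP => // /andP[xm /eqP cx] [<-].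
have pmI x : x <= m -> c x <> None -> pm x = Some (f x).
  by move=> xm /eqP cx; rewrite /pm xm cx.
have dp i j : j <= m -> deep pm V i j.
  move=> jm; split=> [z|x y xij /pmE[xm cx ->] _]; rewrite /V; first lia.
  by have [|h _ _] := f1 x _ cx; lia.
have : avoid r.*2 l (shift 0 c).
  apply: (@unmatched_avoid c pm V m _ _ (fun _ i l => i + l <= m /\ c i = c 0)) => //.
  - move=> x y /pmE[xm cx ->]; have [|h b d] := f1 x _ cx; first lia.
    have fxm : f x <= m by lia.
    have cf0 : c (f x) <> None by rewrite d; exact: flip_None.
    by split=> //; rewrite pmI ?b.
  - rewrite /V => x y xm ym _ cx cy; rewrite (pmI x) // => fxy.
    have cy0 : c y <> None by rewrite cy; exact: flip_None.
    have [|||h|h] := f2 x y _ _ cx cy; [lia|lia|by move=> e; apply: fxy; rewrite e| |].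
    + by left; exists (f x).
    + by right; exists (f y) => //; rewrite pmI.
  - by move=> _ i l' m' [h _] hm'; split; [lia|apply: dp; lia].
  - move=> _ i l' m' k [h ci] hm' cim pk kgt kl.
    have [km' cm0 kE] := pmE _ _ pk.
    have [|h' b d] := f1 (i + m') _ cm0; first lia.
    rewrite -kE in h' b d.
    have ck : c k = c 0 by rewrite d cim flipK.
    have km : k <> m by move=> e; move: ck; rewrite e cm; exact: flip_neq.
    split; first by apply: dp; lia.
    split=> //.
    (* The pair [k], [m] is not matched and [m] has its partner at distance [m], so stability of [f]
       puts [k] closer to [i + m'] than to [m]: the next round also fits before [m]. *)
    have ck0 : c k <> None by rewrite ck.
    have [|||||] := f2 k m _ _ ck0; [lia|lia|by rewrite ck|rewrite b; lia| |];
      rewrite ?b ?fm /gap; lia.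
  - by split=> //; lia.
  - by move=> k /pmE[_ _ ->]; rewrite f0 /gap; lia.
by apply: eq_avoid => x; rewrite shift0.
Qed.

Lemma good_flip c lo hi : good c lo hi -> good (flip \o c) lo hi.
Proof.
move=> [f [h1 h2 h3 h4 h5]]; exists f; split=> //=.
- exact: flip_None.
- move=> x hx cx; have cx' : c x <> None by move=> e; apply: cx; rewrite e.
  by have [a b ->] := h4 x hx cx'.
- move=> x y hx hy cx cy; have cx' : c x <> None by move=> e; apply: cx; rewrite e.
  by apply: h5 => //; move: cy => /(can_inj flipK).
Qed.

(** The involution [f] maps each colour class of the segment injectively into the other. *)
Lemma good_balanced c lo hi N : good c lo hi -> hi < N ->
  #|[set x : 'I_N | (lo <= x <= hi) && (c x == Some true)]| =
  #|[set x : 'I_N | (lo <= x <= hi) && (c x == Some false)]|.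
Proof.
move=> [f [h1 h2 h3 h4 h5]] hN.
have N0 : 0 < N by lia.
(* Only coloured cells of the segment are known to have [f x < N]; reduction modulo [N] makes [g] a
   total map of ordinals. *)
have fN (x : 'I_N) : f x %% N < N by rewrite ltn_mod.
pose g x := Ordinal (fN x).
have gE (x : 'I_N) : lo <= x <= hi -> c x <> None ->
    [/\ val (g x) = f x, lo <= g x <= hi, g (g x) = x & c (g x) = flip (c x)].
  move=> hx cx; have [a b d] := h4 _ hx cx.
  have e : val (g x) = f x by rewrite /= modn_small //; lia.
  split=> //; rewrite ?e //.
  by apply: val_inj; rewrite /= modn_small //; rewrite !modn_small ?b //; lia.
have le s : s <> None ->
    #|[set x : 'I_N | (lo <= x <= hi) && (c x == s)]| <=
    #|[set x : 'I_N | (lo <= x <= hi) && (c x == flip s)]|.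
  move=> s0.
  rewrite -(card_in_imset (f := g)); last first.
    move=> x y; rewrite !inE => /andP[hx /eqP cx] /andP[hy /eqP cy] e.
    have [|_ _ <- _] := gE x hx; first by rewrite cx.
    have [|_ _ <- _] := gE y hy; first by rewrite cy.
    by rewrite e.
  apply: subset_leq_card; apply/fintype.subsetP => y /imsetP[x].
  rewrite !inE => /andP[hx /eqP cx] ->.
  have [|_ a _ d] := gE x hx; first by rewrite cx.
  by rewrite a d cx eqxx.
by apply/eqP; rewrite eqn_leq (le (Some true)) //= (le (Some false)).
Qed.

Lemma modn_inj_small m a b : a %% m = b %% m -> gap a b < m -> a = b.
Proof.
wlog ab : a b / a <= b.
  move=> H e g; case: (leqP a b) => h; first exact: H.
  by apply/esym; apply: H => //; [lia|move: g; rewrite /gap; lia].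
move=> /eqP; rewrite eq_sym eqn_mod_dvd // => dv g.
have : ~ (0 < b - a) by move=> h; have := dvdn_leq h dv; move: g; rewrite /gap; lia.
by lia.
Qed.

(** * Good rotations of antiperiodic words *)

Section Rotation.
Variable m : nat.
Hypothesis m0 : 0 < m.

Definition antiper (c : nat -> sym) := forall x, c (x + m) = flip (c x).
Definition tiefree (c : nat -> sym) := forall u d, 0 < d < m -> c (u + d) <> None ->
  c u = flip (c (u + d)) -> c (u + d + d) = flip (c (u + d)) -> False.

Lemma antiper_mod c x : antiper c ->
  c x = if odd (x %/ m) then flip (c (x %% m)) else c (x %% m).
Proof.
move=> ac; rewrite {1}(divn_eq x m).
elim: (x %/ m) => [|q IH]; first by rewrite mul0n.
have -> : q.+1 * m + x %% m = q * m + x %% m + m by rewrite mulSn; lia.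
rewrite ac IH /=.
by case: odd => //=; rewrite flipK.
Qed.

Lemma antiper_pair c x d : antiper c -> c x <> None -> c (x + d) = flip (c x) ->
  c (x %% m) <> None /\ c (x %% m + d) = flip (c (x %% m)).
Proof.
move=> ac.
have H q z : z = x %% m + q * m -> c z <> None -> c (z + d) = flip (c z) ->
    c (x %% m) <> None /\ c (x %% m + d) = flip (c (x %% m)).
  elim: q z => [|q IH] z ->; first by rewrite mul0n addn0.
  have -> : x %% m + q.+1 * m = x %% m + q * m + m by lia.
  rewrite (addnAC _ m d) !ac => h1 h2; apply: (IH _ erefl).
    by move=> e; apply: h1; rewrite e.
  by move: h2 => /(can_inj flipK).
by apply: (H (x %/ m)); rewrite addnC -divn_eq.
Qed.

Lemma tiefree_gap c u v w d : tiefree c -> 0 < d < m -> c u <> None ->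
  c v = flip (c u) -> c w = flip (c u) -> v <> w ->
  gap u v = d -> gap u w = d -> False.
Proof.
wlog vw : v w / v < w.
  move=> H tf hd cu cv cw vw gv gw; case: (ltngtP v w) => h //.
    exact: (H v w).
  by apply: (H w v) => // /esym.
rewrite /gap => tf hd cu cv cw nvw gv gw.
have uE : u = v + d by lia.
have wE : w = v + d + d by lia.
by apply: (tf v d hd); rewrite -?wE -?uE.
Qed.

(** If two letters of a period have the same colour, the next copy of the first one has the opposite
    colour and lies less than [m] beyond the second. *)
Lemma opposite_pair c : antiper c -> 1 < #|[set x : 'I_m | c x != None]| ->
  exists x d, [/\ 0 < d < m, c x <> None & c (x + d) = flip (c x)].
Proof.
move=> ac /card_gt1P[a [b []]]; rewrite !inE => /eqP ca /eqP cb ab.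
wlog lt : a b ca cb ab / a < b.
  move=> H; case: (ltngtP a b) => h; first exact: (H a b).
    by apply: (H b a) => //; rewrite eq_sym.
  by move: ab; rewrite -val_eqE /= h eqxx.
have [e|e] := sym_dec ca cb.
- exists b, (a + m - b); split=> //; first by have := ltn_ord b; lia.
  have -> : b + (a + m - b) = a + m by have := ltn_ord b; lia.
  by rewrite ac e.
- exists a, (b - a); split=> //; first by have := ltn_ord b; lia.
  by rewrite subnKC ?e //; lia.
Qed.

(* Remove the closest pair of opposite colours, which is matched in any strictly
   stable matching, until a single point per period is left. *)
Lemma rotation_good k c : antiper c -> tiefree c ->
  #|[set x : 'I_m | c x != None]| = k.*2.+1 ->
  exists j, [/\ j < m, c j <> None & good c j (j + m)].
Proof.
elim: k c => [|k IH] c ac tf cnt.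
  have /cards1P[a aE] : #|[set x : 'I_m | c x != None]| == 1 by rewrite cnt.
  have uniq x : x < m -> c x <> None -> x = a.
    move=> xm /eqP cx; have : Ordinal xm \in [set x : 'I_m | c x != None] by rewrite inE.
    by rewrite aE inE => /eqP <-.
  have ca : c a <> None.
    have : a \in [set x : 'I_m | c x != None] by rewrite aE inE.
    by rewrite inE => /eqP.
  have am := ltn_ord a.
  have ins x : a <= x <= a + m -> c x <> None -> x = a \/ x = a + m.
    move=> hx cx; case: (ltnP x m) => h; first by left; apply: uniq.
    right; have : x - m = a.
      apply: uniq; first lia.
      by move=> e; apply: cx; rewrite -(subnK h) ac e.
    by lia.
  exists a; split=> //; exists (fun x => if x == a :> nat then a + m else a); split=> //.
  - lia.
  - by rewrite eqxx.
  - move=> x hx cx; have [->|->] := ins x hx cx.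
      by rewrite eqxx; split; [lia|case: eqP => //; lia|rewrite ac].
    case: eqP => [|_]; first lia.
    by rewrite eqxx; split; [lia|done|rewrite ac flipK].
  - move=> x y hx hy cx cy.
    have cy0 : c y <> None by rewrite cy; exact: flip_None.
    have [xE|xE] := ins x hx cx; have [yE|yE] := ins y hy cy0.
    + by move: cy; rewrite xE yE => /esym /flip_neq; case.
    + by rewrite xE eqxx yE.
    + by rewrite xE yE; case: eqP => //; lia.
    + by move: cy; rewrite yE xE => /esym /flip_neq; case; rewrite ac; exact: flip_None.
pose P d := (0 < d < m) && [exists x : 'I_m, (c x != None) && (c (x + d) == flip (c x))].
have PI x d : 0 < d < m -> c x <> None -> c (x + d) = flip (c x) -> P d.
  move=> hd cx cxd; rewrite /P hd /=.
  have [h1 h2] := antiper_pair ac cx cxd.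
  apply/existsP; exists (Ordinal (ltn_pmod x m0)) => /=.
  by apply/andP; split; apply/eqP.
have [|x1 [d1 [hd1 cx1 cd1]]] := opposite_pair ac; first by rewrite cnt.
have exP : exists d, P d by exists d1; exact: PI hd1 cx1 cd1.
case: (ex_minnP exP) => d0 /andP[hd0 /existsP[x0 /andP[/eqP cx0 /eqP cy0]]] dmin.
have {}dmin x d : 0 < d < m -> c x <> None -> c (x + d) = flip (c x) -> d0 <= d.
  by move=> hd cx cxd; apply: dmin; exact: PI hd cx cxd.
have x0m := ltn_ord x0.
(* All copies of the closest pair modulo [m] are removed: the rest is still antiperiodic and has two
   letters fewer per period. *)
pose rem z := (z %% m == x0) || (z %% m == (x0 + d0) %% m).
pose c' z := if rem z then None else c z.
have c'E z : c' z <> None -> c' z = c z /\ ~~ rem z.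
  by rewrite /c'; case: ifP.
have ac' : antiper c'.
  by move=> x; rewrite /c' /rem modnDr; case: ifP => // _; exact: ac.
have tf' : tiefree c'.
  move=> u d hd cud cu cudd.
  have [e1 _] := c'E _ cud.
  have [e2 _] := c'E u ltac:(by rewrite cu; exact: flip_None).
  have [e3 _] := c'E (u + d + d) ltac:(by rewrite cudd; exact: flip_None).
  by apply: (tf u d hd); rewrite -?e1 -?e2 -?e3.
have y0m : (x0 + d0) %% m < m by rewrite ltn_mod.
have xy0 : (x0 + d0) %% m != x0.
  apply/eqP => e; have : x0 + d0 = x0 :> nat; last by lia.
  by apply: (@modn_inj_small m); rewrite ?(modn_small x0m) //; rewrite /gap; lia.
have cy00 : c ((x0 + d0) %% m) <> None.
  have : c (x0 + d0) <> None by rewrite cy0; exact: flip_None.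
  by rewrite (antiper_mod _ ac); case: odd => // h e; apply: h; rewrite e.
have cnt' : #|[set x : 'I_m | c' x != None]| = k.*2.+1.
  have -> : [set x : 'I_m | c' x != None] =
      [set x : 'I_m | c x != None] :\ x0 :\ Ordinal y0m.
    apply/finset.setP => z; rewrite !inE /c' /rem (modn_small (ltn_ord z)) -!val_eqE /=.
    by case: (z == x0 :> nat); case: (z == (x0 + d0) %% m :> nat); rewrite ?eqxx ?andbF.
  have := cardsD1 (Ordinal y0m) ([set x : 'I_m | c x != None] :\ x0).
  have := cardsD1 x0 [set x : 'I_m | c x != None].
  rewrite !inE -!val_eqE /= xy0 (introN eqP cx0) (introN eqP cy00) cnt /=; lia.
have [j [jm cj gj]] := IH c' ac' tf' cnt'.
have [cjE jrem] := c'E j cj.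
move: (jrem); rewrite /rem (modn_small jm) negb_or => /andP[jx0 jy0].
(* The copy of the removed pair that starts inside the segment [j .. j + m] found by induction. *)
pose xt := if j < x0 then x0 : nat else x0 + m.
have xtj : j < xt < j + m by rewrite /xt; move/eqP: jx0; case: ifP; lia.
have xtmod : xt %% m = x0.
  by rewrite /xt; case: ifP => _; rewrite ?modnDr modn_small.
have cxt : c xt <> None /\ c (xt + d0) = flip (c xt).
  rewrite /xt; case: ifP => _ //.
  by rewrite addnAC !ac cy0; split=> //; exact: flip_None.
case: cxt => cxt cyt.
set yt := xt + d0 in cyt.
have ytmod : yt %% m = (x0 + d0) %% m by rewrite /yt -modnDml xtmod.
have cyt0 : c yt <> None by rewrite cyt; exact: flip_None.
have jE : c (j + m) <> None by rewrite ac -cjE; exact: flip_None.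
(* If [j + m] lay between [xt] and [yt], it would form, with the one of the opposite colour, a pair
   closer than [d0]. *)
have ytj : yt < j + m.
  case: (ltngtP yt (j + m)) => // h.
  - have [e|e] := sym_dec cxt jE.
    + have := dmin (j + m) (yt - (j + m)) _ jE.
      rewrite subnKC; last lia.
      by rewrite e cyt => /(_ _ erefl); rewrite /yt in h *; lia.
    + have := dmin xt (j + m - xt) _ cxt.
      rewrite subnKC; last lia.
      by rewrite e => /(_ _ erefl); rewrite /yt in h *; lia.
  - by move: jy0; rewrite -ytmod h modnDr (modn_small jm) eqxx.
have remE z : j <= z <= j + m -> rem z -> z = xt \/ z = yt.
  move=> hz rz.
  have zj : z <> j by move=> e; move: jrem; rewrite -e rz.
  have zjm : z <> j + m.
    move=> e; move: jrem rz; rewrite e /rem modnDr => /negP; exact.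
  move: rz => /orP[/eqP e|/eqP e]; [left|right].
  + apply: (@modn_inj_small m); first by rewrite e xtmod.
    by rewrite /gap; lia.
  + apply: (@modn_inj_small m); first by rewrite e ytmod.
    by rewrite /gap /yt in ytj *; lia.
have remx : rem xt by rewrite /rem xtmod eqxx.
have remy : rem yt by rewrite /rem ytmod eqxx orbT.
have xyt : xt < yt by rewrite /yt; lia.
have [f' [_ jm' f0 f1 f2]] := gj.
pose f z := if z == xt then yt else if z == yt then xt else f' z.
have fx : f xt = yt by rewrite /f eqxx.
have fy : f yt = xt by rewrite /f eqxx; case: eqP => //; lia.
have fN z : z <> xt -> z <> yt -> f z = f' z.
  by move=> /eqP/negbTE h1 /eqP/negbTE h2; rewrite /f h1 h2.
have fE z : j <= z <= j + m -> c z <> None -> z <> xt -> z <> yt ->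
    [/\ c' z = c z, f z = f' z, f z <> xt & f z <> yt].
  move=> hz cz zx zy.
  have nr : ~~ rem z by apply/negP => /(remE z hz)[].
  have e : c' z = c z by rewrite /c' (negbTE nr).
  have fz := fN z zx zy.
  have cz' : c' z <> None by rewrite e.
  have [h1 h2 h3] := f1 z hz cz'.
  have [_ nr'] := c'E (f' z) ltac:(by rewrite h3; exact: flip_None).
  by split=> //; rewrite fz => e'; move: nr'; rewrite e' ?remx ?remy.
have fxy z : z = xt \/ z = yt -> [/\ f (f z) = z, gap z (f z) = d0, c z <> None & c (f z) = flip (c z)].
  case=> ->; rewrite ?fx ?fy ?fx ?fy; split=> //.
  - by rewrite /gap /yt; lia.
  - by rewrite /gap /yt; lia.
  - by rewrite cyt flipK.
(* Minimality of [d0] gives the weak inequality, and absence of ties the strict one. *)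
have close u v : u = xt \/ u = yt -> j <= v <= j + m -> c v = flip (c u) ->
    f u <> v -> d0 < gap u v.
  move=> hu hv cv fuv.
  have [ffu gu cu cfu] := fxy u hu.
  have uj : j < u < j + m by case: hu => ->; lia.
  have cv0 : c v <> None by rewrite cv; exact: flip_None.
  have uv : u <> v by move=> e; move: cv; rewrite e => /esym /flip_neq; exact.
  have cu' : c u = flip (c v) by rewrite cv flipK.
  have cu'' : c u = flip (c (f u)) by rewrite cfu flipK.
  have cfu0 : c (f u) <> None by rewrite cfu; exact: flip_None.
  have le : d0 <= gap u v.
    case: (ltnP u v) => h.
      have -> : gap u v = v - u by rewrite /gap; lia.
      by apply: (dmin u) => //; [lia|rewrite subnKC //; lia].
    have -> : gap u v = u - v by rewrite /gap; lia.
    by apply: (dmin v) => //; [lia|rewrite subnKC //; lia].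
  rewrite ltn_neqAle le andbT; apply/eqP => e.
  by apply: (tiefree_gap tf hd0 cu cv cfu _ (esym e) gu) => /esym.
exists j; split=> //; first by rewrite -cjE.
exists f; split=> //.
- by rewrite -cjE.
- by rewrite fN; lia.
- move=> z hz cz.
  case: (eqVneq z xt) => [->|/eqP zx]; first by rewrite fx fy; split=> //; lia.
  case: (eqVneq z yt) => [->|/eqP zy]; first by rewrite fy fx cyt flipK; split=> //; lia.
  have [e ez h1 h2] := fE z hz cz zx zy.
  have [|a b d] := f1 z hz; first by rewrite e.
  have [e' _] := c'E (f' z) ltac:(by rewrite d e; exact: flip_None).
  split; rewrite ez //; last by rewrite -e' d e.
  rewrite ez in h1 h2.
  by rewrite fN.
- move=> u v hu hv cu cv fuv.
  case: (eqVneq u xt) => [ux|/eqP ux].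
    left; have [_ -> _ _] := fxy u (or_introl ux).
    by apply: close => //; left.
  case: (eqVneq u yt) => [uy|/eqP uy].
    left; have [_ -> _ _] := fxy u (or_intror uy).
    by apply: close => //; right.
  have gC : gap u v = gap v u by rewrite /gap addnC.
  have cuv : c u = flip (c v) by rewrite cv flipK.
  case: (eqVneq v xt) => [vx|/eqP vx].
    right; have [ffv -> _ _] := fxy v (or_introl vx).
    rewrite gC; apply: close => //; [by left|].
    by move=> e; apply: fuv; rewrite -e.
  case: (eqVneq v yt) => [vy|/eqP vy].
    right; have [ffv -> _ _] := fxy v (or_intror vy).
    rewrite gC; apply: close => //; [by right|].
    by move=> e; apply: fuv; rewrite -e.
  have cv0 : c v <> None by rewrite cv; exact: flip_None.
  have [e1 ez1 _ _] := fE u hu cu ux uy.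
  have [e2 ez2 _ _] := fE v hv cv0 vx vy.
  rewrite ez1 ez2; apply: f2 => //; rewrite ?e1 ?e2 //.
  by rewrite -ez1.
Qed.

End Rotation.

Local Open Scope ring_scope.

(** * Words with independent letters *)

Section WordExpectation.
Variable R : realFieldType.
Implicit Types (v : sym -> R) (K L : nat) (f g : seq sym -> R).

Definition ind (P : Prop) : R := (`[< P >])%:R.

Lemma ind_ge0 P : 0 <= ind P. Proof. exact: ler0n. Qed.
Lemma ind_le1 P : ind P <= 1. Proof. by rewrite /ind; case: asbool. Qed.
Lemma ind1 (P : Prop) : P -> ind P = 1. Proof. by move=> h; rewrite /ind asboolT. Qed.
Lemma ind0 (P : Prop) : ~ P -> ind P = 0. Proof. by move=> h; rewrite /ind asboolF. Qed.
Lemma indM P Q : ind P * ind Q = ind (P /\ Q).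
Proof.
have [p|p] := pselect P; last by rewrite (ind0 p) mul0r ind0 // => -[].
rewrite (ind1 p) mul1r; congr (nat_of_bool _)%:R; apply: asbool_equiv_eq.
by split=> // -[].
Qed.
Lemma ind_iff (P Q : Prop) : (P <-> Q) -> ind P = ind Q.
Proof. by move=> h; congr (nat_of_bool _)%:R; apply: asbool_equiv_eq. Qed.
Lemma le_ind (P Q : Prop) : (P -> Q) -> ind P <= ind Q.
Proof.
move=> h; have [p|p] := pselect P; first by rewrite !ind1 //; exact: h.
by rewrite (ind0 p) ind_ge0.
Qed.
Lemma ind_le_big (T : finType) (P : Prop) (Q : T -> Prop) :
  (P -> exists t, Q t) -> ind P <= \sum_t ind (Q t).
Proof.
move=> h; have [/h [t qt]|p] := pselect P.
  rewrite (bigD1 t) //= (ind1 qt) (le_trans (ind_le1 _)) // lerDl.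
  by apply: sumr_ge0 => i _; apply: ind_ge0.
by rewrite (ind0 p); apply: sumr_ge0 => i _; apply: ind_ge0.
Qed.

(** Expectation over words of [K] independent letters. The weights may have any total, so that it
    serves probabilities, the equal colour weights [vsym] and the defective law [wexact] alike. *)
Fixpoint ex v K f : R :=
  if K is K'.+1 then \sum_(s : sym) v s * ex v K' (fun w => f (s :: w)) else f [::].

Lemma sum_sym (F : sym -> R) :
  \sum_(s : sym) F s = F None + F (Some true) + F (Some false).
Proof.
rewrite (bigD1 None) //= (bigD1 (Some true)) //= (bigD1 (Some false)) //=.
rewrite big1 ?addr0 ?addrA // => -[[]|] //.
Qed.

Lemma eq_ex v K f g : (forall w, size w = K -> f w = g w) -> ex v K f = ex v K g.
Proof.
elim: K f g => [|K IH] f g e /=; first exact: e.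
by apply: eq_bigr => s _; congr (_ * _); apply: IH => w hw; apply: e; rewrite /= hw.
Qed.

Lemma ex_le v v' K f g : (forall s, 0 <= v s <= v' s) ->
  (forall w, size w = K -> 0 <= g w /\ f w <= g w) -> ex v K f <= ex v' K g.
Proof.
move=> hv; elim: K f g => [|K IH] f g e /=; first exact: (e _ _).2.
apply: ler_sum => s _; have /andP[v0 vv] := hv s.
have e' : forall w, size w = K -> 0 <= g (s :: w) /\ f (s :: w) <= g (s :: w).
  by move=> w hw; apply: e; rewrite /= hw.
apply: (@le_trans _ _ (v s * ex v' K (fun w => g (s :: w)))).
  by rewrite ler_wpM2l // IH.
rewrite ler_wpM2r //.
suff : ex v K (fun=> 0) <= ex v' K (fun w => g (s :: w)).
  apply: le_trans; elim: K {IH e e'} => //= K IH.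
  by apply: sumr_ge0 => t _; rewrite mulr_ge0 //; have /andP[] := hv t.
by apply: IH => w /e' [].
Qed.

Lemma exD v K f g : ex v K (fun w => f w + g w) = ex v K f + ex v K g.
Proof.
elim: K f g => [//|K IH] f g /=; rewrite -big_split /=; apply: eq_bigr => s _.
by rewrite IH mulrDr.
Qed.

Lemma exZ v K f a : ex v K (fun w => a * f w) = a * ex v K f.
Proof.
elim: K f => [//|K IH] f /=; rewrite mulr_sumr; apply: eq_bigr => s _.
by rewrite IH mulrCA.
Qed.

Lemma exB v K f g : ex v K (fun w => f w - g w) = ex v K f - ex v K g.
Proof.
rewrite -mulN1r -exZ -exD; apply: eq_ex => w _; by rewrite mulN1r.
Qed.

Lemma ex0 v K : ex v K (fun=> 0) = 0.
Proof. by rewrite -[RHS](mul0r (ex v K (fun=> 0))) -exZ; apply: eq_ex => w _; rewrite mul0r. Qed.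

Lemma ex_sum v K (I : Type) (r : seq I) (F : I -> seq sym -> R) :
  ex v K (fun w => \sum_(i <- r) F i w) = \sum_(i <- r) ex v K (F i).
Proof.
elim: r => [|i r IH]; first by rewrite big_nil -{2}(ex0 v K); apply: eq_ex => w _; rewrite big_nil.
by rewrite big_cons -IH -exD; apply: eq_ex => w _; rewrite big_cons.
Qed.

Lemma ex_ge0 v K f : (forall s, 0 <= v s) -> (forall w, size w = K -> 0 <= f w) ->
  0 <= ex v K f.
Proof.
move=> hv hf; rewrite -(ex0 v K); apply: ex_le => [s|w hw]; last by split; exact: hf.
by rewrite hv lexx.
Qed.

Lemma ex_mono v K f g : (forall s, 0 <= v s) ->
  (forall w, size w = K -> f w <= g w) -> ex v K f <= ex v K g.
Proof.
move=> hv h; rewrite -subr_ge0 -exB; apply: ex_ge0 => // w hw.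
by rewrite subr_ge0 h.
Qed.

Lemma ex_cat v K L f : ex v (K + L) f = ex v K (fun u => ex v L (fun w => f (u ++ w))).
Proof.
elim: K f => [//|K IH] f /=.
by apply: eq_bigr => s _; rewrite IH.
Qed.

Lemma ex_rcons v K f : ex v K.+1 f = \sum_s v s * ex v K (fun w => f (rcons w s)).
Proof.
rewrite -addn1 ex_cat /=; under eq_ex => u _.
  under eq_bigr do rewrite cats1; over.
rewrite ex_sum; apply: eq_bigr => s _; by rewrite exZ.
Qed.

Lemma ex_rev v K f : ex v K (fun w => f (rev w)) = ex v K f.
Proof.
elim: K f => [//|K IH] f; rewrite ex_rcons /=; apply: eq_bigr => s _.
by congr (_ * _); rewrite -[RHS]IH; apply: eq_ex => w _; rewrite rev_rcons.
Qed.

Lemma ex_map v K f (h : sym -> sym) : involutive h ->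
  ex v K (fun w => f (map h w)) = ex (v \o h) K f.
Proof.
move=> hK; elim: K f => [//|K IH] f /=.
rewrite (reindex_inj (can_inj hK)) /=; apply: eq_bigr => s _.
by rewrite -(IH (fun w => f (s :: w))) hK.
Qed.

Lemma ex_reweight v (rho : sym -> R) K f :
  ex (fun s => v s * rho s) K f = ex v K (fun w => (\prod_(s <- w) rho s) * f w).
Proof.
elim: K f => [|K IH] f /=; first by rewrite big_nil mul1r.
apply: eq_bigr => s _; rewrite IH -mulrA -exZ; congr (_ * _).
by apply: eq_ex => w _; rewrite big_cons mulrA.
Qed.

Lemma ex_prod v K (h : nat -> sym -> R) :
  ex v K (fun w => \prod_(i < K) h i (nth None w i)) =
  \prod_(i < K) \sum_s v s * h i s.
Proof.
elim: K h => [|K IH] h /=; first by rewrite !big_ord0.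
rewrite big_ord_recl mulr_suml; apply: eq_bigr => s _ /=.
have <- := IH (fun i => h i.+1).
rewrite -mulrA; congr (_ * _); rewrite -exZ; apply: eq_ex => w _.
by rewrite big_ord_recl.
Qed.

Lemma ex1 v K : \sum_s v s = 1 -> ex v K (fun=> 1) = 1.
Proof.
move=> h; elim: K => [//|K IH] /=.
by rewrite -[RHS]h; apply: eq_bigr => s _; rewrite IH mulr1.
Qed.

(** The indicator is a product of one-letter factors, whose means are at most [c] at the three
    positions and at most [1] elsewhere. Applied to three nearly equidistant letters, it makes ties
    negligible. *)
Lemma ex_nonempty3 v K c a b d : (forall s, 0 <= v s) -> \sum_s v s <= 1 ->
  v (Some true) + v (Some false) <= c ->
  (a < K)%N -> (b < K)%N -> (d < K)%N -> a != b -> a != d -> b != d ->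
  ex v K (fun w => ind [/\ nth None w a <> None, nth None w b <> None
                         & nth None w d <> None]) <= c ^+ 3.
Proof.
move=> v0 v1 vc aK bK dK ab ad bd.
pose h (i : nat) (s : sym) : R := if i \in [:: a; b; d] then (s != None)%:R else 1.
have -> : ex v K (fun w => ind [/\ nth None w a <> None, nth None w b <> None
                         & nth None w d <> None]) =
    ex v K (fun w => \prod_(i < K) h i (nth None w i)).
  apply: eq_ex => w _; have [[h1 h2 h3]|nh] := pselect [/\ nth None w a <> None,
     nth None w b <> None & nth None w d <> None].
    rewrite ind1 // big1 // => i _; rewrite /h !inE.
    by case: ifP => // /or3P[] /eqP ->; rewrite ?(introN eqP h1) ?(introN eqP h2) ?(introN eqP h3).
  rewrite ind0 //.
  have : [|| nth None w a == None, nth None w b == None | nth None w d == None].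
    apply/negPn/negP => /norP[/eqP h1 /norP[/eqP h2 /eqP h3]]; exact: nh.
  have z (i : 'I_K) : val i \in [:: a; b; d] -> nth None w i == None ->
      \prod_(i < K) h i (nth None w i) = 0.
    by move=> hi /eqP e; rewrite (bigD1 i) //= /h hi e eqxx mul0r.
  by case/or3P => e; apply/esym;
    [apply: (z (Ordinal aK))|apply: (z (Ordinal bK))|apply: (z (Ordinal dK))];
    rewrite // !inE eqxx ?orbT.
rewrite ex_prod.
have hE i : i \in [:: a; b; d] -> \sum_s v s * h i s <= c.
  by move=> hi; rewrite sum_sym /h hi /= !mulr1 mulr0 add0r.
have hE' i : i \notin [:: a; b; d] -> \sum_s v s * h i s <= 1.
  move=> hi; rewrite /h (negbTE hi); apply: le_trans v1.
  by apply: ler_sum => s _; rewrite mulr1.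
have h0 i : 0 <= \sum_s v s * h i s.
  by apply: sumr_ge0 => s _; rewrite mulr_ge0 // /h; case: ifP.
rewrite (bigD1 (Ordinal aK)) //= (bigD1 (Ordinal bK)) /=; last first.
  by rewrite -val_eqE /= eq_sym.
rewrite (bigD1 (Ordinal dK)) /=; last by rewrite -!val_eqE /= ![d == _]eq_sym ad bd.
rewrite !exprS expr0 mulr1.
have c0 : 0 <= c by apply: le_trans vc; rewrite addr_ge0.
apply: ler_pM => //; [by apply: mulr_ge0 => //; apply: mulr_ge0 => //; apply: prodr_ge0|by apply: hE; rewrite !inE eqxx|].
apply: ler_pM => //; [by apply: mulr_ge0 => //; apply: prodr_ge0|by apply: hE; rewrite !inE eqxx orbT|].
rewrite -[leRHS]mulr1; apply: ler_pM => //; [by apply: prodr_ge0|by apply: hE; rewrite !inE eqxx !orbT|].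
apply: (@le_trans _ _ (\prod_(i < K | (i != Ordinal aK) && (i != Ordinal bK) && (i != Ordinal dK)) 1)).
  apply: ler_prod => i /andP[/andP[ia ib] id]; rewrite h0 /= hE' //.
  by rewrite !inE; move: ia ib id; rewrite -!val_eqE /= => /negbTE-> /negbTE-> /negbTE->.
by rewrite big1.
Qed.

End WordExpectation.

(** * One-sided survival probabilities and their recursive bounds *)

(** The letter at [0] is fixed and carries no weight; cells past the end of the word read as
    empty. *)
Definition cw (s : sym) (w : seq sym) : nat -> sym := nth None (s :: w).

Lemma card_count (s : seq sym) (N : nat) (P : nat -> bool) a : size s = N ->
  (forall i, (i < N)%N -> P i) ->
  #|[set x : 'I_N | P x && (nth None s x == a)]| = count_mem a s.
Proof.
move=> sN hP; rewrite -sum1_card (eq_bigl (fun x : 'I_N => nth None s x == a)); last first.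
  by move=> x; rewrite inE hP.
rewrite -[in RHS](mkseq_nth None s) sN /mkseq count_map -sum1_count.
rewrite -(big_mkord (fun i => nth None s i == a) (fun=> 1%N)) /index_iota subn0.
by apply: eq_bigl.
Qed.

Lemma cw_good s u w m t : size u = m ->
  good (cw s (u ++ t :: w)) 0 m.+1 <-> good (cw s (rcons u t)) 0 m.+1.
Proof.
move=> su; have e x : (0 <= x <= m.+1)%N -> cw s (u ++ t :: w) x = cw s (rcons u t) x.
  case: x => [//|x] hx; rewrite /cw /= -cats1 !nth_cat su; case: ifP => // h.
  by have -> : (x - m = 0)%N by lia.
by split; apply: eq_good => x hx; rewrite e.
Qed.

Lemma good_word_balanced s u : s <> None ->
  good (cw s (rcons u (flip s))) 0 (size u).+1 ->
  count_mem (Some true) u = count_mem (Some false) u.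
Proof.
move=> s0 g; have := good_balanced g (ltnSn _).
set w := s :: rcons u (flip s).
have sw : size w = (size u).+2 by rewrite /= size_rcons.
have H a : #|[set x : 'I_(size u).+2 | (0 <= x <= (size u).+1)%N &&
    (cw s (rcons u (flip s)) x == a)]| = count_mem a w.
  by apply: (@card_count w _ (fun x => (0 <= x <= (size u).+1)%N)) => // i hi; lia.
rewrite !H /w /= -cats1 !count_cat /=.
by case: s s0 {g w sw H} => [[]|] //= _; lia.
Qed.

Section Survival.
Variables (R : realFieldType) (v : sym -> R) (h : R).
Hypothesis v0 : forall s, 0 <= v s.
Hypothesis v1 : \sum_s v s = 1.
Hypothesis h0 : 0 < h.
Hypothesis hE : h ^+ 2 = v (Some true) * v (Some false).

Definition vsym (s : sym) : R := if s is Some _ then h else v None.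

(** The [i_m] of the outline: only the [m.-1] interior letters are weighted, both ends being
    prescribed. *)
Definition imass (m : nat) : R :=
  ex vsym m.-1 (fun u => ind R (good (cw (Some true) (rcons u (Some false))) 0 m)).

Lemma vsym_flip s : vsym (flip s) = vsym s. Proof. by case: s => [[]|]. Qed.
Lemma vsym_ge0 s : 0 <= vsym s. Proof. by case: s => [b|] /=; [exact: ltW|exact: v0]. Qed.

Lemma imass_ge0 m : 0 <= imass m.
Proof. by apply: ex_ge0 => [s|w _]; [exact: vsym_ge0|exact: ind_ge0]. Qed.

(* The interior of a good segment is balanced, so exchanging the weights
   [v (Some _)] for their geometric mean [h] does not change its mass. *)
Lemma imassE s m : (0 < m)%N -> s <> None ->
  ex v m.-1 (fun u => ind R (good (cw s (rcons u (flip s))) 0 m)) = imass m.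
Proof.
case: m => [//|m] _ s0 /=.
pose rho (t : sym) : R := if t is Some _ then v t / h else 1.
have hn : h != 0 by rewrite gt_eqF.
have -> : ex v m (fun u => ind R (good (cw s (rcons u (flip s))) 0 m.+1)) =
          ex vsym m (fun u => ind R (good (cw s (rcons u (flip s))) 0 m.+1)).
  have rhoE w : \prod_(t <- w) rho t =
      rho (Some true) ^+ count_mem (Some true) w * rho (Some false) ^+ count_mem (Some false) w.
    elim: w => [|t w IH]; first by rewrite big_nil !expr0 mulr1.
    rewrite big_cons IH; case: t => [[]|] /=; rewrite ?exprS ?add0n ?add1n ?mul1r ?exprS.
    - by rewrite mulrA.
    - by rewrite mulrCA.
    - by [].
  transitivity (ex (fun t => vsym t * rho t) m (fun u => ind R (good (cw s (rcons u (flip s))) 0 m.+1))).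
    congr ex; apply/funext => -[b|] /=; last by rewrite mulr1.
    by rewrite mulrC divfK.
  rewrite ex_reweight; apply: eq_ex => w sw.
  have [g|ng] := pselect (good (cw s (rcons w (flip s))) 0 m.+1); last by rewrite ind0 // mulr0.
  rewrite rhoE; rewrite -sw in g; rewrite (good_word_balanced s0 g) -exprMn_comm; last exact: mulrC.
  by rewrite /= mulrACA -invfM -expr2 -hE divff ?expf_neq0 // expr1n mul1r.
(* A segment with a red start becomes one with a blue start when all colours are reversed, and
   [vsym] is invariant under that. *)
case: s s0 => [[]|] // _; rewrite /imass /=.
transitivity (ex (vsym \o flip) m (fun u => ind R (good (cw (Some false) (rcons u (Some true))) 0 m.+1))).
  by congr ex; apply/funext => t /=; rewrite vsym_flip.
rewrite -ex_map; last exact: flipK.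
apply: eq_ex => w sw; apply: ind_iff.
have e x : cw (Some false) (rcons (map flip w) (Some true)) x = flip (cw (Some true) (rcons w (Some false)) x).
  have -> : rcons (map flip w) (Some true) = map flip (rcons w (Some false)) by rewrite map_rcons.
  case: x => [//|x]; rewrite /cw /=; case: (ltnP x (size (rcons w (Some false)))) => hx.
    by rewrite (nth_map None).
  by rewrite !nth_default ?size_map.
split=> g.
- apply: (@eq_good (flip \o cw (Some false) (rcons (map flip w) (Some true)))); last exact: good_flip.
  by move=> x _ /=; rewrite e flipK.
- apply: (@eq_good (flip \o cw (Some true) (rcons w (Some false)))); last exact: good_flip.
  by move=> x _ /=; rewrite e.
Qed.

(** The event lost when the range of [avoid] grows from [m.-1] to [m]. *)
Definition matches r m (c : nat -> sym) :=
  [/\ c m = flip (c 0), good c 0 m & avoid r m.-1 (shift m c)].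

Lemma avoidS r n c : avoid r.+1 n.+1 c <-> avoid r.+1 n c /\ ~ matches r n.+1 c.
Proof.
split=> [a|[a nm] m hm cm gm am].
  split=> [m hm|[h1 h2 h3]]; first by apply: a; lia.
  by apply: (a n.+1) => //; lia.
case: (eqVneq m n.+1) => [e|/eqP ne]; first by subst m; apply: nm.
by apply: (a m) => //; lia.
Qed.

Definition survival r s n K : R := ex v K (fun w => ind R (avoid r n (cw s w))).

Lemma survival_ge0 r s n K : 0 <= survival r s n K.
Proof. by apply: ex_ge0 => // w _; exact: ind_ge0. Qed.

Lemma survival0 r s K : survival r s 0 K = 1.
Proof.
rewrite -(ex1 K v1); apply: eq_ex => w _; rewrite ind1 //.
by case: r => //= r m; lia.
Qed.

(** The interior of the segment, the letter at [m] and the letters after it are independent, and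
    each factor of the product comes from one of them. *)
Lemma matches_mass r s m K : s <> None -> (0 < m <= K)%N ->
  ex v K (fun w => ind R (matches r m (cw s w))) =
  imass m * v (flip s) * survival r (flip s) m.-1 (K - m).
Proof.
move=> s0; case: m => [//|m] /= mK.
have -> : K = (m + (K - m.+1).+1)%N by lia.
have -> : (m + (K - m.+1).+1 - m.+1 = K - m.+1)%N by lia.
set L := (K - m.+1)%N.
rewrite ex_cat -(imassE _ s0) //= -mulrA mulrC -exZ.
apply: eq_ex => u su.
have E t w : ind R (matches r m.+1 (cw s (u ++ t :: w))) =
    ind R (t = flip s) * (ind R (good (cw s (rcons u (flip s))) 0 m.+1) *
      ind R (avoid r m (cw t w))).
  rewrite !indM; apply: ind_iff.
  have c0 : cw s (u ++ t :: w) 0 = s by [].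
  have cm : cw s (u ++ t :: w) m.+1 = t by rewrite /cw /= nth_cat su ltnn subnn.
  have sh x : shift m.+1 (cw s (u ++ t :: w)) x = cw t w x.
    rewrite /shift /cw addSn /= nth_cat su ltnNge leq_addr /=.
    by rewrite addKn.
  rewrite /matches c0 cm; split=> [[te g a]|[te [g a]]]; subst t.
    split=> //; split; first by move: g => /(@cw_good s u w m _ su).
    by apply: eq_avoid a => x; rewrite sh.
  split=> //; first by apply/(@cw_good s u w m _ su).
  by apply: eq_avoid a => x; rewrite sh.
rewrite sum_sym.
have Z t : t <> flip s -> v t * ex v L (fun w => ind R (matches r m.+1 (cw s (u ++ t :: w)))) = 0.
  move=> ht; rewrite (_ : ex _ _ _ = 0) ?mulr0 // -[RHS](ex0 v L).
  by apply: eq_ex => w _; rewrite E (ind0 _ ht) mul0r.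
have T : ex v L (fun w => ind R (matches r m.+1 (cw s (u ++ flip s :: w)))) =
    survival r (flip s) m L * ind R (good (cw s (rcons u (flip s))) 0 m.+1).
  rewrite mulrC -exZ; apply: eq_ex => w _.
  by rewrite E ind1 // mul1r.
case: s s0 E Z T => [[]|] // _ E Z T; rewrite -mulrA -T (Z None) // add0r.
  by rewrite (Z (Some true)) // add0r.
by rewrite (Z (Some false)) // addr0.
Qed.

(** Here [a] is the weight of the colour opposite to the starting letter and [b] that of its own
    colour. They are exchanged at each level because the far end of a segment starts the next
    round. *)
Fixpoint bnd (a b : R) r n : R :=
  if r is r'.+1 then 1 - \sum_(1 <= m < n.+1) imass m * a * bnd b a r' m.-1 else 1.

Lemma bndS a b r n : bnd a b r.+1 n.+1 = bnd a b r.+1 n - imass n.+1 * a * bnd b a r n.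
Proof. by rewrite /= big_nat_recr //= opprD addrA. Qed.

(** Each level of [avoid] negates the next one, so upper and lower bounds alternate. For odd [r] the
    event [matches] lies inside [avoid] by [good_avoid_before] and its mass is subtracted exactly;
    for even [r] the subtraction may remove too much, which is harmless for a lower bound. *)
Lemma survival_bnd r s n K : s <> None -> (r * n <= K)%N ->
  if odd r then bnd (v (flip s)) (v s) r n <= survival r s n K
  else survival r s n K <= bnd (v (flip s)) (v s) r n.
Proof.
elim: r s n K => [|r IH] s n K s0 rn.
  rewrite /= /survival -[leRHS](ex1 K v1); apply: ex_mono => // w _; exact: ind_le1.
have fs0 : flip s <> None by exact: flip_None.
elim: n rn => [|n IHn] rn.
  by rewrite survival0 /= big_geq // subr0 !lexx; case: ifP.
have rn' : (r.+1 * n <= K)%N by lia.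
have nK : (0 < n.+1 <= K)%N by lia.
have rn2 : (r * n <= K - n.+1)%N by nia.
have M := matches_mass r s0 nK.
have c0 : 0 <= imass n.+1 * v (flip s) by rewrite mulr_ge0 // imass_ge0.
have := IH (flip s) n (K - n.+1)%N fs0 rn2; rewrite flipK /= => IHr.
have {}IHn := IHn rn'.
rewrite /= in IHn *; rewrite -[1 - _]/(bnd _ _ r.+1 n.+1) bndS.
rewrite -[1 - _]/(bnd (v (flip s)) (v s) r.+1 n) in IHn.
case: (boolP (odd r)) IHr IHn => odr /= IHr IHn.
- have -> : survival r.+1 s n.+1 K = survival r.+1 s n K -
     ex v K (fun w => ind R (matches r n.+1 (cw s w))).
    rewrite -exB; apply: eq_ex => w _.
    have [m|nm] := pselect (matches r n.+1 (cw s w)).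
      rewrite (ind1 _ m) ind0; last by move/avoidS => -[].
      rewrite ind1 ?subrr //; case: m => cm gm am.
      have -> : r.+1 = (r.+1)./2.*2 by lia.
      exact: (good_avoid_before _ cm gm).
    rewrite (ind0 _ nm) subr0; apply: ind_iff; rewrite avoidS; tauto.
  by rewrite M lerB // ler_wpM2l.
- have : survival r.+1 s n K - ex v K (fun w => ind R (matches r n.+1 (cw s w)))
      <= survival r.+1 s n.+1 K.
    rewrite -exB; apply: ex_mono => // w _.
    have [m|nm] := pselect (matches r n.+1 (cw s w)).
      rewrite (ind1 _ m); apply: le_trans (ind_ge0 _ _).
      by rewrite subr_le0 ind_le1.
    rewrite (ind0 _ nm) subr0; apply: le_ind; rewrite avoidS; tauto.
  by apply: le_trans; rewrite M lerB // ler_wpM2l.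
Qed.

End Survival.

(** * Lower bound for the mass of good segments by averaging over rotations *)

(** The antiperiodic continuation of a word of length [m]. *)
Definition twist (m : nat) (w : seq sym) (x : nat) : sym :=
  if odd (x %/ m) then flip (nth None w (x %% m)) else nth None w (x %% m).

Lemma twist_antiper m w : (0 < m)%N -> antiper m (twist m w).
Proof.
move=> m0 x; rewrite /twist modnDr divnDr // divnn m0 addn1 /=.
by case: odd => //=; rewrite flipK.
Qed.

Lemma twist_small m w x : (x < m)%N -> twist m w x = nth None w x.
Proof. by move=> xm; rewrite /twist divn_small // modn_small. Qed.

(** Together with [ex_rotate] this makes the mass of [cut_good] independent of the place of the
    cut. *)
Lemma twist_rot m s w x : size w = m ->
  twist m.+1 (rcons w (flip s)) x = twist m.+1 (s :: w) x.+1.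
Proof.
move=> sw; have ac w' := @twist_antiper m.+1 w' isT.
rewrite (@antiper_mod m.+1 isT _ x (ac _)).
have -> : twist m.+1 (s :: w) x.+1 = if odd (x %/ m.+1) then
    flip (twist m.+1 (s :: w) (x %% m.+1).+1) else twist m.+1 (s :: w) (x %% m.+1).+1.
  rewrite {1}(divn_eq x m.+1); elim: (x %/ m.+1)%N => [|q IH]; first by rewrite mul0n.
  have -> : ((q.+1 * m.+1 + x %% m.+1).+1 = (q * m.+1 + x %% m.+1).+1 + m.+1)%N.
    by rewrite mulSn; lia.
  by rewrite ac IH /=; case: odd => //=; rewrite flipK.
suff -> : twist m.+1 (rcons w (flip s)) (x %% m.+1) = twist m.+1 (s :: w) (x %% m.+1).+1 by [].
have : (x %% m.+1 < m.+1)%N by rewrite ltn_mod.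
set y := (x %% m.+1)%N => hy; rewrite twist_small // nth_rcons sw.
case: (ltngtP y m) => h; last 2 first.
- by lia.
- by rewrite h -[m.+1 in RHS]add0n (ac _ 0%N) twist_small.
- by rewrite twist_small.
Qed.

Section RotationMass.
Variables (R : realFieldType) (v : sym -> R).
Hypothesis v0 : forall s, 0 <= v s.
Hypothesis vflip : forall s, v (flip s) = v s.

Lemma ex_rotate m g : ex v m.+1 g =
  ex v m.+1 (fun w => if w is s :: u then g (rcons u (flip s)) else 0).
Proof.
rewrite ex_rcons /= (reindex_inj (can_inj flipK)) /=.
by apply: eq_bigr => s _; rewrite vflip.
Qed.

Definition cut_good m j (w : seq sym) :=
  twist m w j = Some true /\ good (twist m w) j (j + m).

Lemma ex_cut m j : ex v m.+1 (fun w => ind R (cut_good m.+1 j w)) =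
  ex v m.+1 (fun w => ind R (cut_good m.+1 0 w)).
Proof.
elim: j => [//|j IH]; rewrite -IH [RHS]ex_rotate; apply: eq_ex => -[//|s w] [sw].
apply: ind_iff; rewrite /cut_good twist_rot // addSn.
have e x : shift 1 (twist m.+1 (s :: w)) x = twist m.+1 (rcons w (flip s)) x.
  by rewrite /shift add1n twist_rot.
split=> -[h g]; split=> //.
- apply: (@eq_good (shift 1 (twist m.+1 (s :: w)))); first by move=> x _; rewrite e.
  by apply/good_shift; rewrite !add1n.
- have : good (shift 1 (twist m.+1 (s :: w))) j (j + m.+1).
    by apply: eq_good g => x _; rewrite e.
  by move/good_shift; rewrite !add1n.
Qed.

(** The indicator of an odd count [k] is [(1 - (-1)^k) / 2], and both terms are multiplicative over
    the letters. *)
Lemma odd_count m : ex v m (fun w => ind R (odd (count (fun s => s != None) w))) =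
  ((v None + 2 * v (Some true)) ^+ m - (v None - 2 * v (Some true)) ^+ m) / 2.
Proof.
have vf : v (Some false) = v (Some true) by rewrite -(vflip (Some true)).
have -> : (v None + 2 * v (Some true)) ^+ m = ex v m (fun=> 1).
  elim: m => [//|m IH]; rewrite exprS IH /= sum_sym vf; ring.
have -> : (v None - 2 * v (Some true)) ^+ m =
    ex v m (fun w => (-1) ^+ count (fun s => s != None) w).
  elim: m => [//|m IH]; rewrite exprS IH /= sum_sym vf /=.
  rewrite !(eq_ex v (f := fun w => (-1) ^+ (1 + _))
    (g := fun w => -1 * (-1) ^+ count (fun s => s != None) w)); last first.
    by move=> w _; rewrite exprS.
  rewrite exZ; under [ex v m (fun w => (-1) ^+ (0 + _))]eq_ex do rewrite add0n.
  ring.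
rewrite -exB mulrC -exZ; apply: eq_ex => w _.
rewrite /ind asboolb -signr_odd.
by case: odd; rewrite /= ?expr0 ?expr1; field.
Qed.

Hypothesis v1 : v None + 2 * v (Some true) <= 1.

(** Union bound over the first position modulo [m] and the distance of a tie, whose three letters
    occupy distinct positions of the period. *)
Lemma not_tiefree_mass m : (0 < m)%N ->
  ex v m (fun w => ind R (~ tiefree m (twist m w))) <= m%:R ^+ 2 * (2 * v (Some true)) ^+ 3.
Proof.
move=> m0.
have vf : v (Some false) = v (Some true) by rewrite -(vflip (Some true)).
have hs : \sum_s v s <= 1 by rewrite sum_sym vf; have := v1; lra.
have hc : v (Some true) + v (Some false) <= 2 * v (Some true) by rewrite vf; lra.
pose Q (w : seq sym) (ud : 'I_m * 'I_m) :=
  [/\ (ud.1 + ud.2) %% m != ud.1, (ud.1 + ud.2 + ud.2) %% m != ud.1,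
      (ud.1 + ud.2) %% m != (ud.1 + ud.2 + ud.2) %% m &
      [/\ nth None w ud.1 <> None, nth None w ((ud.1 + ud.2) %% m) <> None &
          nth None w ((ud.1 + ud.2 + ud.2) %% m) <> None]]%N.
apply: (@le_trans _ _ (ex v m (fun w => \sum_ud ind R (Q w ud)))).
  apply: ex_mono => // w sw; apply: ind_le_big => /existsNP[u /existsNP[d]].
  move=> /not_implyP[hd /not_implyP[cud /not_implyP[cu /not_implyP[cudd _]]]].
  have ac := twist_antiper w m0.
  have cu0 : twist m w u <> None by rewrite cu; exact: flip_None.
  have cudd0 : twist m w (u + d + d) <> None by rewrite cudd; exact: flip_None.
  have nz x : twist m w x <> None -> nth None w (x %% m) <> None.
    by rewrite /twist; case: odd => // h e; apply: h; rewrite e.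
  have hm : (u %% m < m)%N by rewrite ltn_mod.
  have dm : (d < m)%N by lia.
  exists (Ordinal hm, Ordinal dm) => /=.
  have e1 : ((u %% m + d) %% m = (u + d) %% m)%N by rewrite modnDml.
  have e2 : ((u %% m + d + d) %% m = (u + d + d) %% m)%N.
    by rewrite -addnA modnDml addnA.
  rewrite /Q /= e1 e2; split.
  - apply/eqP => e; have := modn_inj_small e; rewrite /gap => H.
    by have := H ltac:(lia); lia.
  - apply/eqP => e.
    (* The outer positions can only coincide modulo [m] when they differ by one period, and then
       antiperiodicity gives them opposite colours, while a tie gives them the same. *)
    have E : (u + d + d = u + m)%N.
      case: (ltngtP (d + d) m) => hh.
      + by have := modn_inj_small e; rewrite /gap => H; have := H ltac:(lia); lia.
      + have e' : ((u + d + d) %% m = (u + m) %% m)%N by rewrite modnDr.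
        by have := modn_inj_small e'; rewrite /gap => H; apply: H; lia.
      + by lia.
    by move: cudd; rewrite E ac cu !flipK => /esym; exact: flip_neq.
  - apply/eqP => e; have := modn_inj_small e; rewrite /gap => H.
    by have := H ltac:(lia); lia.
  - by split; exact: nz.
rewrite ex_sum (le_trans (y := \sum_(ud : 'I_m * 'I_m) (2 * v (Some true)) ^+ 3)) //.
  apply: ler_sum => -[u d] _; rewrite /Q /=.
  have [[h1 h2 h3]|nh] := pselect [/\ (u + d) %% m != u, (u + d + d) %% m != u &
      (u + d) %% m != (u + d + d) %% m]%N.
    apply: (le_trans (y := ex v m (fun w => ind R [/\ nth None w u <> None,
        nth None w ((u + d) %% m) <> None & nth None w ((u + d + d) %% m) <> None]))).
      by apply: ex_mono => // w _; apply: le_ind => -[].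
    by apply: ex_nonempty3; rewrite // ?ltn_mod // eq_sym.
  rewrite (_ : ex _ _ _ = 0) ?exprn_ge0 ?mulr_ge0 // -[RHS](ex0 v m).
  by apply: eq_ex => w _; rewrite ind0 // => -[a b c _]; apply: nh.
by rewrite sumr_const card_prod !card_ord -[leLHS]mulr_natl natrM expr2 lexx.
Qed.

(* The first and last letters of a good segment of length [m] are one letter of the
   twisted word: averaging [rotation_good] over the [2 m] rotations bounds the mass
   of a good segment starting at [0], up to the words with ties. *)
Lemma cut_mass m : (0 < m)%N ->
  ((v None + 2 * v (Some true)) ^+ m - (v None - 2 * v (Some true)) ^+ m) / 2
    - m%:R ^+ 2 * (2 * v (Some true)) ^+ 3
  <= 2 * m%:R * ex v m (fun w => ind R (cut_good m 0 w)).
Proof.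
move=> m0.
apply: (le_trans (lerB (lexx _) (not_tiefree_mass m0))).
rewrite -odd_count -exB.
have -> : 2 * m%:R * ex v m (fun w => ind R (cut_good m 0 w)) =
    ex v m (fun w => \sum_(j < m + m) ind R (cut_good m j w)).
  rewrite ex_sum; case: m m0 => // m _.
  under eq_bigr do rewrite ex_cut.
  by rewrite sumr_const card_ord -[in RHS]mulr_natl natrD; congr (_ * _); ring.
apply: ex_mono => // w sw.
have [tf|ntf] := pselect (tiefree m (twist m w)); last first.
  rewrite (ind1 _ ntf); apply: (@le_trans _ _ 0); first by rewrite subr_le0 ind_le1.
  by apply: sumr_ge0 => i _; exact: ind_ge0.
rewrite (@ind0 R (~ tiefree m (twist m w))) ?subr0; last by [].
apply: ind_le_big => oc.
have ac := twist_antiper w m0.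
have cnt : #|[set x : 'I_m | twist m w x != None]| = count (fun s => s != None) w.
  rewrite -sum1_card (eq_bigl (fun x : 'I_m => nth None w x != None)); last first.
    by move=> x; rewrite inE twist_small.
  rewrite -[in RHS](mkseq_nth None w) sw /mkseq count_map -sum1_count.
  rewrite -(big_mkord (fun i => nth None w i != None) (fun=> 1%N)) /index_iota subn0.
  by apply: eq_bigl.
have [k kE] : exists k, count (fun s => s != None) w = k.*2.+1.
  by exists (count (fun s => s != None) w)./2; rewrite -[LHS]odd_double_half oc.
have [j [jm cj gj]] := rotation_good m0 ac tf (etrans cnt kE).
case E : (twist m w j) cj => [[]|] // _.
- have h : (j < m + m)%N by lia.
  by exists (Ordinal h); split.
(* A good cut with a red start at [j] is a good cut with a blue start one period later; hence
   [m + m] cuts in the sum. *)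
- have h : (j + m < m + m)%N by lia.
  exists (Ordinal h); split; rewrite /= ?ac ?E //.
  have : good (shift m (twist m w)) j (j + m).
    by apply: eq_good (good_flip gj) => x _; rewrite /shift addnC ac.
  by move/good_shift; rewrite addnC (addnC m (j + m)).
Qed.

End RotationMass.

(** * The recursion at infinite depth and its closed form *)

Section ExactRecursion.
Variables (R : realFieldType) (v : sym -> R) (h : R).
Hypothesis v0 : forall s, 0 <= v s.
Hypothesis h0 : 0 < h.
Hypothesis vh1 : v None + 2 * h <= 1.
Let im := imass v h.

Let vs0 s : 0 <= vsym v h s. Proof. by apply: vsym_ge0. Qed.

Lemma imass_le1 m : im m <= 1.
Proof.
apply: (@le_trans _ _ (ex (vsym v h) m.-1 (fun=> 1))).
  by apply: ex_mono => // w _; exact: ind_le1.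
elim: m.-1 => [//|k IH] /=; rewrite sum_sym /=.
have e0 : 0 <= ex (vsym v h) k (fun=> 1) by apply: ex_ge0.
by have := v0 None; have := vh1; nra.
Qed.

(** A cut at [0] prescribes a blue first letter, of weight [h], whose antiperiodic copy is the red
    end. So [h * im m] is the mass bounded below by [cut_mass]. *)
Lemma imass_lower m : (0 < m)%N ->
  ((v None + 2 * h) ^+ m - (v None - 2 * h) ^+ m) / (4 * m%:R)
    - m%:R * (2 * h) ^+ 3 / 2 <= h * im m.
Proof.
move=> m0; have := @cut_mass R (vsym v h) vs0 (vsym_flip v h) vh1 m m0.
have -> : ex (vsym v h) m (fun w => ind R (cut_good m 0 w)) = h * im m.
  case: m m0 => // m _ /=; rewrite sum_sym /=.
  have E s : ex (vsym v h) m (fun w => ind R (cut_good m.+1 0 (s :: w))) =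
      if s == Some true then im m.+1 else 0.
    case: eqP => hs.
      rewrite hs /im /imass; apply: eq_ex => w sw; apply: ind_iff.
      have e x : (0 <= x <= m.+1)%N -> twist m.+1 (Some true :: w) x =
          cw (Some true) (rcons w (Some false)) x.
        move=> hx; case: (ltngtP x m.+1) => hx'; last 2 first.
        - by lia.
        - have := @twist_antiper m.+1 (Some true :: w) isT 0.
          rewrite add0n hx' => ->; rewrite twist_small //=.
          by rewrite /cw /= nth_rcons sw ltnn eqxx.
        - rewrite twist_small // /cw; case: x {hx} hx' => //= x hx'.
          by rewrite nth_rcons sw ifT.
      rewrite /cut_good add0n twist_small //; split=> [[_]|g].
        by apply: eq_good => x hx; rewrite e.
      by split=> //; apply: eq_good g => x hx; rewrite e.
    rewrite -[RHS](ex0 (vsym v h) m); apply: eq_ex => w _; rewrite ind0 // => -[].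
    by rewrite twist_small //= => /hs.
  by rewrite !E /=; ring.
have m0' : (0 : R) < m%:R by rewrite ltr0n.
rewrite /=; set a := (_ ^+ m - _); set k := h * im m; move=> H.
rewrite -(ler_pM2l (_ : 0 < 2 * m%:R :> R)); last by rewrite mulr_gt0.
apply: le_trans H; rewrite le_eqVlt; apply/orP; left; apply/eqP; field.
by rewrite gt_eqF.
Qed.

(* The limit of [bnd] at infinite depth. *)
Fixpoint ysol (a b : R) n : R * R :=
  if n is n'.+1 then let yz := ysol a b n' in
    (yz.1 - im n * a * yz.2, yz.2 - im n * b * yz.1) else (1, 1).

Lemma ysolC a b n : ysol b a n = ((ysol a b n).2, (ysol a b n).1).
Proof. by elim: n => [//|n /= ->]. Qed.

Lemma ysol_sum a b n : (ysol a b n).1 = 1 - \sum_(1 <= m < n.+1) im m * a * (ysol b a m.-1).1.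
Proof.
elim: n => [|n IH]; first by rewrite big_geq // subr0.
by rewrite big_nat_recr //= opprD addrA -IH ysolC.
Qed.

(** A common majorant for both components of [ysol]. The factor [2] is chosen so that one level of
    the recursion halves a multiple of it, see [growth_sum]. *)
Definition growth (c : R) n := \prod_(1 <= m < n.+1) (1 + 2 * (im m * c)).

Lemma im0 m : 0 <= im m. Proof. by apply: imass_ge0. Qed.

Lemma growth_ge1 c n : 0 <= c -> 1 <= growth c n.
Proof.
move=> c0; elim: n => [|n IH]; first by rewrite /growth big_geq.
rewrite /growth big_nat_recr //= -/(growth c n).
have := mulr_ge0 (im0 n.+1) c0; nra.
Qed.

Lemma growth_sum c n : \sum_(1 <= m < n.+1) im m * c * (2 * growth c m.-1) = growth c n - 1.
Proof.
elim: n => [|n IH]; first by rewrite big_geq // /growth big_geq // subrr.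
rewrite big_nat_recr //= IH /growth [in RHS]big_nat_recr //= -/(growth c n).
by ring.
Qed.

Lemma ysol_growth a b c n : 0 <= a <= c -> 0 <= b <= c ->
  `|(ysol a b n).1| <= growth c n /\ `|(ysol a b n).2| <= growth c n.
Proof.
move=> /andP[a0 ac] /andP[b0 bc]; elim: n => [|n [IH1 IH2]] /=.
  by rewrite /growth big_geq // normr1.
have i0 := im0 n.+1; have c0 : 0 <= c by exact: le_trans ac.
have g1 := growth_ge1 n c0.
rewrite /growth big_nat_recr //= -/(growth c n).
have H x y e : 0 <= e <= c -> `|x| <= growth c n -> `|y| <= growth c n ->
    `|x - im n.+1 * e * y| <= growth c n * (1 + 2 * (im n.+1 * c)).
  move=> /andP[e0 ec] hx hy.
  apply: (le_trans (ler_normB _ _)); rewrite !normrM (ger0_norm i0) (ger0_norm e0).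
  have : im n.+1 * e * `|y| <= im n.+1 * c * growth c n.
    by rewrite ler_pM ?mulr_ge0 // ler_wpM2l.
  have := mulr_ge0 (mulr_ge0 i0 c0) (le_trans ler01 g1); nra.
by split; apply: H => //; apply/andP.
Qed.

(** Each level sums the previous error against the weights [im m * c], which halves it by
    [growth_sum]. *)
Lemma bnd_ysol a b c r n : 0 <= a <= c -> 0 <= b <= c ->
  `|bnd v h a b r n - (ysol a b n).1| <= 2 * (1 / 2) ^+ r * growth c n.
Proof.
elim: r a b n => [|r IH] a b n ha hb.
  have c0 : 0 <= c by case/andP: ha => h1 h2; apply: le_trans h2.
  rewrite /= expr0 mulr1 (le_trans (ler_normB _ _)) // normr1.
  have [h1 _] := ysol_growth n ha hb; have := growth_ge1 n c0; lra.
have /andP[a0 ac] := ha; have c0 : 0 <= c by exact: le_trans ac.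
rewrite ysol_sum /= opprB addrC addrA subrK -/im.
rewrite -sumrB (le_trans (ler_norm_sum _ _ _)) //.
apply: (@le_trans _ _ (\sum_(1 <= m < n.+1) im m * c * (2 * (1 / 2) ^+ r * growth c m.-1))).
  apply: ler_sum_nat => m _.
  rewrite -mulrBr !normrM (ger0_norm (im0 m)) (ger0_norm a0).
  by rewrite ler_pM ?mulr_ge0 ?im0 // ?ler_wpM2l ?im0 // distrC IH.
have -> : \sum_(1 <= m < n.+1) im m * c * (2 * (1 / 2) ^+ r * growth c m.-1) =
    (1 / 2) ^+ r * (growth c n - 1).
  by rewrite -growth_sum mulr_sumr; apply: eq_bigr => m _; ring.
have q0 : 0 <= (1 / 2) ^+ r :> R by apply: exprn_ge0; rewrite divr_ge0.
have g1 := growth_ge1 n c0.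
by rewrite exprS; nra.
Qed.

(** With [y] and [z] the two components, [y + s z] and [y - s z] diagonalize the recursion: they
    start at [1 + s] and [1 - s], and step [n] multiplies them by [1 - h * im n] and
    [1 + h * im n]. *)
Lemma ysol_closed s n : 0 < s ->
  (ysol (h * s) (h / s) n).1 =
    ((1 + s) * \prod_(1 <= m < n.+1) (1 - h * im m)
     - (s - 1) * \prod_(1 <= m < n.+1) (1 + h * im m)) / 2.
Proof.
move=> s0; have sn : s != 0 by rewrite gt_eqF.
suff : (ysol (h * s) (h / s) n).1 =
    ((1 + s) * \prod_(1 <= m < n.+1) (1 - h * im m)
     - (s - 1) * \prod_(1 <= m < n.+1) (1 + h * im m)) / 2 /\
  (ysol (h * s) (h / s) n).2 =
    ((1 + s^-1) * \prod_(1 <= m < n.+1) (1 - h * im m)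
     + (1 - s^-1) * \prod_(1 <= m < n.+1) (1 + h * im m)) / 2 by case.
elim: n => [|n [/= -> ->]]; first by rewrite !big_geq //=; split; field.
have E (F : nat -> R) : \prod_(1 <= m < n.+2) F m = (\prod_(1 <= m < n.+1) F m) * F n.+1.
  by rewrite big_nat_recr.
by rewrite !E; split; field.
Qed.

End ExactRecursion.

Import numFieldNormedType.Exports.
Local Open Scope classical_set_scope.
Local Open Scope ring_scope.

Section Analysis.
Variable R : realType.

(** * The limit of small cells *)

Lemma is_derive_powersum (n : nat) (x : R) :
  is_derive x 1 (fun y : R => \sum_(1 <= m < n.+1) y ^+ m / m%:R) (\sum_(i < n) x ^+ i).
Proof.
elim: n => [|n IH].
  rewrite big_ord0 (_ : (fun _ => _) = cst 0); first exact: is_derive_cst.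
  by apply/funext => y; rewrite big_geq.
rewrite (_ : (fun _ => _) = (fun y : R => \sum_(1 <= m < n.+1) y ^+ m / m%:R) +
    (n.+1%:R^-1 *: (fun y : R => y ^+ n.+1))); last first.
  apply/funext => y; rewrite big_nat_recr //= [in RHS]fctE; congr (_ + _).
  by rewrite mulrC.
rewrite big_ord_recr /=; apply: is_deriveD.
have -> : (fun y : R => y ^+ n.+1) = (id : R -> R) ^+ n.+1.
  by apply/funext => y; rewrite exprfctE.
apply: is_derive_eq; rewrite /GRing.scale /= mulr1 mulrA mulVf ?mul1r //.
Qed.

(** The sum [S] satisfies [(1 - x) S = 1 - x^n] and [S >= n x^n]; the first relation times [n] is
    added to the second. *)
Lemma geom_ge n (x : R) : 0 <= x <= 1 ->
  n%:R / (1 + n%:R * (1 - x)) <= \sum_(i < n) x ^+ i.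
Proof.
move=> /andP[x0 x1].
have n0 : (0 : R) <= n%:R by exact: ler0n.
rewrite ler_pdivrMr; last by nra.
have S : (1 - x) * \sum_(i < n) x ^+ i = 1 - x ^+ n.
  elim: n {n0} => [|n IH]; first by rewrite big_ord0 mulr0 expr0 subrr.
  by rewrite big_ord_recr /= mulrDr IH exprS; ring.
have L : n%:R * x ^+ n <= \sum_(i < n) x ^+ i.
  rewrite mulr_natl -[n in leLHS]card_ord -sumr_const; apply: ler_sum => i _.
  by rewrite card_ord ler_wiXn2l // ltnW.
have -> : (\sum_(i < n) x ^+ i) * (1 + n%:R * (1 - x)) =
  \sum_(i < n) x ^+ i + n%:R * ((1 - x) * \sum_(i < n) x ^+ i) by ring.
by rewrite S; lra.
Qed.

(** A truncated form of the logarithm series that stays valid up to [1]: the sum of [x^m / m] plus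
    [ln (1 + n (1 - x))] is nondecreasing in [x], its derivative being nonnegative by [geom_ge]. *)
Lemma ln_powersum n (a b : R) : 0 <= b -> b <= a -> a <= 1 ->
  ln ((1 + n%:R * (1 - b)) / (1 + n%:R * (1 - a))) <=
  \sum_(1 <= m < n.+1) (a ^+ m - b ^+ m) / m%:R.
Proof.
move=> b0 ba a1.
have n0 : (0 : R) <= n%:R by exact: ler0n.
have pos (x : R) : x <= 1 -> 0 < 1 + n%:R * (1 - x) by move=> x1; nra.
pose f (x : R) : R := \sum_(1 <= m < n.+1) x ^+ m / m%:R + ln (1 + n%:R * (1 - x)).
pose df (x : R) : R := \sum_(i < n) x ^+ i - n%:R / (1 + n%:R * (1 - x)).
have dl (x : R) : x <= 1 -> is_derive x 1 f (df x).
  move=> x1.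
  have d1 : is_derive x 1 (fun x : R => 1 + n%:R * (1 - x)) (- n%:R).
    rewrite (_ : (fun _ => _) = cst (1 + n%:R) - (n%:R *: id)); last first.
      by apply/funext => y; rewrite !fctE /= /GRing.scale /=; ring.
    by apply: is_derive_eq; rewrite /GRing.scale /= mulr1 sub0r.
  have := is_derive1_ln (pos x x1) => d2.
  have d3 := @is_derive1_comp R (@ln R) (fun x => 1 + n%:R * (1 - x)) x _ _ d2 d1.
  have := is_deriveD (is_derive_powersum n x) d3.
  by move=> d4; apply: is_derive_eq; rewrite /df; congr (_ + _); rewrite mulrC mulNr.
have cf : {within `[b, a], continuous f}.
  apply: continuous_in_subspaceT => x; rewrite inE /= in_itv /= => /andP[_ xa].
  apply: differentiable_continuous; apply/derivable1_diffP.
  have D := dl x (le_trans xa a1); exact: ex_derive.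
have [|c] := MVT_segment ba _ cf (df := df).
  by move=> x; rewrite in_itv /= => /andP[_ /ltW xa]; apply: dl; exact: le_trans a1.
rewrite in_itv /= => /andP[bc ca] E.
have : 0 <= f a - f b.
  rewrite E mulr_ge0 ?subr_ge0 // geom_ge //.
  by rewrite (le_trans b0 bc) (le_trans ca a1).
rewrite /f ln_div ?posrE ?pos //; last exact: le_trans a1.
under [\sum_(1 <= m < n.+1) (a ^+ m - b ^+ m) / m%:R]eq_bigr do rewrite mulrBl.
rewrite sumrB; lra.
Qed.

Section Bound.
Variables (v : sym -> R) (h s : R).
Hypothesis v0 : forall x, 0 <= v x.
Hypothesis h0 : 0 < h.
Hypothesis vh1 : v None + 2 * h <= 1.
Hypothesis vh0 : 0 <= v None - 2 * h.
Hypothesis s1 : 1 <= s.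

(** The exponent collects the lower bounds of [imass_lower] for [m] up to [n]: the logarithm comes
    from [ln_powersum], and the cubic term bounds the tie errors, with each [m] replaced by [n]. *)
Definition xfac (n : nat) : R :=
  expR (- (ln ((1 + n%:R * (1 - (v None - 2 * h))) / (1 + n%:R * (1 - (v None + 2 * h)))) / 4
           - n%:R ^+ 2 * (2 * h) ^+ 3 / 2)).

Lemma prod_sub_le n : \prod_(1 <= m < n.+1) (1 - h * imass v h m) <= xfac n.
Proof.
have i0 m : 0 <= imass v h m by apply: imass_ge0.
have i1 m : imass v h m <= 1 by apply: imass_le1.
have K1 m : h * imass v h m <= 1 by have := v0 None; have := h0; have := vh1; have := i0 m; have := i1 m; nra.
apply: (@le_trans _ _ (expR (- \sum_(1 <= m < n.+1) h * imass v h m))).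
  rewrite -sumrN expR_sum; apply: ler_prod => m _.
  by rewrite subr_ge0 K1 /= expR_ge1Dx.
rewrite ler_expR lerN2.
apply: (@le_trans _ _ (\sum_(1 <= m < n.+1)
   (((v None + 2 * h) ^+ m - (v None - 2 * h) ^+ m) / (4 * m%:R)
    - m%:R * (2 * h) ^+ 3 / 2))); last first.
  by apply: ler_sum_nat => m /andP[m0 _]; exact: imass_lower.
rewrite sumrB lerB //.
  have ab : v None - 2 * h <= v None + 2 * h by have := h0; lra.
  rewrite ler_pdivrMr //; apply: (le_trans (ln_powersum n vh0 ab vh1)).
  rewrite mulr_suml le_eqVlt; apply/orP; left; apply/eqP.
  by apply: eq_bigr => m _; rewrite invfM; move: (m%:R^-1) => z; field.
have -> : n%:R ^+ 2 * (2 * h) ^+ 3 / 2 = \sum_(1 <= m < n.+1) (n%:R * (2 * h) ^+ 3 / 2).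
  by rewrite sumr_const_nat subn1 /= -mulr_natl; ring.
apply: ler_sum_nat => m /andP[_ mn].
have h3 : 0 <= (2 * h) ^+ 3 / 2 by rewrite divr_ge0 // exprn_ge0 // mulr_ge0 // ltW.
rewrite -(mulrA m%:R) -(mulrA n%:R); apply: ler_wpM2r => //; by rewrite ler_nat.
Qed.

(** Multiplied by the product of the [1 - h i_m], the right-hand side becomes a product of factors
    at least [1 - h^2], hence at least [1 - n h^2]. *)
Lemma prod_add_ge n : n%:R * h ^+ 2 <= 1 ->
  (1 - n%:R * h ^+ 2) / xfac n <= \prod_(1 <= m < n.+1) (1 + h * imass v h m).
Proof.
move=> nh.
have i0 m : 0 <= imass v h m by apply: imass_ge0.
have i1 m : imass v h m <= 1 by apply: imass_le1.
have hs : h < 1 by have := v0 None; have := h0; have := vh1; lra.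
have K1 m : h * imass v h m < 1 by have := i0 m; have := i1 m; have := h0; nra.
have K0 m : 0 <= h * imass v h m by rewrite mulr_ge0 // ltW.
have F0 m : 0 <= (1 + h * imass v h m) * (1 - h * imass v h m).
  by have := K0 m; have := K1 m; nra.
rewrite ler_pdivrMr ?expR_gt0 //.
have P0 : 0 <= \prod_(1 <= m < n.+1) (1 + h * imass v h m).
  by apply: prodr_ge0 => m _; rewrite addr_ge0.
apply: le_trans (ler_wpM2l P0 (prod_sub_le n)).
rewrite -big_split /=.
elim: n {nh P0} => [|n IH]; first by rewrite big_geq // mul0r subr0.
rewrite big_nat_recr //=.
set P := \prod_(1 <= i < n.+1) _ in IH *.
have P1 : P <= 1.
  rewrite /P; elim: n {IH P} => [|n IH]; first by rewrite big_geq.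
  rewrite big_nat_recr //= mulr_ile1 //.
  - by apply: prodr_ge0 => m _; apply: F0.
  - by have := K0 n.+1; nra.
have P0 : 0 <= P.
  by apply: prodr_ge0 => m _; apply: F0.
have k2 : (h * imass v h n.+1) ^+ 2 <= h ^+ 2.
  rewrite exprMn -[leRHS]mulr1 ler_wpM2l ?sqr_ge0 // expr_le1 //.
rewrite -natr1; set k := h * _ in k2 *; rewrite [(1 + k) * (1 - k)](_ : _ = 1 - k ^+ 2); last by ring.
have := sqr_ge0 k; nra.
Qed.

Lemma ysol_le n : n%:R * h ^+ 2 <= 1 ->
  (ysol v h (h * s) (h / s) n).1 <=
  ((1 + s) * xfac n - (s - 1) * ((1 - n%:R * h ^+ 2) / xfac n)) / 2.
Proof.
move=> nh; rewrite ysol_closed; last exact: lt_le_trans s1.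
rewrite ler_wpM2r // lerB // ler_wpM2l ?prod_sub_le ?prod_add_ge //; have := s1; lra.
Qed.

Lemma growth_le c n : 0 <= c -> growth v h c n <= expR (2 * (n%:R * c)).
Proof.
move=> c0; have -> : expR (2 * (n%:R * c)) = \prod_(1 <= m < n.+1) expR (2 * c).
  by rewrite prodr_const_nat subn1 /= -expRM_natl; congr expR; ring.
rewrite /growth big_seq [leRHS]big_seq; apply: ler_prod => m _.
have i0 : 0 <= imass v h m by apply: imass_ge0.
have i1 : imass v h m <= 1 by apply: imass_le1.
apply/andP; split; first by rewrite addr_ge0 // mulr_ge0 // mulr_ge0.
by apply: le_trans (expR_ge1Dx _); nra.
Qed.

End Bound.
End Analysis.

Lemma cvg_scale (R : realType) (f : nat -> R) (c l : R) :
  f @ \oo --> l -> c * f k @[k --> \oo] --> c * l.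
Proof. by move=> fl; apply: cvgM; [exact: cvg_cst|]. Qed.

Section Mesh.
Variable R : realType.

(** One is taken off because points in cells [n] apart may be almost [n.+1] cells apart: unless [n]
    is truncated to [0], this choice ensures [n.+1 <= t * N]. *)
Definition nmesh (t : R) (N : nat) : nat := (Num.truncn (t * N%:R)).-1.

Lemma nmesh_le (t : R) N : 0 <= t -> (nmesh t N)%:R <= t * N%:R.
Proof.
move=> t0; have h : 0 <= t * N%:R by rewrite mulr_ge0.
have /andP[h1 _] := truncn_itv h.
by apply: le_trans h1; rewrite ler_nat leq_pred.
Qed.

Lemma nmesh_ge (t : R) N : 0 <= t -> t * N%:R - 2 <= (nmesh t N)%:R.
Proof.
move=> t0; have h : 0 <= t * N%:R by rewrite mulr_ge0.
have /andP[_ h1] := truncn_itv h.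
have : (Num.truncn (t * N%:R)).+1%:R <= (nmesh t N)%:R + 2 :> R.
  by rewrite -(natrD _ _ 2) ler_nat /nmesh; move: (Num.truncn _) => z; lia.
by lra.
Qed.

Lemma cvg_mesh0 : (fun k : nat => (k.+1%:R)^-1 : R) @ \oo --> (0 : R).
Proof. exact: cvg_harmonic. Qed.

Lemma cvg_nmesh (t : R) : 0 <= t -> (nmesh t k.+1)%:R / k.+1%:R @[k --> \oo] --> (t : R).
Proof.
move=> t0.
have lo : (fun k : nat => t - 2 * (k.+1%:R)^-1) @ \oo --> t.
  rewrite -[X in _ --> X](_ : t - 2 * 0 = t); last by rewrite mulr0 subr0.
  by apply: cvgB; [exact: cvg_cst|apply: cvg_scale; exact: cvg_mesh0].
have hi : (fun k : nat => t) @ \oo --> t by exact: cvg_cst.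
apply: (squeeze_cvgr _ lo hi); apply: nearW => k; apply/andP; split.
  rewrite ler_pdivlMr ?ltr0n // mulrBl -mulrA mulVf ?pnatr_eq0 // mulr1.
  exact: nmesh_ge.
by rewrite ler_pdivrMr ?ltr0n // nmesh_le.
Qed.

End Mesh.

(** * The limiting survival function and the sums of its square *)

Section Limit.
Variables (R : realType) (lam mu : R).
Hypothesis lam0 : 0 < lam.
Hypothesis lammu : lam < mu.

Definition sratio : R := Num.sqrt (mu / lam).
Let s := sratio.
Definition Dbig : R := lam * (1 + s) ^+ 2.
Definition Dsmall : R := lam * (s - 1) ^+ 2.
Let D := Dbig.
Let d := Dsmall.

Lemma lam_sq : lam * s ^+ 2 = mu.
Proof.
rewrite sqr_sqrtr ?divr_ge0 ?ltW //; last exact: lt_trans lammu.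
by rewrite mulrC divfK // gt_eqF.
Qed.

Lemma sratio_gt1 : 1 < s.
Proof.
rewrite -(@sqrtr1 R) /s /sratio ltr_sqrt ?divr_gt0 //; last exact: lt_trans lammu.
by rewrite ltr_pdivlMr // mul1r.
Qed.

Lemma Dsum : D + d = 2 * (lam + mu).
Proof. by rewrite -lam_sq /D /d /Dbig /Dsmall; ring. Qed.
Lemma Dprod : D * d = (mu - lam) ^+ 2.
Proof. by rewrite -lam_sq /D /d /Dbig /Dsmall; ring. Qed.
Lemma D_gt0 : 0 < D.
Proof. by rewrite /D /Dbig mulr_gt0 // exprn_gt0 //; have := sratio_gt1; lra. Qed.
Lemma d_gt0 : 0 < d.
Proof. by rewrite /d /Dsmall mulr_gt0 // exprn_gt0 //; have := sratio_gt1; lra. Qed.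

Definition xlim (t : R) : R := expR (- (ln ((1 + D * t) / (1 + d * t)) / 4)).
Definition ybar (t : R) : R := ((1 + s) * xlim t - (s - 1) / xlim t) / 2.

Lemma xlim_gt0 (t : R) : 0 < xlim t. Proof. exact: expR_gt0. Qed.

Lemma lin_gt0 (c t : R) : 0 < c -> 0 <= t -> 0 < 1 + c * t.
Proof. by move=> c0 t0; have := mulr_ge0 (ltW c0) t0; lra. Qed.

Lemma xlim4 t : 0 <= t -> (xlim t ^+ 2) ^+ 2 * (1 + D * t) = 1 + d * t.
Proof.
move=> t0; have hD := lin_gt0 D_gt0 t0; have hd := lin_gt0 d_gt0 t0.
rewrite -exprM /xlim -expRM_natl mulrN [X in expR (- X)](_ : _ = ln ((1 + D * t) / (1 + d * t))); last by field.
rewrite expRN lnK ?posrE ?divr_gt0 // invf_div divfK // gt_eqF //.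
Qed.

Lemma ybar0 : ybar 0 = 1.
Proof.
by rewrite /ybar /xlim !mulr0 !addr0 !divr1 ln1 mul0r oppr0 expR0 divr1; field.
Qed.

Lemma ybar_sqr t : 4 * lam * ybar t ^+ 2 = D * xlim t ^+ 2 + d / xlim t ^+ 2 - 2 * (mu - lam).
Proof.
have := xlim_gt0 t; rewrite /ybar -lam_sq /D /d /Dbig /Dsmall; move: (xlim t) => x x0.
by field; rewrite gt_eqF.
Qed.

(* [S t = sqrt ((1 + D t) (1 + d t))]. *)
Let S (t : R) : R := (1 + D * t) * xlim t ^+ 2.

(** [S] is concave, so its increment is at least [tau] times its slope at [t + tau], which is
    [2 lam ybar^2 + (mu - lam)] there by [ybar_sqr]. *)
Lemma ybar_tangent t tau : 0 <= t -> 0 < tau ->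
  2 * lam * tau * ybar (t + tau) ^+ 2 <= S (t + tau) - S t - (mu - lam) * tau.
Proof.
move=> t0 tau0; have tt0 : 0 <= t + tau by rewrite addr_ge0 // ltW.
have Y := ybar_sqr (t + tau).
have X1 := xlim4 tt0; have X0 := xlim4 t0.
have c1 : 0 < xlim (t + tau) ^+ 2 by rewrite exprn_gt0 // xlim_gt0.
rewrite /S; move: (ybar _ ^+ 2) Y X0 X1 c1 => y.
move: (xlim (t + tau) ^+ 2) (xlim t ^+ 2) => c c0 Y X0 X1 c1.
have hD := lin_gt0 D_gt0 t0.
have cc : c * c^-1 = 1 by rewrite mulfV // gt_eqF.
have ci : 0 < c^-1 by rewrite invr_gt0.
have dE : d * tau * c^-1 = (c * c * (1 + D * (t + tau)) - c0 * c0 * (1 + D * t)) * c^-1.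
  by congr (_ * _); rewrite -!expr2 X1 X0; ring.
have dE' : d * tau * c^-1 = c * (1 + D * (t + tau)) - c0 * c0 * (1 + D * t) * c^-1.
  by rewrite dE mulrBl; congr (_ - _); rewrite -mulrA mulrC mulrA [c^-1 * _]mulrC; field; rewrite gt_eqF.
(* Concavity enters as the inequality between arithmetic and geometric means, so no derivative of
   [S] is taken. *)
have AG : 2 * c0 <= c0 * c0 * c^-1 + c.
  have : 0 <= (c0 - c) ^+ 2 * c^-1 by rewrite mulr_ge0 ?sqr_ge0 // ltW.
  have -> : (c0 - c) ^+ 2 * c^-1 = c0 * c0 * c^-1 - 2 * c0 * (c * c^-1) + c * (c * c^-1) by ring.
  by rewrite cc; lra.
have AG' : 0 <= (1 + D * t) * (c0 * c0 * c^-1 + c - 2 * c0) by apply: mulr_ge0; [exact: ltW|rewrite subr_ge0].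
have -> : 2 * lam * tau * y = tau * (4 * lam * y) / 2 by field.
rewrite Y; have -> : tau * (D * c + d / c - 2 * (mu - lam)) = D * tau * c + d * tau * c^-1 - 2 * (mu - lam) * tau by ring.
rewrite dE'; lra.
Qed.

(** The right-hand side is the asymptote of [S]; the squares differ by the constant
    [4 lam mu / (mu - lam)^2]. *)
Lemma S_le t : 0 <= t -> S t <= (mu - lam) * t + (lam + mu) / (mu - lam).
Proof.
move=> t0; have e0 : 0 < mu - lam by rewrite subr_gt0.
have hD := lin_gt0 D_gt0 t0.
have X := xlim4 t0.
have r0 : 0 <= (mu - lam) * t + (lam + mu) / (mu - lam).
  have mu0 := lt_trans lam0 lammu; apply: addr_ge0.
    by rewrite mulr_ge0 // ltW.
  by apply: divr_ge0; [apply: addr_ge0|]; exact: ltW.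
have S0 : 0 <= S t by rewrite mulr_ge0 ?sqr_ge0 // ltW.
suff : S t ^+ 2 <= ((mu - lam) * t + (lam + mu) / (mu - lam)) ^+ 2.
  by rewrite ler_pXn2r.
have -> : S t ^+ 2 = (1 + D * t) * (1 + d * t) by rewrite -X /S; ring.
have -> : (1 + D * t) * (1 + d * t) = 1 + (D + d) * t + D * d * t ^+ 2 by ring.
rewrite Dsum Dprod -subr_ge0.
have -> : ((mu - lam) * t + (lam + mu) / (mu - lam)) ^+ 2 - (1 + 2 * (lam + mu) * t + (mu - lam) ^+ 2 * t ^+ 2)
   = 4 * lam * mu / (mu - lam) ^+ 2 by field; rewrite gt_eqF.
by rewrite divr_ge0 ?sqr_ge0 // !mulr_ge0 // ltW // (lt_trans lam0).
Qed.

(** The term [j = 0] is [tau]. The others sit at right endpoints, so [ybar_tangent] telescopes them,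
    and [S_le] bounds the result uniformly in [J]. *)
Lemma ybar_series tau J : 0 < tau ->
  \sum_(j < J) tau * ybar (j%:R * tau) ^+ 2 <= tau + (mu - lam)^-1.
Proof.
move=> tau0; have e0 : 0 < mu - lam by rewrite subr_gt0.
case: J => [|J]; first by rewrite big_ord0; apply: addr_ge0; rewrite ?invr_ge0; exact: ltW.
rewrite big_ord_recl /= mul0r ybar0 expr1n mulr1 lerD2l.
have T : 2 * lam * \sum_(i < J) tau * ybar ((bump 0 i)%:R * tau) ^+ 2 <=
    S (J%:R * tau) - S 0 - (mu - lam) * (J%:R * tau).
  elim: J => [|J IH]; first by rewrite big_ord0 !mul0r; lra.
  rewrite big_ord_recr /= mulrDr.
  have J0 : 0 <= J%:R * tau by rewrite mulr_ge0 // ltW.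
  have := ybar_tangent J0 tau0.
  have -> : (bump 0 J)%:R * tau = J%:R * tau + tau by rewrite /bump /= add1n -natr1; ring.
  by lra.
have S0 : S 0 = 1 by rewrite /S /xlim !mulr0 !addr0 divr1 ln1 mul0r oppr0 expR0; ring.
have J0 : 0 <= J%:R * tau by rewrite mulr_ge0 // ltW.
have := S_le J0; rewrite S0 in T => SJ.
rewrite -(ler_pM2l (_ : 0 < 2 * lam)); last by rewrite mulr_gt0.
apply: (le_trans T).
apply: (@le_trans _ _ ((lam + mu) / (mu - lam) - 1)); first by lra.
rewrite le_eqVlt; apply/orP; left; apply/eqP; field.
by rewrite gt_eqF.
Qed.

(** The probability that a cell of length [1 / N] contains no point of either colour. *)
Definition emesh (N : nat) : R := expR (- ((lam + mu) / N%:R)).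
(* The weights of the coloured letters are the exact probabilities; the empty
   letter also receives the probability of the cells with several points, so that
   the weights add up to [1]. *)
Definition wmesh (N : nat) (x : sym) : R := match x with
  | Some true => lam * emesh N / N%:R
  | Some false => mu * emesh N / N%:R
  | None => 1 - lam * emesh N / N%:R - mu * emesh N / N%:R end.
Definition hmesh (N : nat) : R := lam * s * emesh N / N%:R.

Lemma wmesh_sum N : \sum_x wmesh N x = 1.
Proof. by rewrite sum_sym /=; ring. Qed.

Lemma hmesh_sqr N : hmesh N ^+ 2 = wmesh N (Some true) * wmesh N (Some false).
Proof. by rewrite /hmesh /= -lam_sq; ring. Qed.

Lemma emesh_gt0 N : 0 < emesh N. Proof. exact: expR_gt0. Qed.
Lemma emesh_le1 N : emesh N <= 1.
Proof.
rewrite /emesh -expR0 ler_expR oppr_le0 divr_ge0 // addr_ge0 // ltW //.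
exact: lt_trans lammu.
Qed.

Lemma cvg_emesh : emesh k.+1 @[k --> \oo] --> (1 : R).
Proof.
have L : (fun k : nat => - ((lam + mu) * k.+1%:R^-1)) @ \oo --> (0 : R).
  rewrite -[X in _ --> X](_ : - ((lam + mu) * 0) = 0 :> R); last by rewrite mulr0 oppr0.
  by apply: cvgN; apply: cvg_scale; exact: cvg_mesh0.
rewrite -(@expR0 R).
exact: (@continuous_cvg _ _ _ _ _ _ (@expR R) _ (@continuous_expR R 0) L).
Qed.

End Limit.

(** * Convergence of the survival bounds as the cells shrink *)

Section SurvivalLimit.
Variables (R : realType) (lam mu : R).
Hypothesis lam0 : 0 < lam.
Hypothesis lammu : lam < mu.
Let s := sratio lam mu.
Let D := Dbig lam mu.
Let d := Dsmall lam mu.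
Let e (k : nat) : R := emesh lam mu k.+1.
Let delta (k : nat) : R := k.+1%:R^-1.
Let x (t : R) (k : nat) : R := (nmesh t k.+1)%:R / k.+1%:R.
Let wm k := @wmesh R lam mu k.+1.
Let hm k := @hmesh R lam mu k.+1.
Let o k := wm k None.

Let mesh_low k : o k - 2 * hm k = 1 - D * (e k * delta k).
Proof.
rewrite /o /wm /hm /= /hmesh -/s -/(e k) -/(delta k) -(lam_sq lam0 lammu) -/s /D /Dbig -/s.
by ring.
Qed.

Let mesh_high k : o k + 2 * hm k = 1 - d * (e k * delta k).
Proof.
rewrite /o /wm /hm /= /hmesh -/s -/(e k) -/(delta k) -(lam_sq lam0 lammu) -/s /d /Dsmall -/s.
by ring.
Qed.

Let xfacE t k : xfac (wm k) (hm k) (nmesh t k.+1) =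
  expR (- (ln ((1 + D * (x t k * e k)) / (1 + d * (x t k * e k))) / 4
           - 4 * x t k ^+ 2 * (lam * s * e k) ^+ 3 * delta k)).
Proof.
rewrite /xfac -/(o k) mesh_low mesh_high /x -/(delta k).
have -> : 4 * ((nmesh t k.+1)%:R * delta k) ^+ 2 * (lam * s * e k) ^+ 3 * delta k =
   (nmesh t k.+1)%:R ^+ 2 * (2 * hm k) ^+ 3 / 2.
  by rewrite /hm /hmesh -/s -/(e k) -/(delta k); field.
have E c : 1 + c * ((nmesh t k.+1)%:R * delta k * e k) = 1 + (nmesh t k.+1)%:R * (1 - (1 - c * (e k * delta k))).
  by ring.
by rewrite !E.
Qed.

Let cvg_e : e k @[k --> \oo] --> (1 : R). Proof. exact: cvg_emesh. Qed.
Let cvg_delta : delta k @[k --> \oo] --> (0 : R). Proof. exact: cvg_mesh0. Qed.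

Section FixedTime.
Variable t : R.
Hypothesis t0 : 0 <= t.

Let cvg_x : x t k @[k --> \oo] --> (t : R). Proof. exact: cvg_nmesh. Qed.

Let cvg_xe : x t k * e k @[k --> \oo] --> (t : R).
Proof. by rewrite -[t in _ --> t]mulr1; apply: cvgM. Qed.

Let cvg_lin c : 1 + c * (x t k * e k) @[k --> \oo] --> (1 + c * t : R).
Proof. by apply: cvgD; [exact: cvg_cst|exact: cvg_scale]. Qed.

Lemma cvg_xfac : xfac (wm k) (hm k) (nmesh t k.+1) @[k --> \oo] --> (xlim lam mu t : R).
Proof.
under eq_fun do rewrite xfacE.
have hD := lin_gt0 (D_gt0 lam0 lammu) t0.
have hd := lin_gt0 (d_gt0 lam0 lammu) t0.
have L0 : (fun k => (1 + D * (x t k * e k)) / (1 + d * (x t k * e k))) @ \oo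
    --> ((1 + D * t) / (1 + d * t) : R).
  apply: cvgM; first exact: cvg_lin.
  by apply: cvgV; [rewrite gt_eqF|exact: cvg_lin].
have L1 := @continuous_cvg _ _ _ _ _ _ (@ln R) _ (continuous_ln (divr_gt0 hD hd)) L0.
have L : lam * s * e k @[k --> \oo] --> (lam * s * 1 : R) by exact: cvg_scale.
have L3 : (lam * s * e k) ^+ 3 @[k --> \oo] --> ((lam * s * 1) ^+ 3 : R).
  exact: (cvgM L (cvgM L L)).
have L2 : 4 * x t k ^+ 2 * (lam * s * e k) ^+ 3 * delta k @[k --> \oo] --> (0 : R).
  rewrite -[X in _ --> X](mulr0 (4 * t ^+ 2 * (lam * s * 1) ^+ 3)).
  apply: cvgM => //; apply: cvgM => //; apply: cvg_scale.
  exact: (cvgM cvg_x cvg_x).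
have L4 : (fun k => - (ln ((1 + D * (x t k * e k)) / (1 + d * (x t k * e k))) / 4
           - 4 * x t k ^+ 2 * (lam * s * e k) ^+ 3 * delta k)) @ \oo -->
    - (ln ((1 + D * t) / (1 + d * t)) / 4).
  apply: cvgN; rewrite -[X in _ --> X]subr0; apply: cvgB => //.
  by apply: cvgM; [exact: L1|exact: cvg_cst].
exact: (@continuous_cvg _ _ _ _ _ _ (@expR R) _ (@continuous_expR R _) L4).
Qed.

Let nh2 k := (nmesh t k.+1)%:R * hm k ^+ 2.

Let cvg_nh2 : nh2 k @[k --> \oo] --> (0 : R).
Proof.
rewrite (_ : nh2 = fun k => x t k * (lam * s * e k) ^+ 2 * delta k); last first.
  by apply/funext => k; rewrite /nh2 /hm /hmesh /x -/s -/(e k) -/(delta k); ring.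
rewrite -[X in _ --> X](mulr0 (t * (lam * s * 1) ^+ 2)).
apply: cvgM => //; apply: cvgM => //.
have L : lam * s * e k @[k --> \oo] --> (lam * s * 1 : R) by exact: cvg_scale.
exact: (cvgM L L).
Qed.

Lemma cvg_yb : ((1 + s) * xfac (wm k) (hm k) (nmesh t k.+1) -
   (s - 1) * ((1 - nh2 k) / xfac (wm k) (hm k) (nmesh t k.+1))) / 2 @[k --> \oo] --> (ybar lam mu t : R).
Proof.
apply: cvgM; last exact: cvg_cst.
apply: cvgB; first by apply: cvg_scale; exact: cvg_xfac.
apply: cvg_scale; rewrite -[X in _ --> X]mul1r; apply: cvgM.
  by rewrite -[X in _ --> X]subr0; apply: cvgB; [exact: cvg_cst|].
by apply: cvgV; [rewrite gt_eqF // xlim_gt0|exact: cvg_xfac].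
Qed.

(** The depth is fixed before the mesh: the truncation error is at most [2 (1/2)^(2r) expR (2 mu t)]
    on every fine mesh, and takes half of [eta]. The other half covers the convergence of the closed
    form to [ybar]. *)
Lemma survival_limit (eta : R) : 0 < eta -> exists r, \forall k \near \oo,
  forall K, (r.*2 * nmesh t k.+1 <= K)%N ->
  survival (wm k) r.*2 (Some true) (nmesh t k.+1) K <= ybar lam mu t + eta.
Proof.
move=> eta0.
have mu0 := lt_trans lam0 lammu.
have [r hr] : exists r, 2 * (1 / 2) ^+ r.*2 * expR (2 * (mu * t)) <= eta / 2.
  have : (fun r : nat => (1 / 2 : R) ^+ r) @ \oo --> (0 : R).
    by apply: cvg_expr; rewrite ger0_norm; lra.
  move/cvgrPdist_le => /(_ (eta / 2 / (2 * expR (2 * (mu * t))))) [].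
    by rewrite !divr_gt0 // mulr_gt0 // expR_gt0.
  move=> r _ /(_ r.*2) /=; rewrite -addnn leq_addl => /(_ isT).
  rewrite sub0r normrN ger0_norm ?exprn_ge0 // ler_pdivlMr ?mulr_gt0 ?expR_gt0 // => H.
  by exists r; rewrite -addnn; apply: le_trans H; rewrite le_eqVlt; apply/orP; left; apply/eqP; ring.
exists r.
have s1 := sratio_gt1 lam0 lammu.
have s0 : 0 < s by exact: lt_trans s1.
have E2 : 0 < eta / 2 by rewrite divr_gt0.
have cY := cvg_yb.
move/cvgrPdist_le : (cY) => /(_ _ E2) near1.
move/cvgrPdist_le : cvg_nh2 => /(_ 1 ltr01) near2.
have near3 : \forall k \near \oo, D * (e k * delta k) <= 1.
  have : D * (e k * delta k) @[k --> \oo] --> (0 : R).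
    rewrite -[X in _ --> X](mulr0 D); apply: cvg_scale.
    by rewrite -[X in _ --> X](mul1r 0); apply: cvgM.
  move/cvgrPdist_le => /(_ 1 ltr01); apply: filterS => k.
  by rewrite sub0r normrN; exact/le_trans/ler_norm.
near=> k => K hK.
have n1 : `|ybar lam mu t - ((1 + s) * xfac (wm k) (hm k) (nmesh t k.+1) -
   (s - 1) * ((1 - nh2 k) / xfac (wm k) (hm k) (nmesh t k.+1))) / 2| <= eta / 2 by near: k.
have n2 : `|0 - nh2 k| <= 1 by near: k.
have n3 : D * (e k * delta k) <= 1 by near: k.
have e0 : 0 < e k by exact: emesh_gt0.
have dl0 : 0 < delta k by rewrite invr_gt0 ltr0n.
have ed0 : 0 <= e k * delta k by rewrite mulr_ge0 // ltW.
have h0 : 0 < hm k.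
  by rewrite /hm /hmesh -/(e k) -/(delta k) !mulr_gt0 //; apply: lt_trans s1.
have vh1 : o k + 2 * hm k <= 1.
  by rewrite mesh_high lerBlDr lerDl mulr_ge0 // ltW // d_gt0.
have vh0 : 0 <= o k - 2 * hm k by rewrite mesh_low subr_ge0.
have p0 : 0 <= lam * e k / k.+1%:R by rewrite divr_ge0 // mulr_ge0 // ltW.
have q0 : 0 <= mu * e k / k.+1%:R by rewrite divr_ge0 // mulr_ge0 // ltW.
have v0 y : 0 <= wm k y.
  by case: y => [[]|] //; move: vh0; rewrite -/(o k); lra.
have v1 : \sum_y wm k y = 1 by exact: wmesh_sum.
have hE : hm k ^+ 2 = wm k (Some true) * wm k (Some false) by exact: hmesh_sqr.
have := @survival_bnd R (wm k) (hm k) v0 v1 h0 hE r.*2 (Some true) (nmesh t k.+1) K.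
rewrite odd_double => /(_ ltac:(by []) hK) H; apply: (le_trans H).
have qE : wm k (Some false) = hm k * s.
  by rewrite /wm /hm /hmesh /= -{1}(lam_sq lam0 lammu) -/s; ring.
have pE : wm k (Some true) = hm k / s.
  by rewrite /wm /hm /hmesh /= -/s; field; rewrite ?gt_eqF ?ltr0n.
have qc : 0 <= wm k (Some false) <= wm k (Some false) by rewrite v0 lexx.
have pc : 0 <= wm k (Some true) <= wm k (Some false).
  rewrite v0 /= /wm /= -!mulrA; apply: ler_wpM2r; last exact: ltW.
  exact: ed0.
have := bnd_ysol v0 h0 r.*2 (nmesh t k.+1) qc pc.
have G := growth_le v0 h0 vh1 (nmesh t k.+1) (v0 (Some false)).
have nle : (nmesh t k.+1)%:R * wm k (Some false) <= mu * t.
  rewrite /wm /= -/(e k) [leLHS](_ : _ = mu * (e k * ((nmesh t k.+1)%:R / k.+1%:R))); last by ring.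
  apply: ler_wpM2l; first exact: ltW.
  rewrite -[leRHS]mul1r; apply: ler_pM.
  - exact: ltW.
  - by rewrite divr_ge0.
  - exact: emesh_le1.
  - by rewrite ler_pdivrMr ?ltr0n // nmesh_le.
have GG : growth (wm k) (hm k) (wm k (Some false)) (nmesh t k.+1) <= expR (2 * (mu * t)).
  by apply: (le_trans G); rewrite ler_expR ler_wpM2l.
have q2 : 0 <= 2 * (1 / 2 : R) ^+ r.*2 by rewrite mulr_ge0 // exprn_ge0 // divr_ge0.
have {}GG := ler_wpM2l q2 GG.
have n2' : nh2 k <= 1.
  by apply: le_trans n2; rewrite sub0r normrN ler_norm.
have := ysol_le v0 h0 vh1 vh0 (ltW s1) n2'.
rewrite -qE -pE -/(nh2 k) => Y1 B.
have {}B := le_trans (ler_norm _) B.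
move: n1; rewrite ler_norml => /andP[n1 _].
rewrite -/s in Y1; rewrite [flip _]/=; lra.
Unshelve. all: by end_near. Qed.

End FixedTime.
End SurvivalLimit.

(** * From the point processes to words *)

Section IndexMatching.
Variables (col : nat -> sym) (K n : nat) (pm : nat -> option nat).
Hypothesis pm_ok : forall x y, pm x = Some y ->
  [/\ (x < K)%N, (y < K)%N, col x <> None, col y = flip (col x) & pm y = Some x].
Let V x := (n.+2 <= x)%N /\ (x + n.+2 < K)%N.
Hypothesis pm_stable : forall x y, V x -> V y -> (gap x y <= n)%N ->
  col x <> None -> col y = flip (col x) -> pm x <> Some y ->
  (exists2 k, pm x = Some k & (gap x k < gap x y)%N) \/
  (exists2 k, pm y = Some k & (gap y k < gap x y)%N).

(** Each round advances by less than [2 * n.+2] cells; three further blocks of [n.+2] keep the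
    current segment and the partners of its letters where stability is known. *)
Lemma index_avoid r i : (2 * n.+2 <= i)%N -> (i + r.*2.+3 * n.+2 < K)%N ->
  col i <> None -> (forall k, pm i = Some k -> (n < gap i k)%N) ->
  avoid r.*2 n (shift i col).
Proof.
move=> hi hK ci ui.
have dp j k : (2 * n.+2 <= j)%N -> (k - j <= n)%N -> (k + 2 * n.+2 < K)%N -> deep pm V j k.
  move=> hj kn hk; split=> [z hz|x y hx /pm_ok[_ _ _ _ _]]; rewrite /V; first lia.
  by rewrite /gap; lia.
apply: (@unmatched_avoid col pm V n _ pm_stable
  (fun r i l => [/\ (l <= n)%N, (2 * n.+2 <= i)%N & (i + r.*2.+3 * n.+2 < K)%N])) => //.
- by move=> x y /pm_ok[].
- move=> r' i' l m [ln hi' hK'] hm; split; first lia.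
  by apply: dp; [lia|lia|nia].
- move=> r' i' l m k [ln hi' hK'] hm _ _ hk1 hk2; split; first by apply: dp; [lia|lia|nia].
  by split; [lia|lia|nia].
Qed.

End IndexMatching.

(** Half-open cells tile the line. Cell [N0] starts at the real [0], so that points on its left also
    get natural indices. *)
Definition cell {R : realType} (N N0 i : nat) : set R :=
  `[(i%:R - N0%:R) / N%:R, (i%:R + 1 - N0%:R) / N%:R[%classic.

(** A configuration with two points in one of the cells reads no word. *)
Definition reads {R : realType} (B Rd : set R) (N N0 K : nat) (w : seq sym) : Prop :=
  forall i : 'I_K, ncount (B `&` cell N N0 i) (nth None w i == Some true) /\
                   ncount (Rd `&` cell N N0 i) (nth None w i == Some false).

(* Cells whose gaps differ by at most one may hide either order of the distances. *)
Definition spread (w : seq sym) : Prop := forall x d e,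
  (0 < d)%N -> (0 < e)%N -> nth None w x <> None -> nth None w (x + d) <> None ->
  nth None w (x + d + e) <> None -> (1 < gap d e)%N.

(** Passing to cells may distort a comparison of distances by less than [2]. For [y] and [z] on
    opposite sides of [x], [spread] excludes such close gaps; on the same side the order of the
    cells decides. *)
Lemma closer_spread w x y z : spread w ->
  nth None w x <> None -> nth None w y <> None -> nth None w z <> None ->
  x <> y -> y <> z -> x <> z -> (gap x z < gap x y + 2)%N ->
  ((x < y)%N -> (x < z)%N -> (z <= y)%N) -> ((y < x)%N -> (z < x)%N -> (y <= z)%N) ->
  (gap x z < gap x y)%N.
Proof.
move=> sp cx cy cz xy yz xz g lr rl.
have [xy'|xy'] := ltnP x y; have [xz'|xz'] := ltnP x z.
- by have := lr xy' xz'; rewrite /gap; lia.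
- have zx : (z < x)%N by lia.
  have := sp z (x - z)%N (y - x)%N; rewrite !subn_gt0 (subnKC xz') (subnKC (ltnW xy')).
  by move=> /(_ zx xy' cz cx cy); move: g; rewrite /gap; lia.
- have yx : (y < x)%N by lia.
  have := sp y (x - y)%N (z - x)%N; rewrite !subn_gt0 (subnKC xy') (subnKC (ltnW xz')).
  by move=> /(_ yx xz' cy cx cz); move: g; rewrite /gap; lia.
- have yx : (y < x)%N by lia. have zx : (z < x)%N by lia.
  by have := rl yx zx; rewrite /gap; lia.
Qed.

Section RealMatching.
Variables (R : realType) (B Rd : set R) (M : R -> option R) (N N0 K : nat) (w : seq sym).
Hypothesis N_gt0 : (0 < N)%N.
Hypothesis stM : is_stable_matching B Rd M.
Hypothesis sw : size w = K.
Hypothesis rw : reads B Rd N N0 K w.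
Hypothesis spw : spread w.

Let cl i : set R := cell N N0 i.
Let col := nth None w.
Let u (x : R) : R := x * N%:R + N0%:R.
Let N0' : (0 : R) < N%:R. Proof. by rewrite ltr0n. Qed.

Lemma cellP i x : cl i x <-> i%:R <= u x < i%:R + 1.
Proof.
rewrite /cl /cell /= in_itv /= ler_pdivrMr // ltr_pdivlMr // /u.
by split=> /andP[a b]; apply/andP; split; lra.
Qed.

Lemma cell_of x : 0 <= u x -> u x < K%:R -> exists2 i, (i < K)%N & cl i x.
Proof.
move=> u0 uK; have /andP[a b] := truncn_itv u0.
exists (Num.truncn (u x)); first by rewrite -(ltr_nat R); exact: le_lt_trans uK.
by apply/cellP; rewrite a /= natr1.
Qed.

Lemma ncount0 (S : set R) : ncount S 0 -> S = set0.
Proof. by move=> [s [_ [-> /size0nil ->]]]; apply/seteqP; split. Qed.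

Lemma ncount1 (S : set R) : ncount S 1 -> exists x, S = [set x].
Proof.
move=> [[|x [|y s]] [_ [-> //]]] _; exists x; apply/seteqP; split=> y /=.
  by rewrite inE => /eqP.
by move=> ->; rewrite inE.
Qed.

Let pt i : R := xget 0 ((B `|` Rd) `&` cl i).

Let ptB i : (i < K)%N -> col i = Some true -> B `&` cl i = [set pt i] /\ Rd `&` cl i = set0.
Proof.
move=> iK ci; have [/= + +] := rw (Ordinal iK).
rewrite -/(col i) ci eqxx /= => /ncount1[x xE] /ncount0 E; split=> //.
rewrite xE; congr [set _]; apply/esym/xget_unique.
  have [Bx cx] : (B `&` cl i) x by rewrite xE.
  by split; [left|].
move=> y [[By|Ry] cy].
  by have : (B `&` cl i) y by []; rewrite xE.
by have : (Rd `&` cl i) y by []; rewrite E.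
Qed.

Let ptR i : (i < K)%N -> col i = Some false -> Rd `&` cl i = [set pt i] /\ B `&` cl i = set0.
Proof.
move=> iK ci; have [/= + +] := rw (Ordinal iK).
rewrite -/(col i) ci eqxx /= => /ncount0 E /ncount1[x xE]; split=> //.
rewrite xE; congr [set _]; apply/esym/xget_unique.
  have [Rx cx] : (Rd `&` cl i) x by rewrite xE.
  by split; [right|].
move=> y [[By|Ry] cy].
  by have : (B `&` cl i) y by []; rewrite E.
by have : (Rd `&` cl i) y by []; rewrite xE.
Qed.

Let pt0 i : (i < K)%N -> col i = None -> B `&` cl i = set0 /\ Rd `&` cl i = set0.
Proof.
by move=> iK ci; have [/= + +] := rw (Ordinal iK); rewrite -/(col i) ci => /ncount0-> /ncount0.
Qed.

Lemma cell_blue i x : (i < K)%N -> cl i x -> B x -> col i = Some true /\ pt i = x.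
Proof.
move=> iK cx Bx; have h : (B `&` cl i) x by [].
case E : (col i) => [[]|].
- by have [E1 _] := ptB iK E; rewrite E1 in h.
- by have [_ E1] := ptR iK E; rewrite E1 in h.
- by have [E1 _] := pt0 iK E; rewrite E1 in h.
Qed.

Lemma cell_red i x : (i < K)%N -> cl i x -> Rd x -> col i = Some false /\ pt i = x.
Proof.
move=> iK cx Rx; have h : (Rd `&` cl i) x by [].
case E : (col i) => [[]|].
- by have [_ E1] := ptB iK E; rewrite E1 in h.
- by have [E1 _] := ptR iK E; rewrite E1 in h.
- by have [_ E1] := pt0 iK E; rewrite E1 in h.
Qed.

Lemma col_lt i : col i <> None -> (i < K)%N.
Proof. by move=> h; rewrite ltnNge; apply/negP => hK; apply: h; rewrite /col nth_default ?sw. Qed.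

Lemma pt_blue i : col i = Some true -> B (pt i) /\ cl i (pt i).
Proof.
move=> ci; have iK : (i < K)%N by apply: col_lt; rewrite ci.
by have [E _] := ptB iK ci; have : (B `&` cl i) (pt i) by rewrite E.
Qed.

Lemma pt_red i : col i = Some false -> Rd (pt i) /\ cl i (pt i).
Proof.
move=> ci; have iK : (i < K)%N by apply: col_lt; rewrite ci.
by have [E _] := ptR iK ci; have : (Rd `&` cl i) (pt i) by rewrite E.
Qed.

Lemma pt_cell i : col i <> None -> i%:R <= u (pt i) < i%:R + 1.
Proof.
move=> ci; apply/cellP.
by case E : (col i) ci => [[]|] // _; [have [] := pt_blue E|have [] := pt_red E].
Qed.

Lemma pt_inj i j : col i <> None -> col j <> None -> pt i = pt j -> i = j.
Proof.
move=> /pt_cell /andP[a b] /pt_cell /andP[c d] e; rewrite e in a b.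
have : (i%:R : R) < j%:R + 1 by apply: le_lt_trans d.
have : (j%:R : R) < i%:R + 1 by apply: le_lt_trans b.
by rewrite !natr1 !ltr_nat; lia.
Qed.

(** The matching [M] carried over to indices; partners outside the [K] cells are dropped. *)
Let pm (x : nat) : option nat :=
  if [pick y : 'I_K | `[< [/\ col x <> None, col y <> None & M (pt x) = Some (pt y)] >]]
  is Some y then Some (val y) else None.

Lemma pmE x y : pm x = Some y ->
  [/\ (y < K)%N, col x <> None, col y <> None & M (pt x) = Some (pt y)].
Proof. by rewrite /pm; case: pickP => // z /asboolP[a b d] [<-]; split. Qed.

Lemma pmI x y : col x <> None -> col y <> None -> M (pt x) = Some (pt y) -> pm x = Some y.
Proof.
move=> cx cy e; rewrite /pm; case: pickP => [z /asboolP[_ cz e']|/(_ (Ordinal (col_lt cy)))].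
  by congr Some; apply: pt_inj => //; move: e'; rewrite e => -[].
by move/negP; case; apply/asboolP.
Qed.

Lemma match_color x y : col x <> None -> M (pt x) = Some y ->
  if col x is Some true then Rd y else B y.
Proof.
have [[h1 [h2 _]] _] := stM.
by case E : (col x) => [[]|] // _ e; [apply: h1 e; have [] := pt_blue E|apply: h2 e; have [] := pt_red E].
Qed.

Lemma pm_ok x y : pm x = Some y ->
  [/\ (x < K)%N, (y < K)%N, col x <> None, col y = flip (col x) & pm y = Some x].
Proof.
move=> /pmE[yK cx cy e]; have [[h1 [h2 h3]] _] := stM.
have cyE : col y = flip (col x).
  have := match_color cx e; case E : (col x) cx => [[]|] // _ h.
    have cl' : cl y (pt y) by apply/cellP; exact: pt_cell.
    by have [] := cell_red yK cl' h.
  have cl' : cl y (pt y) by apply/cellP; exact: pt_cell.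
  by have [] := cell_blue yK cl' h.
split=> //; first exact: col_lt.
apply: pmI => //; case E : (col x) cx cyE => [[]|] // _ cyE.
  by apply/h3 => //; [have [] := pt_blue E|have [] := pt_red cyE].
have [Bb _] := pt_blue cyE; have [Rr _] := pt_red E.
exact: (h3 _ _ Bb Rr).1.
Qed.

Lemma gap_u x y : col x <> None -> col y <> None ->
  (gap x y)%:R - 1 < `|u (pt x) - u (pt y)| < (gap x y)%:R + 1.
Proof.
move=> /pt_cell /andP[a b] /pt_cell /andP[c d].
have [h|h] := leqP x y.
- have -> : (gap x y)%:R = y%:R - x%:R :> R by rewrite /gap -natrB //; congr _%:R; lia.
  have : (x%:R : R) <= y%:R by rewrite ler_nat.
  by rewrite ltr_norml => hh; apply/andP; split; [rewrite lter_normr; apply/orP; right|]; lra.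
- have -> : (gap x y)%:R = x%:R - y%:R :> R by rewrite /gap -natrB 1?ltnW //; congr _%:R; lia.
  have : (y%:R : R) <= x%:R by rewrite ler_nat ltnW.
  by rewrite ltr_norml => hh; apply/andP; split; [rewrite lter_normr; apply/orP; left|]; lra.
Qed.

Lemma u_dist x y : `|u x - u y| = `|x - y| * N%:R.
Proof. by rewrite /u -[X in _ = _ * X]ger0_norm // -normrM; congr `|_|; ring. Qed.

Lemma closer_index x y z : col x <> None -> col y <> None -> col z <> None ->
  x <> y -> y <> z -> x <> z -> `|pt x - pt z| <= `|pt x - pt y| -> (gap x z < gap x y)%N.
Proof.
move=> cx cy cz xy yz xz; rewrite -(ler_pM2r N0') -!u_dist => le.
have /andP[_ g1] := gap_u cx cy; have /andP[g2 _] := gap_u cx cz.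
have g : (gap x z < gap x y + 2)%N.
  by rewrite -(ltr_nat R) natrD; lra.
have /andP[ax bx] := pt_cell cx; have /andP[ay b_y] := pt_cell cy; have /andP[az bz] := pt_cell cz.
have lt_nat i j : (i < j)%N -> (i%:R + 1 : R) <= j%:R by rewrite natr1 ler_nat.
apply: (closer_spread spw) => //.
- move=> /lt_nat l1 /lt_nat l2; rewrite leqNgt; apply/negP => /lt_nat l3.
  by move: le; rewrite !ler0_norm; lra.
- move=> /lt_nat l1 /lt_nat l2; rewrite leqNgt; apply/negP => /lt_nat l3.
  by move: le; rewrite !ger0_norm; lra.
Qed.

(** Stability of [M] gives one of the two points a partner no farther than the other point. The
    margin [n.+2] keeps that partner within the cells, and [closer_index] turns the weak inequality
    between reals into a strict one between indices. *)
Lemma pm_stable n x y :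
  (n.+2 <= x)%N /\ (x + n.+2 < K)%N -> (n.+2 <= y)%N /\ (y + n.+2 < K)%N ->
  (gap x y <= n)%N -> col x <> None -> col y = flip (col x) -> pm x <> Some y ->
  (exists2 k, pm x = Some k & (gap x k < gap x y)%N) \/
  (exists2 k, pm y = Some k & (gap y k < gap x y)%N).
Proof.
have closest a b z : (n.+2 <= a)%N /\ (a + n.+2 < K)%N -> (gap a b <= n)%N ->
    col a <> None -> col b <> None -> col b <> col a -> pm a <> Some b -> M (pt a) = Some z ->
    `|pt a - z| <= `|pt a - pt b| -> exists2 k, pm a = Some k & (gap a k < gap a b)%N.
  move=> [a1 a2] gab ca cb cab pab Ma le.
  have /andP[_ gu] := gap_u ca cb.
  have le' : `|u (pt a) - u z| < n%:R + 1.
    rewrite u_dist; apply: (@lt_le_trans _ _ ((gap a b)%:R + 1)); last by rewrite lerD2r ler_nat.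
    by apply: le_lt_trans gu; rewrite u_dist ler_pM2r.
  have /andP[pa pa'] := pt_cell ca.
  move: le'; rewrite ltr_norml => /andP[l1 l2].
  have b1 : (n%:R + 2 : R) <= a%:R by rewrite -natrD ler_nat; lia.
  have b2 : (a%:R + (n%:R + 2) : R) < K%:R by rewrite -!natrD ltr_nat; lia.
  have [||k kK ck] := @cell_of z; [lra|lra|].
  have := match_color ca Ma => hz.
  have [ck0 pk] : col k <> None /\ pt k = z.
    case E : (col a) ca hz => [[]|] // _ hz.
      by have [-> ->] := cell_red kK ck hz.
    by have [-> ->] := cell_blue kK ck hz.
  have pak : pm a = Some k by apply: pmI => //; rewrite pk.
  exists k => //.
  have [_ _ _ ckE _] := pm_ok pak.
  apply: closer_index => //; rewrite ?pk //.
  - by move=> e; apply: cab; rewrite e.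
  - by move=> e; apply: pab; rewrite e.
  - by move=> e; move: ckE; rewrite -e => /esym; exact: flip_neq.
move=> Vx Vy gxy cx cy pxy.
have cy0 : col y <> None by rewrite cy; exact: flip_None.
have cyx : col y <> col x by rewrite cy; exact: flip_neq.
have gC : gap x y = gap y x by rewrite /gap addnC.
have pyx : pm y <> Some x by move=> /pm_ok[].
have nM : M (pt x) <> Some (pt y) by move=> /(pmI cx cy0).
have nM' : M (pt y) <> Some (pt x) by move=> /(pmI cy0 cx).
have key : (match_dist M (pt x) <= (`|pt x - pt y|)%:E)%E \/
           (match_dist M (pt y) <= (`|pt x - pt y|)%:E)%E.
  have [_ st] := stM.
  case E : (col x) cx cy => [[]|] // _ cy.
  - have [Bx _] := pt_blue E; have [Ry _] := pt_red cy.
    have := st _ _ Bx Ry nM'; rewrite lt_min distrC => /negP; rewrite negb_and -!leNgt.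
    by case/orP; [right|left].
  - have [Rx _] := pt_red E; have [By _] := pt_blue cy.
    have := st _ _ By Rx nM; rewrite lt_min => /negP; rewrite negb_and -!leNgt.
    by case/orP; [left|right].
case: key; rewrite /match_dist.
- case E : (M (pt x)) => [z|] //; rewrite lee_fin => le.
  by left; exact: (closest x y z Vx gxy cx cy0 cyx pxy E le).
- case E : (M (pt y)) => [z|] //; rewrite lee_fin (distrC (pt x)) => le.
  have gyx : (gap y x <= n)%N by rewrite -gC.
  have cxy : col x <> col y by move=> e; apply: cyx.
  by right; rewrite gC; exact: (closest y x z Vy gyx cy0 cx cxy pyx E le).
Qed.

Variables (t : R) (n : nat).
Hypothesis nt : n = 0%N \/ (n.+1%:R <= t * N%:R :> R).

(** Points in cells [g] apart are less than [g + 1] cells apart, hence [n.+1] in [nt]. For [n = 0]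
    it suffices that partners occupy different cells. *)
Lemma far_unmatched i : col i = Some true -> (t%:E < match_dist M (pt i))%E ->
  forall k, pm i = Some k -> (n < gap i k)%N.
Proof.
move=> ci far k pk; have [iK kK ci0 ck _] := pm_ok pk; have [_ _ ck0 e] := pmE pk.
case: nt => [->|nt'].
  have : i <> k by move=> ik; move: ck; rewrite -ik => /esym; exact: flip_neq.
  by rewrite /gap; lia.
move: far; rewrite /match_dist e lte_fin -(ltr_pM2r N0') -u_dist => far.
have /andP[_ g] := gap_u ci0 ck0.
have : (n.+1%:R : R) < (gap i k)%:R + 1 by apply: (le_lt_trans nt'); exact: lt_trans g.
by rewrite natr1 ltr_nat ltnS.
Qed.

Lemma real_avoid r b : B b -> (t%:E < match_dist M b)%E ->
  forall i, (r.*2.+4 * n.+2 <= i)%N -> (i + r.*2.+4 * n.+2 < K)%N -> cl i b ->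
  [/\ col i = Some true, avoid r.*2 n (shift i col) &
      avoid r.*2 n (shift (K - i.+1) (nth None (rev w)))].
Proof.
move=> Bb far i hi hK cib; have iK : (i < K)%N by lia.
have [ci pb] := cell_blue iK cib Bb; rewrite -pb in far.
have ui := far_unmatched ci far.
have ci0 : col i <> None by rewrite ci.
split=> //.
- apply: (@index_avoid col K n pm pm_ok (@pm_stable n)) => //; nia.
(* The left side of [i] is the right side of its mirror image, so the index matching is reflected by
   [x] to [K - x.+1]. *)
- set col' := nth None (rev w).
  have colE x : (x < K)%N -> col' x = col (K - x.+1)%N.
    by move=> xK; rewrite /col' nth_rev ?sw.
  have colN x : (K <= x)%N -> col' x = None by move=> xK; rewrite /col' nth_default // size_rev sw.
  pose pm' x := if (x < K)%N then omap (fun y => (K - y.+1)%N) (pm (K - x.+1)%N) else None.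
  have pm'E x y : pm' x = Some y -> [/\ (x < K)%N, (y < K)%N & pm (K - x.+1)%N = Some (K - y.+1)%N].
    rewrite /pm'; case: ifP => // xK; case E : (pm _) => [z|] //= [<-].
    have [_ zK _ _ _] := pm_ok E; split=> //; first lia.
    by congr Some; lia.
  have pm'I x y : (x < K)%N -> (y < K)%N -> pm (K - x.+1)%N = Some (K - y.+1)%N -> pm' x = Some y.
    by move=> xK yK e; rewrite /pm' xK e /=; congr Some; lia.
  apply: (@index_avoid col' K n pm') => //.
  + move=> x y /pm'E[xK yK e]; have [_ _ cx cy e'] := pm_ok e.
    rewrite !colE //; split=> //.
    exact: pm'I.
  + move=> x y [x1 x2] [y1 y2] gxy.
    have xK : (x < K)%N by lia. have yK : (y < K)%N by lia.
    rewrite !colE // => cx cy npm.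
    have gE z z' : (z < K)%N -> (z' < K)%N -> gap (K - z.+1) (K - z'.+1) = gap z z'.
      by rewrite /gap; lia.
    have [||||[k pk gk]|[k pk gk]] := @pm_stable n (K - x.+1)%N (K - y.+1)%N _ _ _ cx cy.
    * lia.
    * lia.
    * by rewrite gE.
    * by move=> e; apply: npm; exact: pm'I.
    * have [_ kK _ _ _] := pm_ok pk; left; exists (K - k.+1)%N.
        by apply: pm'I => //; [lia|rewrite pk; congr Some; lia].
      by move: gk; rewrite /gap; lia.
    * have [_ kK _ _ _] := pm_ok pk; right; exists (K - k.+1)%N.
        by apply: pm'I => //; [lia|rewrite pk; congr Some; lia].
      by move: gk; rewrite /gap; lia.
  + nia.
  + nia.
  + rewrite colE; last lia.
    by have -> : (K - (K - i.+1).+1 = i)%N by lia.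
  + move=> k /pm'E[_ kK]; have -> : (K - (K - i.+1).+1 = i)%N by lia.
    by move=> /ui; rewrite /gap; lia.
Qed.

End RealMatching.

(** * Law of the word read from the two point processes *)

Lemma ex_tuple (R : realFieldType) (v : sym -> R) K f :
  ex v K f = \sum_(w : K.-tuple sym) (\prod_(i < K) v (tnth w i)) * f w.
Proof.
elim: K f => [|K IH] f.
  rewrite (bigD1 [tuple]) //= big_ord0 mul1r big1 ?addr0 // => w.
  by move=> /eqP h; case: h; exact: tuple0.
rewrite /=; under eq_bigr do rewrite IH mulr_sumr.
rewrite pair_bigA /=.
rewrite (reindex (fun p : sym * K.-tuple sym => cons_tuple p.1 p.2)) /=; last first.
  exists (fun w => (thead w, behead_tuple w)) => [[s w] _|w _] /=.
    by rewrite theadE; congr pair; apply: val_inj.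
  by case/tupleP: w => s w; apply: val_inj => /=; rewrite theadE.
apply: eq_bigr => -[s w] _ /=; rewrite big_ord_recl /= mulrA; congr (_ * _ * _).
by apply: eq_bigr => i _; rewrite !(tnth_nth None).
Qed.

Lemma not_spread_mass (R : realFieldType) (v : sym -> R) K c :
  (forall s, 0 <= v s) -> \sum_s v s <= 1 -> v (Some true) + v (Some false) <= c ->
  ex v K (fun w => ind R (~ spread w)) <= 3 * K%:R ^+ 2 * c ^+ 3.
Proof.
move=> v0 v1 vc.
have c0 : 0 <= c by apply: le_trans vc; rewrite addr_ge0.
(* A second gap [e] within one of [d] is coded as [d + z - 1] with [z] in ['I_3], so the union bound
   has [3 K^2] terms. *)
pose Q (w : seq sym) (p : 'I_K * 'I_K * 'I_3) := (0 < p.1.2)%N /\ (0 < p.1.2 + p.2 - 1)%N /\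
  [/\ nth None w p.1.1 <> None, nth None w (p.1.1 + p.1.2) <> None &
      nth None w (p.1.1 + p.1.2 + (p.1.2 + p.2 - 1)) <> None]%N.
apply: (@le_trans _ _ (ex v K (fun w => \sum_p ind R (Q w p)))).
  apply: ex_mono => // w sw; apply: ind_le_big => /existsNP[x /existsNP[d /existsNP[e]]].
  move=> /not_implyP[d0 /not_implyP[e0 /not_implyP[cx /not_implyP[cd /not_implyP[ce]]]]] /negP.
  rewrite -leqNgt => ge.
  have lt z : nth None w z <> None -> (z < K)%N.
    by move=> h; rewrite ltnNge; apply/negP => hK; apply: h; rewrite nth_default ?sw.
  have xK := lt _ cx; have dK : (d < K)%N by have := lt _ cd; lia.
  have zK : (e + 1 - d < 3)%N by move: ge; rewrite /gap; lia.
  exists (Ordinal xK, Ordinal dK, Ordinal zK); rewrite /Q /=.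
  have -> : (d + (e + 1 - d) - 1 = e)%N by move: ge; rewrite /gap; lia.
  by [].
rewrite ex_sum (le_trans (y := \sum_(p : 'I_K * 'I_K * 'I_3) c ^+ 3)) //.
  apply: ler_sum => -[[x d] z] _; rewrite /Q /=.
  have [h|h] := boolP [&& (0 < d)%N, (0 < d + z - 1)%N & (x + d + (d + z - 1) < K)%N]; last first.
    rewrite (_ : ex _ _ _ = 0) ?exprn_ge0 // -[RHS](ex0 v K).
    apply: eq_ex => w sw; rewrite ind0 // => -[a [b [_ _ e]]]; move/negP: h; apply.
    rewrite a b /= ltnNge; apply/negP => hK; apply: e; rewrite nth_default ?sw //.
  move: h => /and3P[a b e].
  apply: (le_trans (y := ex v K (fun w => ind R [/\ nth None w x <> None,
        nth None w (x + d) <> None & nth None w (x + d + (d + z - 1)) <> None]))).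
    by apply: ex_mono => // w _; apply: le_ind => -[_ [_ ?]].
  by apply: ex_nonempty3 => //; lia.
by rewrite sumr_const !card_prod !card_ord -[leLHS]mulr_natl !natrM expr2 le_eqVlt; apply/orP; left; apply/eqP; ring.
Qed.

Section Law.
Variables (R : realType) (d : measure_display) (Omega : measurableType d)
  (P : probability Omega R) (lam mu : R) (B Rd : Omega -> set R).
Hypothesis lam0 : 0 < lam.
Hypothesis lammu : lam < mu.
Hypothesis pp : poisson_pair P lam mu B Rd.

(** The probabilities that a cell reads each letter. Their total is at most [1], the deficit being
    the cells with several points; [wmesh] restores it at the empty letter. *)
Definition wexact (N : nat) (s : sym) : R :=
  if s is Some _ then wmesh lam mu N s else emesh lam mu N.

Let mu0 : 0 < mu. Proof. exact: lt_trans lammu. Qed.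

Lemma wexact_ge0 N s : 0 <= wexact N s.
Proof.
have e0 := ltW (emesh_gt0 lam mu N).
by case: s => [[]|] //=; rewrite divr_ge0 // mulr_ge0 // ltW.
Qed.

Lemma wexact_None N : wexact N None <= wmesh lam mu N None.
Proof.
rewrite /= /emesh; set x := (lam + mu) / N%:R.
have -> : lam * expR (- x) / N%:R = (lam / N%:R) * expR (- x) by rewrite mulrAC.
have -> : mu * expR (- x) / N%:R = (mu / N%:R) * expR (- x) by rewrite mulrAC.
have h : (1 + x) * expR (- x) <= 1.
  rewrite -[leRHS](@expR0 R) -(subrr x) expRD ler_wpM2r ?expR_ge0 //; exact: expR_ge1Dx.
by move: h; rewrite /x mulrDl; lra.
Qed.

Lemma wexact_le N s : wexact N s <= wmesh lam mu N s.
Proof. by case: s => [[]|] //; exact: wexact_None. Qed.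

Lemma wexact_sum N : \sum_s wexact N s <= 1.
Proof. by rewrite -(wmesh_sum lam mu N); apply: ler_sum => s _; exact: wexact_le. Qed.

Lemma cell_bounded N N0 i : bounded_borel (@cell R N N0 i).
Proof.
split; first exact: measurable_itv.
exists ((i%:R - N0%:R) / N%:R), ((i%:R + 1 - N0%:R) / N%:R).
by apply: subset_itvl; rewrite bnd_simp.
Qed.

Lemma cell_measure N N0 i : (0 < N)%N ->
  fine (lebesgue_measure (@cell R N N0 i)) = N%:R^-1.
Proof.
move=> N0'; have n0 : (0 : R) < N%:R by rewrite ltr0n.
rewrite /cell lebesgue_measure_itv /= lte_fin ltr_pM2r ?invr_gt0 // ifT; last by lra.
by rewrite /=; field; rewrite gt_eqF.
Qed.

Lemma cell_disjoint N N0 i j : (0 < N)%N -> i != j ->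
  @cell R N N0 i `&` cell N N0 j = set0.
Proof.
move=> N_gt0 ij; apply/seteqP; split=> // x [/(cellP N0 N_gt0) /andP[a b] /(cellP N0 N_gt0) /andP[c e]].
have : (i%:R : R) < j%:R + 1 by apply: le_lt_trans e.
have : (j%:R : R) < i%:R + 1 by apply: le_lt_trans b.
by rewrite !natr1 !ltr_nat; move/eqP: ij; lia.
Qed.

Definition readset N N0 K (s : seq sym) : set Omega :=
  [set w | reads (B w) (Rd w) N N0 K s].

Lemma readset_measurable N N0 K s : measurable (readset N N0 K s).
Proof.
have [m _] := pp.
have -> : readset N N0 K s = \bigcap_(i in [set: 'I_K])
    ([set w | ncount (B w `&` cell N N0 i) (nth None s i == Some true)] `&`
     [set w | ncount (Rd w `&` cell N N0 i) (nth None s i == Some false)]).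
  by apply/seteqP; split=> w h i; [move=> _; have [] := h i|have [] := h i I].
apply: fin_bigcap_measurable => // i _; apply: measurableI.
  exact: (m _ _ (cell_bounded N N0 i)).1.
exact: (m _ _ (cell_bounded N N0 i)).2.
Qed.

Lemma readset_prob N N0 K s : (0 < N)%N ->
  P (readset N N0 K s) = (\prod_(i < K) wexact N (nth None s i))%:E.
Proof.
move=> N_gt0; have [_ m] := pp.
have := m K (fun i => cell N N0 i) (fun i => nth None s i == Some true)
  (fun i => nth None s i == Some false) (fun i => cell_bounded N N0 i).
move=> /(_ _)/= ->; last by move=> i j ij; apply: cell_disjoint.
congr (_%:E); apply: eq_bigr => i _; rewrite cell_measure // /pois.
have E : expR (- (lam / N%:R)) * expR (- (mu / N%:R)) = emesh lam mu N.
  by rewrite -expRD /emesh; congr expR; ring.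
case: nth => [[]|] /=.
- by rewrite -E /= expr1 expr0 fact0 divr1 mul1r ?invr1 /=; ring.
- by rewrite -E /= expr1 expr0 fact0 !divr1 ?mul1r ?invr1 /=; ring.
- by rewrite -E !expr0 fact0 divr1 !mul1r.
Qed.

Lemma int_words N N0 K (a : seq sym -> R) : (0 < N)%N -> (forall s, 0 <= a s) ->
  (\int[P]_w (\sum_(s : K.-tuple sym) (a s)%:E * (\1_(readset N N0 K s) w)%:E)
   = (ex (wexact N) K a)%:E)%E.
Proof.
move=> N_gt0 a0.
have mI s : measurable_fun setT (fun w => (\1_(readset N N0 K s) w)%:E : \bar R).
  by apply/measurable_EFinP; apply: measurable_indic; exact: readset_measurable.
rewrite ge0_integral_sum //; last 2 first.
- by move=> s; apply: measurable_funeM.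
- by move=> s w _; rewrite mule_ge0 // lee_fin.
rewrite ex_tuple -sumEFin; apply: eq_bigr => s _.
rewrite ge0_integralZl_EFin //.
rewrite integral_indic //; last exact: readset_measurable.
rewrite setIT; transitivity ((a s)%:E * (\prod_(i < K) wexact N (nth None s i))%:E)%E.
  by congr (_ * _)%E; exact: readset_prob.
rewrite -EFinM mulrC; congr (_%:E); congr (_ * _).
by apply: eq_bigr => i _; rewrite (tnth_nth None).
Qed.

Lemma words_measurable N N0 K (a : seq sym -> R) :
  measurable_fun setT (fun w => (\sum_(s : K.-tuple sym) (a s)%:E * (\1_(readset N N0 K s) w)%:E)%E : \bar R).
Proof.
apply: emeasurable_sum => s; apply: measurable_funeM.
by apply/measurable_EFinP; apply: measurable_indic; exact: readset_measurable.
Qed.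

Lemma ncount_inj (S : set R) k l : ncount S k -> ncount S l -> k = l.
Proof.
move=> [s [us [-> <-]]] [s' [us' [e <-]]].
apply/eqP; rewrite eqn_leq !uniq_leq_size // => x hx.
  by have : [set x | x \in s'] x by []; rewrite -e.
by have : [set x | x \in s] x by []; rewrite e.
Qed.

Lemma reads_inj S S' N N0 K (s s' : K.-tuple sym) :
  @reads R S S' N N0 K s -> reads S S' N N0 K s' -> s = s'.
Proof.
move=> h h'; apply: eq_from_tnth => i; rewrite !(tnth_nth None).
have [b r] := h i; have [b' r'] := h' i.
have := ncount_inj b b'; have := ncount_inj r r'.
by case: (nth None s i) => [[]|]; case: (nth None s' i) => [[]|].
Qed.

Definition goodset N N0 K : set Omega :=
  \bigcup_(s in [set s : K.-tuple sym | spread s]) readset N N0 K s.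

Lemma goodset_measurable N N0 K : measurable (goodset N N0 K).
Proof.
apply: fin_bigcup_measurable => [|s _]; first exact: finite_finset.
exact: readset_measurable.
Qed.

(** At most one word is read by a configuration, so the indicator of [goodset] dominates the sum of
    those of the spread words. *)
Lemma goodset_prob N N0 K : (0 < N)%N ->
  (P (~` goodset N N0 K) <= (1 - ex (wexact N) K (fun s => ind R (spread s)))%:E)%E.
Proof.
move=> N_gt0; rewrite probability_setC; last exact: goodset_measurable.
rewrite EFinB; apply: leeB => //.
have -> : P (goodset N N0 K) = (\int[P]_w (\1_(goodset N N0 K) w)%:E)%E.
  by rewrite integral_indic ?setIT //; exact: goodset_measurable.
have a0 s : 0 <= ind R (spread s) by exact: ind_ge0.
rewrite -(int_words N0 K N_gt0 a0).
apply: ge0_le_integral => //.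
- move=> w _; apply: sume_ge0 => s _; rewrite mule_ge0 // lee_fin //; exact: ind_ge0.
- exact: (@words_measurable N N0 K (fun s => ind R (spread s))).
- by apply/measurable_EFinP; apply: measurable_indic; exact: goodset_measurable.
- move=> w _.
  have [[s [sp rs]]|ng] := pselect (exists s : K.-tuple sym, spread s /\ readset N N0 K s w).
    rewrite (bigD1 s) //= big1 ?adde0; last first.
      move=> s' s's; rewrite indicE memNset ?mule0 // => rs'.
      by move/eqP: s's; apply; exact: reads_inj rs' rs.
    rewrite !indicE (mem_set rs) ind1 // mul1e mem_set //.
    by exists s.
  rewrite big1 // => s _; have [sp|nsp] := pselect (spread s); last by rewrite ind0 // mul0e.
  by rewrite indicE memNset ?mule0 // => rs; apply: ng; exists s.
Qed.

(** The first term pays for cells with several points, as one cell reads a letter with probability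
    [(1 + x) e^(-x) >= 1 - x^2]; the second pays for near ties. *)
Lemma spread_mass N K : (0 < N)%N ->
  1 - ex (wexact N) K (fun s => ind R (spread s)) <=
  K%:R * ((lam + mu) / N%:R) ^+ 2 + 3 * K%:R ^+ 2 * ((lam + mu) / N%:R) ^+ 3.
Proof.
move=> N_gt0; set x := (lam + mu) / N%:R.
have n0 : (0 : R) < N%:R by rewrite ltr0n.
have x0 : 0 <= x by rewrite divr_ge0 // ?addr_ge0 // ltW.
have e1 := emesh_le1 lam0 lammu N; have e0 := ltW (emesh_gt0 lam mu N).
have c : wexact N (Some true) + wexact N (Some false) <= x.
  rewrite /wexact /= -!mulrDl /x ler_wpM2r ?invr_ge0 //.
  by have := mulr_ge0 (addr_ge0 (ltW lam0) (ltW mu0)) (_ : 0 <= 1 - emesh lam mu N); rewrite subr_ge0 => /(_ e1); lra.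
have H := not_spread_mass K (wexact_ge0 N) (wexact_sum N) c.
have T : 1 - K%:R * x ^+ 2 <= ex (wexact N) K (fun=> 1).
  have s2 : 1 - x ^+ 2 <= \sum_s wexact N s.
    have -> : \sum_s wexact N s = (1 + x) * emesh lam mu N.
      by rewrite sum_sym /= /x; field; rewrite gt_eqF.
    have e2 : 1 - x <= emesh lam mu N by rewrite /emesh -/x; exact: expR_ge1Dx.
    by nra.
  have s3 : \sum_s wexact N s <= 1 by exact: wexact_sum.
  have s4 : 0 <= \sum_s wexact N s by apply: sumr_ge0 => s _; exact: wexact_ge0.
  have -> : ex (wexact N) K (fun=> 1) = (\sum_s wexact N s) ^+ K.
    elim: (K) => [//|k IH]; rewrite /= IH exprS mulr_suml; apply: eq_bigr => s _.
    by [].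
  elim: (K) => [|k IH]; first by rewrite mul0r subr0 expr0.
  have p1 : (\sum_s wexact N s) ^+ k <= 1 by rewrite exprn_ile1.
  have p0 : 0 <= (\sum_s wexact N s) ^+ k by rewrite exprn_ge0.
  rewrite (exprS (\sum_s wexact N s)) -natr1; move: IH p1 p0 s2 s3; set a := _ ^+ k; set g := \sum_s _ => IH p1 p0 s2 s3.
  have := mulr_ge0 (_ : 0 <= 1 - g) (_ : 0 <= 1 - a); rewrite !subr_ge0 => /(_ s3 p1).
  by nra.
have -> : ex (wexact N) K (fun s => ind R (spread s)) =
    ex (wexact N) K (fun=> 1) - ex (wexact N) K (fun s => ind R (~ spread s)).
  rewrite -exB; apply: eq_ex => w _; have [h|h] := pselect (spread w).
    by rewrite ind1 // ind0 ?subr0.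
  by rewrite ind0 // ind1 ?subrr.
by lra.
Qed.

End Law.

(** * Measurable majorants of the number of points unmatched up to a given time *)

Definition survives (r n K i : nat) (w : seq sym) : Prop :=
  [/\ nth None w i = Some true, avoid r n (shift i (nth None w)) &
      avoid r n (shift (K - i.+1) (nth None (rev w)))].

(** The letters on the right of [i] and the reversed letters on its left form independent words, so
    the two one-sided survivals multiply. *)
Lemma survives_mass (R : realFieldType) (v : sym -> R) r n i L :
  ex v (i + L.+1) (fun w => ind R (survives r n (i + L.+1) i w)) =
  v (Some true) * survival v r (Some true) n i * survival v r (Some true) n L.
Proof.
transitivity (ex v i (fun u => v (Some true) * survival v r (Some true) n L *
    ind R (avoid r n (cw (Some true) (rev u))))); last first.
  rewrite exZ /survival (ex_rev v i (fun u => ind R (avoid r n (cw (Some true) u)))).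
  by rewrite mulrAC.
rewrite ex_cat; apply: eq_ex => u su /=.
have E s w : size w = L -> ind R (survives r n (i + L.+1) i (u ++ s :: w)) =
    ind R (s = Some true) * (ind R (avoid r n (cw (Some true) (rev u))) * ind R (avoid r n (cw (Some true) w))).
  move=> sw; rewrite !indM; apply: ind_iff.
  have e1 : nth None (u ++ s :: w) i = s by rewrite nth_cat su ltnn subnn.
  have e2 x : shift i (nth None (u ++ s :: w)) x = cw s w x.
    by rewrite /shift nth_cat su ltnNge leq_addr /= addKn.
  have e3 x : shift (i + L.+1 - i.+1) (nth None (rev (u ++ s :: w))) x = cw s (rev u) x.
    rewrite /shift rev_cat rev_cons -cats1 -catA nth_cat size_rev sw.
    have -> : (i + L.+1 - i.+1 = L)%N by lia.
    by rewrite ltnNge leq_addr /= addKn.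
  rewrite /survives e1; split=> [[hs h1 h2]|[hs [h1 h2]]]; subst s; split=> //.
  - by split; [apply: eq_avoid h2|apply: eq_avoid h1].
  - by apply: eq_avoid h2 => x; rewrite e2.
  - by apply: eq_avoid h1 => x; rewrite e3.
have Z s : s <> Some true -> ex v L (fun w => ind R (survives r n (i + L.+1) i (u ++ s :: w))) = 0.
  by move=> hs; rewrite -[RHS](ex0 v L); apply: eq_ex => w sw; rewrite E // ind0 // mul0r.
rewrite sum_sym (Z None) // (Z (Some false)) // !mulr0 add0r addr0.
have -> : ex v L (fun w => ind R (survives r n (i + L.+1) i (u ++ Some true :: w))) =
   ind R (avoid r n (cw (Some true) (rev u))) * ex v L (fun w => ind R (avoid r n (cw (Some true) w))).
  by rewrite -exZ; apply: eq_ex => w sw; rewrite E // ind1 // mul1r.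
by rewrite /survival; ring.
Qed.

Section Majorant.
Variables (R : realType) (d : measure_display) (Omega : measurableType d)
  (P : probability Omega R) (lam mu : R)
  (B Rd : Omega -> set R) (M : Omega -> R -> option R).
Hypothesis lam0 : 0 < lam.
Hypothesis lammu : lam < mu.
Hypothesis pp : poisson_pair P lam mu B Rd.

(* [unmatched_avoid] at depth [r.*2] looks at most [room r n] cells away. *)
Definition room (r n : nat) : nat := (r.*2.+4 * n.+2)%N.
Definition width (r n N : nat) : nat := (room r n + N + room r n).+1.

(** The number of surviving indices in [[0, 1)], or [0] when no word is read. It is expressed
    through the events [readset] alone, which makes it measurable. *)
Definition scount (t : R) (r N : nat) (w : Omega) : \bar R :=
  let n := nmesh t N in
  (\sum_(i < N) \sum_(s : (width r n N).-tuple sym)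
    (ind R (survives r.*2 n (width r n N) (room r n + i) s))%:E *
    (\1_(readset B Rd N (room r n) (width r n N) s) w)%:E)%E.

Lemma scount_measurable t r N : measurable_fun setT (scount t r N).
Proof.
apply: emeasurable_sum => i.
exact: (@words_measurable R d Omega P lam mu B Rd pp N (room r (nmesh t N)) (width r (nmesh t N) N)
  (fun s => ind R (survives r.*2 (nmesh t N) (width r (nmesh t N) N) (room r (nmesh t N) + i) s))).
Qed.

Lemma scount_ge0 t r N w : (0 <= scount t r N w)%E.
Proof.
apply: sume_ge0 => i _; apply: sume_ge0 => s _; rewrite mule_ge0 // lee_fin; exact: ind_ge0.
Qed.

Lemma scount_int t r N (Y : R) : (0 < N)%N ->
  (forall x, 0 <= wmesh lam mu N x) ->
  (forall K, (r.*2 * nmesh t N <= K)%N ->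
     survival (wmesh lam mu N) r.*2 (Some true) (nmesh t N) K <= Y) ->
  (\int[P]_w scount t r N w <= (lam * Y ^+ 2)%:E)%E.
Proof.
move=> N_gt0 w0 sY; set n := nmesh t N.
have n0 : (0 : R) < N%:R by rewrite ltr0n.
rewrite /scount ge0_integral_sum //; last 2 first.
- move=> i; exact: (@words_measurable R d Omega P lam mu B Rd pp N (room r n) (width r n N)
    (fun s => ind R (survives r.*2 n (width r n N) (room r n + i) s))).
- by move=> i w _; apply: sume_ge0 => s _; rewrite mule_ge0 // lee_fin //; exact: ind_ge0.
apply: (@le_trans _ _ (\sum_(i < N) (wmesh lam mu N (Some true) * Y ^+ 2)%:E)%E).
  apply: lee_sum => i _.
  have a0 s : 0 <= ind R (survives r.*2 n (width r n N) (room r n + i) s) by exact: ind_ge0.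
  rewrite (int_words lam0 lammu pp (room r n) (width r n N) N_gt0 a0) lee_fin.
  apply: (@le_trans _ _ (ex (wmesh lam mu N) (width r n N)
     (fun s => ind R (survives r.*2 n (width r n N) (room r n + i) s)))).
    by apply: ex_le => [s|s _]; rewrite ?lexx ?a0 // wexact_ge0 // wexact_le.
  have iN := ltn_ord i.
  have -> : width r n N = (room r n + i + (N - i.+1 + room r n).+1.+1)%N by rewrite /width; lia.
  rewrite survives_mass -mulrA ler_wpM2l // expr2.
  have s0 K : 0 <= survival (wmesh lam mu N) r.*2 (Some true) n K by apply: survival_ge0.
  by apply: ler_pM; rewrite // sY // -/n /room; nia.
rewrite sumEFin lee_fin sumr_const card_ord -mulr_natl /=.
have -> : N%:R * (lam * emesh lam mu N / N%:R * Y ^+ 2) = lam * emesh lam mu N * Y ^+ 2.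
  by field; rewrite gt_eqF.
rewrite ler_wpM2r ?sqr_ge0 // -[leRHS]mulr1 ler_wpM2l ?(ltW lam0) ?(emesh_le1 lam0 lammu) //.
Qed.

(** Distinct members of [s] occupy distinct cells, because a cell holds at most one blue point, and
    each of these cells survives by [real_avoid]. *)
Lemma scount_ge t r N w (s : seq R) : 0 <= t -> (0 < N)%N ->
  is_stable_matching (B w) (Rd w) (M w) ->
  goodset B Rd N (room r (nmesh t N)) (width r (nmesh t N) N) w ->
  uniq s -> (forall b, b \in s -> [/\ B w b, 0 <= b < 1 & (t%:E < match_dist (M w) b)%E]) ->
  ((size s)%:R%:E <= scount t r N w)%E.
Proof.
move=> t0 N_gt0 st [W /= spW rW] us hs; set n := nmesh t N in rW *.
have n0 : (0 : R) < N%:R by rewrite ltr0n.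
have tK := size_tuple W.
have nt : n = 0%N \/ (n.+1%:R <= t * N%:R :> R).
  have h : 0 <= t * N%:R by rewrite mulr_ge0 // ltW.
  have /andP[h1 _] := truncn_itv h.
  rewrite /n /nmesh; case: (Num.truncn _) h1 => [|m] h1; [by left|by right].
have idx b : b \in s -> exists2 i : 'I_N, @cell R N (room r n) (room r n + i) b &
    survives r.*2 n (width r n N) (room r n + i) W.
  move=> /hs[Bb /andP[b0 b1] far].
  have bN : b * N%:R < N%:R by rewrite -[ltRHS]mul1r ltr_pM2r.
  have bN0 : 0 <= b * N%:R by rewrite mulr_ge0 // ltW.
  have rm0 : (0 : R) <= (room r n)%:R by [].
  have [||i iK ci] := @cell_of R N (room r n) (width r n N) N_gt0 b.
  - lra.
  - rewrite /width -natr1 !natrD; lra.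
  have /(cellP _ N_gt0) /andP[c1 c2] := ci.
  have i1 : (room r n <= i)%N.
    by rewrite -ltnS -(ltr_nat R) -natr1; lra.
  have i2 : (i < room r n + N)%N.
    by rewrite -(ltr_nat R) natrD; lra.
  have i3 : (i - room r n < N)%N by rewrite ltn_subLR.
  exists (Ordinal i3); rewrite /= subnKC //.
  have [||h1 h2 h3] := real_avoid N_gt0 st tK rW spW nt (r := r) Bb far _ _ ci.
  - exact: i1.
  - by rewrite /width ltnS leq_add2r ltnW.
  by split=> //; rewrite tK in h3.
have pcell b b' (i : 'I_N) : b \in s -> b' \in s -> @cell R N (room r n) (room r n + i) b ->
    @cell R N (room r n) (room r n + i) b' -> b = b'.
  move=> /hs[Bb _ _] /hs[Bb' _ _] cb cb'.
  have iK : (room r n + i < width r n N)%N by have := ltn_ord i; rewrite /width; lia.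
  have [_ <-] := cell_blue rW iK cb Bb.
  by have [_ <-] := cell_blue rW iK cb' Bb'.
have N1 : (0 < N)%N by [].
(* A choice of surviving cell for each member of [s]; by [idx] the default ordinal is never taken on
   [s]. *)
pose g b : 'I_N := xget (Ordinal N1) [set i : 'I_N | @cell R N (room r n) (room r n + i) b /\
    survives r.*2 n (width r n N) (room r n + i) W].
have gP b : b \in s -> @cell R N (room r n) (room r n + g b) b /\
    survives r.*2 n (width r n N) (room r n + g b) W.
  move=> /idx[i h1 h2]; rewrite /g; apply: (@xgetPex _ (Ordinal N1) [set i : 'I_N | @cell R N (room r n) (room r n + i) b /\
    survives r.*2 n (width r n N) (room r n + i) W]).
  by exists i.
have ug : uniq (map g s).
  rewrite map_inj_in_uniq // => b b' hb hb' e.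
  have [c1 _] := gP b hb; have [c2 _] := gP b' hb'.
  by apply: (pcell b b' (g b)) => //; rewrite e.
apply: (@le_trans _ _ (\sum_(i < N) (ind R (survives r.*2 n (width r n N) (room r n + i) W))%:E)%E).
  rewrite sumEFin lee_fin -(size_map g) -(card_uniqP ug) -sum1_card natr_sum.
  rewrite [leRHS](bigID (mem (map g s))) /= -[leLHS]addr0 lerD //.
    apply: ler_sum => i /mapP[b hb ->]; rewrite ind1 //.
    by have [] := gP b hb.
  by apply: sumr_ge0 => i _; exact: ind_ge0.
apply: lee_sum => i _; rewrite (bigD1 W) //= indicE mem_set // mule1 leeDl //.
apply: sume_ge0 => s' _; rewrite mule_ge0 // lee_fin //; exact: ind_ge0.
Qed.

End Majorant.

(* Fatou for [G = liminf f_j], and Borel-Cantelli for the exceptional sets [F_j]. *)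
Lemma eventual_majorant (R : realType) (d : measure_display) (T : measurableType d)
  (P : probability T R) (f : nat -> T -> \bar R) (F : nat -> set T) (c C : R) :
  (forall j, measurable_fun setT (f j)) -> (forall j w, (0 <= f j w)%E) ->
  (forall j, (\int[P]_w f j w <= c%:E)%E) ->
  (forall j, measurable (F j)) -> (forall j, (P (F j) <= (C / 2 ^+ j)%:E)%E) ->
  exists G : T -> \bar R, [/\ measurable_fun setT G, forall w, (0 <= G w)%E,
    (\int[P]_w G w <= c%:E)%E &
    {ae P, forall w, forall x, (forall j, ~ F j w -> (x <= f j w)%E) -> (x <= G w)%E}].
Proof.
move=> mf f0 fc mF FC; pose G w := limn_einf (f^~ w).
have le_G w x n : (forall j, (n <= j)%N -> (x <= f j w)%E) -> (x <= G w)%E.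
  move=> h; rewrite /G limn_einf_lim; apply: lime_ge; first exact: is_cvg_einfs.
  near=> m; apply: le_ereal_inf_tmp => _ [p /= pm <-]; apply: h; apply: leq_trans pm.
  by near: m; exists n.
exists G; split.
- apply: (@emeasurable_fun_cvg _ _ _ setT (fun n x => einfs (f ^~ x) n)) => [n|w _]; first exact: measurable_fun_einfs.
  by rewrite /G limn_einf_lim; exact: is_cvg_einfs.
- by move=> w; apply: (le_G w 0%E 0%N) => j _.
- apply: (le_trans (fatou P measurableT mf (fun j w _ => f0 j w))).
  rewrite limn_einf_lim; apply: lime_le; first exact: is_cvg_einfs.
  apply: nearW => m; apply: (le_trans _ (fc m)); apply: ereal_inf_lbound.
  by exists m => /=.
- have S : (\sum_(n <oo) P (F n) < +oo)%E.
    apply: (@le_lt_trans _ _ (2 * C)%:E); last exact: ltry.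
    apply: lime_le; first by apply: is_cvg_nneseries => n _ _; exact: measure_ge0.
    apply: nearW => m; apply: (@le_trans _ _ (\sum_(0 <= i < m) (C / 2 ^+ i)%:E)%E).
      by apply: lee_sum => i _; exact: FC.
    have C0 : 0 <= C.
      by have := le_trans (measure_ge0 P (F 0%N)) (FC 0%N); rewrite lee_fin expr0 divr1.
    rewrite sumEFin lee_fin (_ : \sum_(0 <= i < m) C / 2 ^+ i = 2 * C - 2 * C / 2 ^+ m).
      by rewrite lerBlDr lerDl divr_ge0 // mulr_ge0.
    elim: m => [|m IH]; first by rewrite big_nil expr0 divr1 subrr.
    by rewrite big_nat_recr //= IH exprS; field; rewrite expf_neq0.
  have mL : measurable (lim_sup_set F).
    by apply: bigcap_measurable => // n _; apply: bigcup_measurable => j _; exact: mF.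
  exists (lim_sup_set F); split => //; first exact: lim_sup_set_cvg0.
  move=> w /= /existsNP[x /not_implyP[hx nx]] n _; apply: contrapT => nF; apply: nx.
  apply: (le_G w x n) => j nj; apply: hx => Fj; apply: nF.
  by exists j.
Unshelve. all: by end_near. Qed.

Section TimeMajorant.
Variables (R : realType) (d : measure_display) (Omega : measurableType d)
  (P : probability Omega R) (lam mu : R)
  (B Rd : Omega -> set R) (M : Omega -> R -> option R).
Hypothesis lam0 : 0 < lam.
Hypothesis lammu : lam < mu.
Hypothesis pp : poisson_pair P lam mu B Rd.
Hypothesis stable : {ae P, forall w, is_stable_matching (B w) (Rd w) (M w)}.

Lemma wmesh_ge0 N x : 0 <= wmesh lam mu N x.
Proof. by apply: le_trans (wexact_le lam mu N x); exact: wexact_ge0. Qed.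

Lemma width_le (t : R) r N : 0 <= t -> (0 < N)%N ->
  (width r (nmesh t N) N)%:R <= (2 * r.*2.+4%:R * (t + 2) + 2) * N%:R.
Proof.
move=> t0 N_gt0; have N1 : (1 : R) <= N%:R by rewrite ler1n.
have nle := nmesh_le N t0; have r0 : (0 : R) <= r.*2.+4%:R by [].
rewrite /width /room -[in leLHS]natr1 !natrD natrM -[in (nmesh t N).+2%:R]addn2 natrD.
move: nle r0; set n := (nmesh t N)%:R; set q := r.*2.+4%:R => nle r0.
have := ler_wpM2l r0 (_ : n + 2 <= (t + 2) * N%:R); rewrite mulrDl => /(_ ltac:(lra)).
by lra.
Qed.

(** The number of cells is at most [c * N], so both terms of [spread_mass] are of order [1 / N]. *)
Lemma goodset_fail (t : R) r N (c : R) : 0 <= t -> (0 < N)%N ->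
  c = 2 * r.*2.+4%:R * (t + 2) + 2 ->
  (P (~` goodset B Rd N (room r (nmesh t N)) (width r (nmesh t N) N)) <=
    ((c * (lam + mu) ^+ 2 + 3 * c ^+ 2 * (lam + mu) ^+ 3) / N%:R)%:E)%E.
Proof.
move=> t0 N_gt0 cE; have n0 : (0 : R) < N%:R by rewrite ltr0n.
have := goodset_prob lam0 lammu pp (room r (nmesh t N)) (width r (nmesh t N) N) N_gt0.
move=> /le_trans; apply; rewrite lee_fin; apply: (le_trans (spread_mass lam0 lammu _ N_gt0)).
have := width_le r t0 N_gt0; rewrite -cE; set K := (width _ _ _)%:R => Kc.
have K0 : 0 <= K by [].
have S0 : 0 <= lam + mu by have := lam0; have := lammu; lra.
have -> : (c * (lam + mu) ^+ 2 + 3 * c ^+ 2 * (lam + mu) ^+ 3) / N%:R =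
   (c * N%:R) * ((lam + mu) / N%:R) ^+ 2 + 3 * (c * N%:R) ^+ 2 * ((lam + mu) / N%:R) ^+ 3.
  by field; rewrite gt_eqF.
have x0 : 0 <= (lam + mu) / N%:R by rewrite divr_ge0 // ltW.
apply: lerD; first by apply: ler_wpM2r Kc; exact: exprn_ge0.
apply: ler_wpM2r; first exact: exprn_ge0.
by apply: ler_wpM2l => //; apply: lerXn2r => //; exact: le_trans Kc.
Qed.

(** Finite lists [s] stand for the set of late blue points, and a single null set serves all of
    them; [G] replaces their number by a measurable function. *)
Lemma time_majorant (t eta : R) : 0 <= t -> 0 < eta ->
  exists G : Omega -> \bar R, [/\ measurable_fun setT G, forall w, (0 <= G w)%E,
    (\int[P]_w G w <= (lam * (ybar lam mu t + eta) ^+ 2)%:E)%E &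
    {ae P, forall w, forall s : seq R, uniq s ->
      (forall b, b \in s -> [/\ B w b, 0 <= b < 1 & (t%:E < match_dist (M w) b)%E]) ->
      ((size s)%:R%:E <= G w)%E}].
Proof.
move=> t0 eta0; have [r [j0 _ hj]] := survival_limit lam0 lammu t0 eta0.
(* Powers of two make the failure probabilities of [goodset_fail] summable, and [j0] starts the
   meshes in the range of [survival_limit]. *)
pose N j := (2 ^ (j + j0))%N.
have N0 j : (0 < N j)%N by rewrite expn_gt0.
pose bad j := ~` goodset B Rd (N j) (room r (nmesh t (N j))) (width r (nmesh t (N j)) (N j)).
pose c : R := 2 * r.*2.+4%:R * (t + 2) + 2.
pose C := c * (lam + mu) ^+ 2 + 3 * c ^+ 2 * (lam + mu) ^+ 3.
have c0 : 0 <= c by rewrite addr_ge0 // !mulr_ge0 // addr_ge0.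
have S0 : 0 <= lam + mu by have := lam0; have := lammu; lra.
have C0 : 0 <= C by rewrite addr_ge0 // !mulr_ge0 // exprn_ge0.
have [|||||G [mG G0 intG aeG]] := @eventual_majorant R d Omega P
    (fun j => scount B Rd t r (N j)) bad (lam * (ybar lam mu t + eta) ^+ 2) C.
- by move=> j; exact: (scount_measurable pp).
- by move=> j w; exact: scount_ge0.
- move=> j; apply: (scount_int lam0 lammu pp) => //; first exact: wmesh_ge0.
  have := hj (N j).-1; rewrite /= prednK //; apply.
  rewrite -ltnS prednK //; apply: (leq_trans (ltn_expl j0 (ltnSn 1))).
  by rewrite leq_exp2l // leq_addl.
- by move=> j; apply: measurableC; exact: (goodset_measurable pp).
- move=> j; apply: (le_trans (goodset_fail (r := r) (c := c) t0 (N0 j) erefl)).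
  rewrite lee_fin -/C; apply: ler_wpM2l => //.
  by rewrite /N natrX lef_pV2 ?posrE ?exprn_gt0 // ler_weXn2l ?ler1n ?leq_addr.
exists G; split => //.
move: stable aeG; apply: filterS2 => w st h s us hs; apply: h => j nb.
apply: (scount_ge lam0 lammu t0 (N0 j) st _ us hs).
by apply: contrapT.
Qed.

End TimeMajorant.

(** * Summation over time levels and the mean matching distance *)

(** The partial sums grow by [tau] per step until they reach [X]. If they never do, they are
    unbounded and the series is infinite. *)
Lemma layer_cake (R : realType) (tau : R) (X : \bar R) : 0 < tau ->
  (X <= \sum_(j <oo) (tau *+ ((j%:R * tau)%:E < X)%E)%:E)%E.
Proof.
move=> tau0; pose f j : \bar R := (tau *+ ((j%:R * tau)%:E < X)%E)%:E.
have f0 j : (0 <= f j)%E by rewrite lee_fin mulrn_wge0 // ltW.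
have part J : (\sum_(0 <= j < J) f j <= \sum_(j <oo) f j)%E.
  by apply: nneseries_lim_ge => j _ _; exact: f0.
have step J : (X <= \sum_(0 <= j < J) f j)%E \/ (\sum_(0 <= j < J) f j)%E = (J%:R * tau)%:E.
  elim: J => [|J [le|eq]]; first by right; rewrite big_nil mul0r.
    by left; rewrite big_nat_recr //=; apply: (le_trans le); rewrite leeDl.
  have [le|lt] := leP X (J%:R * tau)%:E.
    by left; rewrite big_nat_recr //= eq; apply: (le_trans le); rewrite leeDl.
  by right; rewrite big_nat_recr //= eq /f lt mulr1n -EFinD -natr1 mulrDl mul1r.
have [[J le]|none] := pselect (exists J, (X <= \sum_(0 <= j < J) f j)%E).
  exact: le_trans le (part J).
have big J : ((J%:R * tau)%:E <= \sum_(j <oo) f j)%E.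
  by apply: le_trans (part J); have [le|->] := step J => //; case: none; exists J.
rewrite -/f; case E : (\sum_(j <oo) f j)%E big => [S| |] big; last 2 first.
- exact: leey.
- by have := big 0%N.
have S0 : 0 <= S by have := big 0%N; rewrite mul0r lee_fin.
have := big (Num.truncn (S / tau)).+1; rewrite lee_fin.
have /andP[_ h] := truncn_itv (divr_ge0 S0 (ltW tau0)).
by rewrite leNgt -ltr_pdivrMr // h.
Qed.

Lemma sqr_slack (R : realFieldType) (y delta : R) : 0 < delta ->
  exists2 eta, 0 < eta & (y + eta) ^+ 2 <= y ^+ 2 + delta.
Proof.
move=> d0; have k0 : 0 < 2 * `|y| + 1 by rewrite ltr_wpDl // mulr_ge0.
have a0 : 0 < delta / (2 * `|y| + 1) by rewrite divr_gt0.
exists (Num.min 1 (delta / (2 * `|y| + 1))); first by rewrite lt_min ltr01.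
set e := Num.min _ _.
have e1 : e <= 1 by rewrite ge_min lexx.
have e2 : e * (2 * `|y| + 1) <= delta by rewrite -ler_pdivlMr // ge_min lexx orbT.
have e0 : 0 <= e by rewrite le_min ler01 ltW.
have := ler_wpM2l e0 (ler_norm y); have := ler_wpM2l e0 e1.
by lra.
Qed.

Section MeanDistance.
Variables (R : realType) (d : measure_display) (Omega : measurableType d)
  (P : probability Omega R) (lam mu : R)
  (B Rd : Omega -> set R) (M : Omega -> R -> option R).
Hypothesis lam0 : 0 < lam.
Hypothesis lammu : lam < mu.
Hypothesis pp : poisson_pair P lam mu B Rd.
Hypothesis stable : {ae P, forall w, is_stable_matching (B w) (Rd w) (M w)}.

Let F w : \bar R := (\esum_(b in B w `&` `[0%R, 1%R[) match_dist (M w) b)%E.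
Hypothesis mF : measurable_fun setT F.

Lemma match_dist_ge0 (m : R -> option R) b : (0 <= match_dist m b)%E.
Proof. by rewrite /match_dist; case: (m b) => [y|] //; rewrite lee_fin. Qed.

(** Applies [layer_cake] to each point of a finite subset and exchanges the sum over points with the
    series over levels. *)
Lemma total_le_layers (tau : R) (G : nat -> \bar R) w : 0 < tau ->
  (forall j, 0 <= G j)%E ->
  (forall j (s : seq R), uniq s ->
     (forall b, b \in s -> [/\ B w b, 0 <= b < 1 & ((j%:R * tau)%:E < match_dist (M w) b)%E]) ->
     ((size s)%:R%:E <= G j)%E) ->
  (F w <= \sum_(j <oo) (tau%:E * G j))%E.
Proof.
move=> tau0 G0 hG; apply: ub_ereal_sup => _ [A [finA AS] <-].
rewrite fsbig_finite //; set s : seq R := fset_set A.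
have sA b : b \in s -> B w b /\ 0 <= b < 1.
  rewrite /s in_fset_set // => /set_mem/AS[Bb]; rewrite /= in_itv /= => /andP[-> ->].
  by [].
apply: (@le_trans _ _ (\sum_(b <- s) \sum_(j <oo) (tau *+ ((j%:R * tau)%:E < match_dist (M w) b)%E)%:E)%E).
  by apply: lee_sum => b _; exact: layer_cake.
rewrite -nneseries_sum; last by move=> b j _; rewrite lee_fin mulrn_wge0 // ltW.
apply: lee_nneseries => [j _ _|j _].
  by apply: sume_ge0 => b _; rewrite lee_fin mulrn_wge0 // ltW.
have -> : (\sum_(b <- s) (tau *+ ((j%:R * tau)%:E < match_dist (M w) b)%E)%:E)%E =
   (tau%:E * (size [seq b <- s | ((j%:R * tau)%:E < match_dist (M w) b)%E])%:R%:E)%E.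
  rewrite sumEFin -EFinM; congr (_%:E).
  rewrite size_filter -sum1_count natr_sum mulr_sumr [RHS]big_mkcond /=.
  by apply: eq_bigr => b _; case: ifP; rewrite ?mulr1n ?mulr1.
apply: lee_wpmul2l; first by rewrite lee_fin ltW.
apply: hG; first by rewrite filter_uniq // fset_uniq.
by move=> b; rewrite mem_filter => /andP[h /sA[]].
Qed.

(** One [tau] is the Riemann sum error in [ybar_series]. The other pays for the slack of
    [time_majorant], chosen at level [j] to add at most [2^-(j+1)] to the squared survival bound. *)
Lemma mean_total_le (tau : R) : 0 < tau ->
  (\int[P]_w F w <= (lam * (2 * tau + (mu - lam)^-1))%:E)%E.
Proof.
move=> tau0.
pose y (j : nat) : R := ybar lam mu (j%:R * tau).
have h2 j : 0 < (2 ^+ j.+1 : R)^-1 by rewrite invr_gt0 exprn_gt0.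
have /choice[G hG] : forall j : nat, exists G : Omega -> \bar R,
  [/\ measurable_fun setT G, forall w, (0 <= G w)%E,
    (\int[P]_w G w <= (lam * (y j ^+ 2 + (2 ^+ j.+1)^-1))%:E)%E &
    {ae P, forall w, forall s : seq R, uniq s ->
      (forall b, b \in s -> [/\ B w b, 0 <= b < 1 & ((j%:R * tau)%:E < match_dist (M w) b)%E]) ->
      ((size s)%:R%:E <= G w)%E}].
  move=> j; have [eta eta0 le] := sqr_slack (y j) (h2 j).
  have jt : 0 <= j%:R * tau by rewrite mulr_ge0 // ltW.
  have [G [mG G0 intG aeG]] := time_majorant lam0 lammu pp stable jt eta0.
  exists G; split => //; apply: (le_trans intG); rewrite lee_fin.
  by apply: ler_wpM2l le; exact: ltW.
have mG j : measurable_fun setT (fun w => (tau%:E * G j w)%E).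
  by apply: measurable_funeM; have [] := hG j.
have G0 j w : (0 <= tau%:E * G j w)%E.
  by apply: mule_ge0; [rewrite lee_fin ltW|have [] := hG j].
have dom : {ae P, forall w, (F w <= \sum_(j <oo) (tau%:E * G j w))%E}.
  have /ae_foralln : forall j, {ae P, forall w, forall s : seq R, uniq s ->
      (forall b, b \in s -> [/\ B w b, 0 <= b < 1 & ((j%:R * tau)%:E < match_dist (M w) b)%E]) ->
      ((size s)%:R%:E <= G j w)%E} by move=> j; have [] := hG j.
  apply: filterS => w hw; apply: total_le_layers => // j.
  by have [] := hG j.
apply: (@le_trans _ _ (\int[P]_w (\sum_(j <oo) (tau%:E * G j w)))%E).
  apply: ae_ge0_le_integral => //.
  - by move=> w _; apply: esum_ge0 => b _; exact: match_dist_ge0.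
  - by move=> w _; apply: nneseries_ge0 => j _ _; exact: G0.
  - by apply: ge0_emeasurable_sum => // j _; exact: mG.
  - by move: dom; apply: filterS => w hw _.
rewrite integral_nneseries //.
apply: lime_le; first by apply: is_cvg_nneseries => j _ _; exact: integral_ge0.
apply: nearW => J.
apply: (@le_trans _ _ (\sum_(0 <= j < J) (tau * (lam * (y j ^+ 2 + (2 ^+ j.+1)^-1)))%:E)%E).
  apply: lee_sum => j _; have [mGj G0j intG _] := hG j.
  rewrite ge0_integralZl_EFin //; last exact: ltW.
  by rewrite [leRHS]EFinM; apply: lee_wpmul2l => //; rewrite lee_fin ltW.
rewrite sumEFin lee_fin big_mkord.
have -> : \sum_(j < J) tau * (lam * (y j ^+ 2 + (2 ^+ j.+1)^-1)) =
  lam * (\sum_(j < J) tau * y j ^+ 2 + tau * \sum_(j < J) (2 ^+ j.+1)^-1).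
  rewrite mulr_sumr -big_split mulr_sumr; apply: eq_bigr => j _ /=.
  by rewrite -mulrDr mulrCA.
apply: ler_wpM2l; first exact: ltW.
have geo : \sum_(j < J) (2 ^+ j.+1 : R)^-1 <= 1.
  rewrite (_ : \sum_(j < J) _ = 1 - (2 ^+ J)^-1); first by rewrite gerBl invr_ge0 exprn_ge0.
  elim: J => [|J IH]; first by rewrite big_ord0 expr0 invr1 subrr.
  by rewrite big_ord_recr /= IH exprS; field; rewrite expf_neq0.
have := ybar_series lam0 lammu J tau0; rewrite -/(y _).
have := ler_wpM2l (ltW tau0) geo; rewrite mulr1 /y; lra.
Qed.

End MeanDistance.

Theorem theorem4p7 (R : realType) (d : measure_display) (Omega : measurableType d)
  (P : probability Omega R) (lam mu : R)
  (B Rd : Omega -> set R) (M : Omega -> R -> option R) :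
  0 < lam -> lam < mu ->
  poisson_pair P lam mu B Rd ->
  {ae P, forall w, is_stable_matching (B w) (Rd w) (M w)} ->
  measurable_fun [set: Omega]
    (fun w : Omega => (\esum_(b in B w `&` `[0%R, 1%R[) match_dist (M w) b : \bar R)) ->
  ((lam^-1)%:E *
     \int[P]_w (\esum_(b in B w `&` `[0%R, 1%R[) match_dist (M w) b)
   <= ((1 + ln ((mu + lam) / (mu - lam))) / (mu - lam))%:E)%E.
Proof.
move=> lam0 lammu pp stable mF.
have e0 : 0 < mu - lam by rewrite subr_gt0.
set K := ln _; have K0 : 0 < K by rewrite ln_gt0 // ltr_pdivlMr // mul1r; lra.
(* This mesh makes [2 * tau] equal to the logarithmic term of the bound. *)
pose tau := K / (mu - lam) / 2.
have tau0 : 0 < tau by rewrite !divr_gt0.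
have := mean_total_le lam0 lammu pp stable mF tau0.
have li : (0 <= (lam^-1)%:E :> \bar R)%E by rewrite lee_fin invr_ge0 ltW.
move=> /(lee_wpmul2l li) /le_trans; apply.
rewrite -EFinM lee_fin /tau le_eqVlt; apply/orP; left; apply/eqP.
by field; rewrite !gt_eqF.
Qed.
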